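(* Let $p>1$, $q=p/(p-1)$, let $\mathcal X=\{0\}\times(\mathbb R^d)^N$, and let $\mu\in\mathscr M(\mathcal X)$ be a martingale measure with finite $p$-th moment. Assume: (i) $L:[0,+\infty)\to[0,+\infty]$ is continuous, non-decreasing, $L(0)=0$ and $\liminf_{u\to\infty}L(u)/u^p=+\infty$; (ii) $f:\mathcal X\to\mathbb R$ is continuously differentiable and there is a constant $C$ such that $|\mathbb D f(x)|\le C(1+|x|^{p-1})$ for all $x\in\mathcal X$. For $\delta>0$ let $$V_{\mathrm{Mart}}(\delta)=\sup_{\nu\in\mathscr M(\mathcal X)}\Big\{E_\nu[f(X)]-L_\delta\big(d_{\mathfrak{bc}}(\mu,\nu)^{1/p}\big)\Big\},\qquad V_{\mathrm{Mart}}(0)=E_\mu[f(X)].$$ Let $\mathscr H$ be the set of $\mathbb R^d$-valued predictable processes $h=(h_n)_{n=1}^N$ with $\|h\|_{L^q(\mu)}=\big(\sum_{n=1}^NE_\mu[|h_n|_*^q]\big)^{1/q}<\infty$. Then, as $\delta\to0^+$, $$V_{\mathrm{Mart}}(\delta)=V_{\mathrm{Mart}}(0)+\Upsilon_{\mathrm{Mart}}\,\delta+o(\delta),$$ where $$\Upsilon_{\mathrm{Mart}}=L^*\left(\inf_{h\in\mathscr H}E_\mu\Big[\sum_{n=1}^N\big|E_\mu[\mathbb D_nf(X)\mid\mathcal F_n]-h_n\big|_*^q\Big]^{1/q}\right).$$ In particular, if $p=2$, then $$\Upsilon_{\mathrm{Mart}}=L^*\left(E_\mu\Big[\sum_{n=1}^N\big|E_\mu[\mathbb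 D_nf(X)\mid\mathcal F_n]-E_\mu[\mathbb D_nf(X)\mid\mathcal F_{n-1}]\big|_*^2\Big]^{1/2}\right).$$
   Context: Time index set $I=\{0,1,\dots,N\}$, $N,d\ge1$. $\mathcal X=\{0\}\times(\mathbb R^d)^N$, with elements $x=(x_0=0,x_1,\dots,x_N)$; $X=(X_n)_{n\in I}$ is the canonical process and $(\mathcal F_n)_{n\in I}$ its natural filtration. $\mathscr M(\mathcal X)$ is the set of Borel probability measures on $\mathcal X$ under which $X$ is an $(\mathcal F_n)$-martingale. A process $h$ is predictable if $h_n$ is $\mathcal F_{n-1}$-measurable for $n=1,\dots,N$. On $\mathbb R^d$, $|\cdot|$ is the $l_p$-norm and $|\cdot|_*$ the $l_q$-norm; in the growth condition, $|x|$ and $|\mathbb Df(x)|$ denote (any) norms on the corresponding finite-dimensional spaces. Discrete Malliavin derivative: $\mathbb D f=(\mathbb D_1f,\dots,\mathbb D_Nf)$, $\mathbb D_n f=\sum_{k=n}^N\partial_kf$, where $\partial_k f\in\mathbb R^d$ is the gradient of $f$ with respect to $x_k$. Bicausal couplings: let $(\mathcal Y,(\mathcal G_n)_{n\in I})$ be a copy of $(\mathcal X,(\mathcal F_n)_{n\in I})$ with canonical process $Y$. $\Pi(\mu,\nu)$ is the set of couplings of $\mu$ and $\nu$. A coupling $\pi\in\Pi(\mu,\nu)$, disintegrated as $\pi(dx,dy)=\mu(dx)\pi_y(x,dy)$, is causal from $\mu$ to $\nu$ if for every $n\in I$ and $U\in\mathcal G_n$ the map $x\mapsto\pi_y(x,U)$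 is measurable with respect to the $\mu$-completion of $\mathcal F_n$. It is bicausal if in addition its image under $(x,y)\mapsto(y,x)$ is causal from $\nu$ to $\mu$. $\Pi_{\mathfrak{bc}}(\mu,\nu)$ is the set of bicausal couplings. Transport cost: $d_{\mathfrak{bc}}(\mu,\nu)=\inf_{\pi\in\Pi_{\mathfrak{bc}}(\mu,\nu)}E_\pi[c_N(X,Y)]$ with $c_N(x,y)=\sum_{n=1}^N|\Delta x_n-\Delta y_n|^p$, $\Delta x_n=x_n-x_{n-1}$. Penalty: $L_\delta(u)=\delta L(u/\delta)$, with $L(+\infty)=+\infty$; measures $\nu$ with infinite penalty contribute $-\infty$ to the supremum. $L^*(v)=\sup_{u\ge0}\{uv-L(u)\}$. *)

(* Defs.v *)
From mathcomp Require Export all_boot all_order all_algebra.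
From mathcomp Require Export all_classical all_reals all_analysis measurable_realfun.

Set Implicit Arguments.
Unset Strict Implicit.
Unset Printing Implicit Defensive.

Export Order.TTheory GRing.Theory Num.Theory.
Export numFieldNormedType.Exports.

Local Open Scope classical_set_scope.
Local Open Scope ring_scope.

(* A topological space with its Borel sigma-algebra. *)
Notation borel T := (@g_sigma_algebraType T open).

(* The path space {0} x (R^d)^N: the path (0, x_1, ..., x_N) is encoded by the
   N x d matrix whose row number k : 'I_N (counted from 0) is x_(k+1). *)
Notation pathspace R N d := (borel 'M[R]_(N, d)).

(* The time index set {0, ..., N} is 'I_N.+1.  A time n in {1, ..., N} is given
   by k : 'I_N with n = k + 1. *)
Notation this_time k := (lift ord0 k).
Notation prev_time k := (widen_ord (leqnSn _) k).

Section Paths.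
Variables (R : realType) (N d : nat).
Implicit Types (x : 'M[R]_(N, d)) (k : 'I_N).

(* unlift ord0 n is None if n = 0, and Some k if n = k + 1. *)
Definition Xt (n : 'I_N.+1) x : 'rV[R]_d :=
  if unlift ord0 n is Some k then row k x else 0.

Definition incr k x : 'rV[R]_d := Xt (this_time k) x - Xt (prev_time k) x.

(* Ft n = sigma(X_0, ..., X_n) *)
Definition Ft (n : 'I_N.+1) : set (set (pathspace R N d)) :=
  <<s \bigcup_(m in [set m : 'I_N.+1 | (m <= n)%N])
        preimage_set_system setT (Xt m) (@measurable _ (borel 'rV[R]_d)) >>.

End Paths.

(* measurability with respect to a sub-sigma-algebra G of the domain *)
Definition measurable_wrt (T : Type) d' (U : measurableType d')
    (G : set (set T)) (g : T -> U) : Prop :=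
  forall B : set U, measurable B -> G (g @^-1` B).

Section CondExp.
Local Open Scope ereal_scope.
Context d (T : measurableType d) (R : realType).
Variables (P : probability T R) (G : set (set T)).

Definition is_condE (g h : T -> R) : Prop :=
  [/\ measurable_wrt G h, P.-integrable setT (EFin \o h) &
      forall A, G A -> \int[P]_(x in A) (h x)%:E = \int[P]_(x in A) (g x)%:E].

(* A version of E_P[g | G].  The default value is not reached when G is a
   sub-sigma-algebra and g is integrable, by the Radon-Nikodym theorem. *)
Definition condE (g : T -> R) : T -> R := xget (cst 0%R) [set h | is_condE g h].

Definition condE_rV m (g : T -> 'rV[R]_m) (x : T) : 'rV[R]_m :=
  \row_i condE (fun y => g y 0%R i) x.

(* The P-completion of G: the sets that differ from a set of G by a P-negligible set. *)
Definition completion : set (set T) :=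
  [set A | exists2 B, G B & P.-negligible (A `+` B)].

End CondExp.

Section Transport.
Context (R : realType) (N d : nat).
Local Notation XX := (pathspace R N d).
Local Notation XX2 := (XX * XX)%type.

(* the l_r-norm on R^d *)
Definition lnorm (r : R) (v : 'rV[R]_d) : R :=
  (\sum_i `|v 0 i| `^ r) `^ r^-1.

Definition cost (p : R) (x y : XX) : R :=
  \sum_(k < N) lnorm p (incr k x - incr k y) `^ p.

Local Open Scope ereal_scope.

Definition martingale_measure : set (probability XX R) :=
  [set nu : probability XX R |
    (forall n i, nu.-integrable setT (fun x : XX => (Xt n x 0%R i)%:E)) /\
    (forall m n : 'I_N.+1, (m <= n)%N -> forall i,
       is_condE nu (Ft m) (fun x : XX => Xt n x 0%R i) (fun x : XX => Xt m x 0%R i))].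

Definition coupling (mu nu : probability XX R) : set (probability XX2 R) :=
  [set pi : probability XX2 R |
    (forall A, measurable A -> pushforward pi fst A = mu A) /\
    (forall A, measurable A -> pushforward pi snd A = nu A)].

(* The kernel k is the disintegration pi(dx, dy) = mu(dx) k(x, dy).
   Stated for a set function pi, so that it also applies to an image measure. *)
Definition causal (mu : probability XX R) (pi : set XX2 -> \bar R) : Prop :=
  exists2 k : R.-pker XX ~> XX,
    forall A, measurable A -> pi A = \int[mu]_x k x (xsection A x) &
    forall n (U : set XX), Ft n U -> measurable_wrt (completion mu (Ft n)) (k ^~ U).

Definition swap (z : XX2) : XX2 := (z.2, z.1).

Definition bicausal (mu nu : probability XX R) : set (probability XX2 R) :=
  [set pi : probability XX2 R |
    [/\ coupling mu nu pi, causal mu pi & causal nu (pushforward pi swap)]].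

Definition d_bc (p : R) (mu nu : probability XX R) : \bar R :=
  ereal_inf [set \int[pi]_z (cost p z.1 z.2)%:E | pi in bicausal mu nu].

End Transport.

Section Penalty.
Context (R : realType).
Local Open Scope ereal_scope.
Variable L : R -> \bar R.

(* L_delta(u) = delta L(u / delta), with L(+oo) = +oo; only u >= 0 is used *)
Definition penalty (delta : R) (u : \bar R) : \bar R :=
  if u is r%:E then delta%:E * L (r / delta)%R else +oo.

Definition conjugate (v : \bar R) : \bar R :=
  ereal_sup [set u%:E * v - L u | u in [set u : R | (0 <= u)%R]].

End Penalty.

Section Malliavin.
Context (R : realType) (N d : nat).
Variable f : 'M[R]_(N, d) -> R.

(* the gradient of f with respect to x_(k+1) *)
Definition grad (k : 'I_N) (x : 'M[R]_(N, d)) : 'rV[R]_d :=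
  \row_i 'D_(delta_mx k i) f x.

Definition C1 : Prop :=
  (forall x, differentiable f x) /\ (forall k, continuous (grad k)).

(* DD_(k+1) f, i.e. the sum of the gradients with respect to x_(k+1), ..., x_N *)
Definition DD_ (k : 'I_N) (x : 'M[R]_(N, d)) : 'rV[R]_d :=
  \sum_(j < N | (k <= j)%N) grad j x.

Definition DD (x : 'M[R]_(N, d)) : 'M[R]_(N, d) := \matrix_k DD_ k x.

End Malliavin.

Section Values.
Context (R : realType) (N d : nat).
Local Notation XX := (pathspace R N d).
Local Open Scope ereal_scope.
Variables (p q : R) (L : R -> \bar R) (f : 'M[R]_(N, d) -> R).
Variable mu : probability XX R.

(* A measure with infinite penalty contributes -oo even if its expectation of f
   is not defined. *)
Definition V (delta : R) : \bar R :=
  ereal_sup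
    [set (let pen := penalty L delta (d_bc p mu nu `^ p^-1) in
          if pen == +oo then -oo else 'E_nu[f] - pen)
    | nu in @martingale_measure R N d].

(* h k is the value of the process at time k + 1, hence F_k-measurable. *)
Definition HH : set ('I_N -> XX -> 'rV[R]_d) :=
  [set h |
    (forall k, measurable_wrt (Ft (prev_time k)) (h k : XX -> borel 'rV[R]_d)) /\
    \sum_(k < N) \int[mu]_x (lnorm q (h k x) `^ q)%:E < +oo].

Definition Upsilon : \bar R :=
  conjugate L (ereal_inf
    [set (\int[mu]_x (\sum_(k < N)
            lnorm q (condE_rV mu (Ft (this_time k)) (DD_ f k) x - h k x)
              `^ q)%R%:E) `^ q^-1
    | h in HH]).

Definition Upsilon2 : \bar R :=
  conjugate L
    ((\int[mu]_x (\sum_(k < N)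
        lnorm q (condE_rV mu (Ft (this_time k)) (DD_ f k) x
                 - condE_rV mu (Ft (prev_time k)) (DD_ f k) x) `^ 2)%R%:E)
     `^ 2^-1).

End Values.

(* Main.v *)
(** Write [w] for the difference of the increments of [Y] and [X], [D_n] for
    [DD_n f(X)], [G_n = E_mu[D_n | F_n]], and [v] for the infimum over [h] in
    the definition of Upsilon, so that Upsilon is [L^*(v)].

    Upper bound.  Under a bicausal coupling of two martingale measures,
    [E[D_n w_n] = E[(G_n - h_n) w_n]] for every predictable [h], hence, up to a
    Taylor remainder of order [o(delta)], [E_nu f - E_mu f] is at most
    [|G - h|_q |w|_p].  Costs beyond [U delta] are absorbed by the superlinear
    growth of the penalty.

    Lower bound.  The distance of [G_n] to the [F_(n-1)]-measurable functions is
    dual to the pairing with [Phi_n] such that [E[Phi_n | F_(n-1)] = 0]; it is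
    nearly attained by [Phi_n = phi_n - E[phi_n | F_(n-1)]] with [phi_n] bounded,
    Lipschitz and [F_n]-measurable.  Adding [u delta Phi_n] to the n-th increment
    preserves the martingale property and is an adapted bijection onto its image
    with adapted inverse, so that the coupling of a path with its perturbation
    is bicausal.  As the cost and the constraints separate over times and
    coordinates, only a scalar duality is needed. *)

From HB Require Import structures.
Require Import Defs.
From mathcomp Require Import all_boot all_order all_algebra.
From mathcomp Require Import all_classical all_reals all_analysis measurable_realfun.
From mathcomp Require Import ring lra.

Set Implicit Arguments.
Unset Strict Implicit.
Unset Printing Implicit Defensive.

Import Order.TTheory GRing.Theory Num.Theory.

Local Open Scope classical_set_scope.
Local Open Scope ring_scope.

(** * Expectations *)

(** Conditioning is expressed by orthogonality: [centered] says that a function has mean zero on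
    every event of the past, and causality is used only through the vanishing of E[c(X) b(Y)] for
    [c] centered and [b] adapted.

    The obstacle in the lower bound is the adapted inverse. A conditional expectation
    E[phi_n | F_(n-1)] has no regularity, so the perturbation by Phi_n need not be Lipschitz. It
    depends on the past only, however: when a path is recovered time by time it is already known,
    and the Lipschitz part phi_n alone enters the fixed point equation for the current position.
    This is why phi_n is made Lipschitz before it is centered, and why its conditional expectation
    is taken in a version that is bounded at every path.

    No optimizer is required to exist. The infima over predictable processes and over couplings are
    replaced by near-minimizers, and the defect of a near-minimizer is balanced against the step of
    a finite variation by the uniform continuity of [psi]. *)

Lemma eq_ler disp (T : porderType disp) (x y : T) : x = y -> (x <= y)%O.
Proof. by move=> ->. Qed.

Notation Ex P f := (Rintegral P setT f).
Notation intg P f := (integrable P setT (EFin \o f)).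

Section Expectation.
Context d (T : measurableType d) (R : realType) (P : probability T R).
Implicit Types (f g : T -> R).

Lemma intg_meas f : intg P f -> measurable_fun setT f.
Proof. by move=> /measurable_int /measurable_EFinP. Qed.

Lemma intg_le f g : measurable_fun setT f -> intg P g ->
  (forall x, `|f x| <= g x) -> intg P f.
Proof.
move=> mf ig fg; apply: (le_integrable _ _ _ ig) => //.
  exact/measurable_EFinP.
by move=> x _ /=; rewrite lee_fin (le_trans (fg x))// ler_norm.
Qed.

Lemma intg_cst (c : R) : intg P (fun=> c).
Proof. exact: finite_measure_integrable_cst. Qed.

Lemma intgD f g : intg P f -> intg P g -> intg P (fun x => f x + g x).
Proof.
by move=> If Ig; have := integrableD measurableT If Ig; apply: eq_integrable.
Qed.

Lemma intgZ (c : R) f : intg P f -> intg P (fun x => c * f x).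
Proof.
by move=> If; have := integrableZl measurableT c If; apply: eq_integrable.
Qed.

Lemma intgN f : intg P f -> intg P (fun x => - f x).
Proof.
by move=> If; have := integrableN If; apply: eq_integrable.
Qed.

Lemma intgB f g : intg P f -> intg P g -> intg P (fun x => f x - g x).
Proof. by move=> If Ig; apply: intgD => //; exact: intgN. Qed.

Lemma intg_norm f : intg P f -> intg P (fun x => `|f x|).
Proof. exact: integrable_norm. Qed.

Lemma intg_sum I (r : seq I) (Q : pred I) (F : I -> T -> R) :
  (forall i, Q i -> intg P (F i)) -> intg P (fun x => \sum_(i <- r | Q i) F i x).
Proof.
move=> IF; have := @integrable_sum _ _ _ P _ measurableT _ r Q (fun i => EFin \o F i).
move=> /(_ IF); apply: eq_integrable => // x _ /=.
by rewrite sumEFin.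
Qed.

Lemma intg_indic (A : set T) : measurable A -> intg P \1_A.
Proof. by move=> mA; apply: integrable_indic. Qed.

Lemma intg_bounded f (M : R) : measurable_fun setT f -> (forall x, `|f x| <= M) ->
  intg P f.
Proof. by move=> mf fM; apply: (intg_le mf (intg_cst M)). Qed.

Lemma intgMb f g (M : R) : intg P f -> measurable_fun setT g ->
  (forall x, `|g x| <= M) -> intg P (fun x => f x * g x).
Proof.
move=> If mg gM; apply: (intg_le _ (intgZ M (intg_norm If))).
  exact: measurable_funM (intg_meas If) mg.
by move=> x; rewrite normrM mulrC ler_wpM2r.
Qed.

Lemma intgMi f (A : set T) : measurable A -> intg P f -> intg P (fun x => f x * \1_A x).
Proof.
move=> mA If; apply: (@intgMb _ _ 1) => //.
by move=> x; rewrite indicE; case: (_ \in _); rewrite ?normr1 ?normr0.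
Qed.

Lemma ExD f g : intg P f -> intg P g -> Ex P (fun x => f x + g x) = Ex P f + Ex P g.
Proof. by move=> If Ig; rewrite RintegralD. Qed.

Lemma ExB f g : intg P f -> intg P g -> Ex P (fun x => f x - g x) = Ex P f - Ex P g.
Proof. by move=> If Ig; rewrite RintegralB. Qed.

Lemma ExZ (c : R) f : intg P f -> Ex P (fun x => c * f x) = c * Ex P f.
Proof. by move=> If; rewrite RintegralZl. Qed.

Lemma Ex_cst (c : R) : Ex P (fun=> c) = c.
Proof.
by rewrite /Rintegral integral_cst//= probability_setT mule1.
Qed.

Lemma Ex_eq f g : f =1 g -> Ex P f = Ex P g.
Proof. by move=> fg; apply: eq_Rintegral => x _. Qed.

Lemma Ex_sum I (r : seq I) (Q : pred I) (F : I -> T -> R) :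
  (forall i, Q i -> intg P (F i)) ->
  Ex P (fun x => \sum_(i <- r | Q i) F i x) = \sum_(i <- r | Q i) Ex P (F i).
Proof.
move=> IF; elim: r => [|i r IH].
  rewrite big_nil -[RHS](Ex_cst 0); apply: Ex_eq => x; by rewrite big_nil.
rewrite big_cons; case: ifPn => Qi.
  rewrite -IH -ExD//; last exact: intg_sum; last exact: IF.
  by apply: Ex_eq => x; rewrite big_cons Qi.
by rewrite -IH; apply: Ex_eq => x; rewrite big_cons (negbTE Qi).
Qed.

Lemma Ex_le f g : intg P f -> intg P g -> (forall x, f x <= g x) -> Ex P f <= Ex P g.
Proof. by move=> If Ig fg; apply: le_Rintegral. Qed.

Lemma Ex_ge0 f : (forall x, 0 <= f x) -> 0 <= Ex P f.
Proof. by move=> f0; apply: Rintegral_ge0. Qed.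

Lemma Ex_norm f : intg P f -> `|Ex P f| <= Ex P (fun x => `|f x|).
Proof. exact: le_normr_Rintegral. Qed.

Lemma ExE f : intg P f -> (\int[P]_x (f x)%:E)%E = (Ex P f)%:E.
Proof. by move=> If; rewrite /Rintegral fineK// integrable_fin_num. Qed.

Lemma intg_int (A : set T) f : measurable A -> intg P f ->
  (\int[P]_(x in A) (f x)%:E = (Ex P (fun x => f x * \1_A x))%:E)%E.
Proof.
move=> mA If; rewrite integral_mkcond -(ExE (intgMi mA If)).
by apply: eq_integral => x _; rewrite patchE indicE /=; case: (_ \in _);
  rewrite ?mulr1 ?mulr0.
Qed.

Lemma intg_ge0 f : measurable_fun setT f -> (forall x, 0 <= f x) ->
  (\int[P]_x (f x)%:E < +oo)%E -> intg P f.
Proof.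
move=> mf f0 foo; apply/integrableP; split; first exact/measurable_EFinP.
by under eq_integral => x _ do rewrite /= ger0_norm//.
Qed.

Lemma Ex_dct (f_ : nat -> T -> R) f g :
  (forall n, measurable_fun setT (f_ n)) -> measurable_fun setT f ->
  (forall x, f_ ^~ x @ \oo --> f x) -> intg P g ->
  (forall n x, `|f_ n x| <= g x) ->
  (fun n => Ex P (f_ n)) @ \oo --> Ex P f.
Proof.
move=> mf_ mf cf Ig fg.
have [||||| If _ cvg_int] := @dominated_convergence _ _ _ P _ measurableT
  (fun n => EFin \o f_ n) (EFin \o f) (EFin \o g).
- by move=> n; apply/measurable_EFinP.
- exact/measurable_EFinP.
- by apply: aeW => x _ /=; apply/fine_cvgP; split;
    [apply: nearW|exact: cf].
- exact: Ig.
- by apply: aeW => x n _ /=; rewrite lee_fin.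
have If_ n : intg P (f_ n) by apply: intg_le Ig _.
rewrite /Rintegral; apply: fine_cvg.
rewrite fineK; last exact: integrable_fin_num.
exact: cvg_int.
Qed.

End Expectation.

Section Image.
Context d d' (T : measurableType d) (T' : measurableType d') (R : realType).
Variables (P : probability T R) (Q : probability T' R) (phi : T -> T').
Hypothesis mphi : measurable_fun setT phi.
Hypothesis PQ : forall A, measurable A -> P (phi @^-1` A) = Q A.

(** Change of variables. The image measure is described by its values on sets, so that the same
    lemmas serve the marginals of a coupling and the laws given by [distribution]. *)
Lemma int_image_ge0 (f : T' -> \bar R) : measurable_fun setT f ->
  (forall x, 0 <= f x)%E -> (\int[Q]_y f y = \int[P]_x f (phi x))%E.
Proof.
move=> mf f0; rewrite (eq_measure_integral (pushforward P phi)).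
  by rewrite ge0_integral_pushforward// preimage_setT.
by move=> A mA _; rewrite /= -PQ.
Qed.

Lemma intg_image f : measurable_fun setT f -> intg P (fun x => f (phi x)) -> intg Q f.
Proof.
move=> mf /integrableP[_ fi]; apply/integrableP; split; first exact/measurable_EFinP.
rewrite int_image_ge0//; apply/measurableT_comp => //; exact/measurable_EFinP.
Qed.

Lemma intg_image_inv f : intg Q f -> intg P (fun x => f (phi x)).
Proof.
move=> If; have /integrableP[mf fi] := If; apply/integrableP; split.
  by apply/measurable_EFinP; apply: measurableT_comp => //; exact: intg_meas If.
by rewrite int_image_ge0// in fi; exact: measurableT_comp.
Qed.

Lemma Ex_image f : intg Q f -> Ex Q f = Ex P (fun x => f (phi x)).
Proof.
move=> If; rewrite /Rintegral; congr fine.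
rewrite (eq_measure_integral (pushforward P phi)).
  rewrite integral_pushforward//; first exact: measurable_int If.
  exact: intg_image_inv.
by move=> A mA _; rewrite /= -PQ.
Qed.

End Image.

Section Stair.
Variable R : realType.

(** On [0, 1] this rounds [t] down to a multiple of 1 / (m + 1). It is written as an average of
    indicators of half-lines, so that properties of indicators of preimages pass to functions by
    linearity. *)
Definition stair (m : nat) (t : R) : R :=
  m.+1%:R^-1 * \sum_(i < m.+1) (i.+1%:R / m.+1%:R <= t)%R%:R.

Lemma stair_close m (t : R) : 0 <= t <= 1 -> `|t - stair m t| <= m.+1%:R^-1.
Proof.
move=> /andP[t0 t1].
have m0 : 0 < m.+1%:R :> R by rewrite ltr0n.
pose k := Num.truncn (m.+1%:R * t).
have mt0 : 0 <= m.+1%:R * t by rewrite mulr_ge0// ltW.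
have /andP[k1 k2] := truncn_itv mt0.
have km : (k <= m.+1)%N.
  rewrite -(ler_nat R) (le_trans k1)// -[leRHS]mulr1 ler_wpM2l//; exact: ltW.
have -> : stair m t = k%:R / m.+1%:R.
  rewrite /stair mulrC; congr (_ / _).
  rewrite (eq_bigr (fun i : 'I_m.+1 => ((i < k)%N : nat)%:R)); last first.
    move=> i _; congr ((nat_of_bool _)%:R).
    rewrite ler_pdivrMr// mulrC; apply/idP/idP => [h|h].
      by rewrite /k truncn_ge_nat.
    by rewrite (le_trans _ k1)// ler_nat.
  rewrite -natr_sum; congr (_%:R).
  rewrite -(big_mkord xpredT (fun i => (i < k)%N : nat)) (@big_cat_nat _ _ _ k)//=.
  rewrite (@eq_big_nat _ _ _ _ _ _ (fun=> 1%N)); last by move=> i /andP[_ ->].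
  rewrite sum_nat_const_nat subn0 muln1 big_nat big1 ?addn0//.
  by move=> i /andP[ki _]; rewrite ltnNge ki.
rewrite ler_norml; have k1' : k%:R / m.+1%:R <= t by rewrite ler_pdivrMr// mulrC.
have k2' : t <= k%:R / m.+1%:R + m.+1%:R^-1.
  by rewrite -[X in _ + X]mul1r -mulrDl ler_pdivlMr// mulrC natr1 ltW.
have i0 : 0 <= m.+1%:R^-1 :> R by rewrite invr_ge0 ltW.
have aux (a b : R) : a <= t -> t <= a + b -> 0 <= b -> - b <= t - a <= b.
  by move=> *; apply/andP; split; lra.
exact: aux.
Qed.

End Stair.

Section Orth.
Context d (T : measurableType d) (R : realType) (P : probability T R).

Lemma eq0_of_le_inv (a C : R) : (forall m : nat, `|a| <= C / m.+1%:R) -> a = 0.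
Proof.
move=> H; apply/eqP; rewrite -normr_eq0; apply/eqP/le_anti; rewrite normr_ge0 andbT.
apply/ler_addgt0Pr => e e0; rewrite add0r.
have C0 : 0 <= C by have := H 0%N; rewrite divr1; exact: le_trans.
apply: (le_trans (H (Num.truncn (C / e)))).
rewrite ler_pdivrMr ?ltr0n// mulrC -ler_pdivrMr//.
by have /andP[_ /ltW] := truncn_itv (divr_ge0 C0 (ltW e0)).
Qed.

(** By linearity [c] is orthogonal to every staircase of [k], and the staircases converge to [k]
    uniformly. *)
Lemma Ex_mul_eq0_unit (c k : T -> R) : intg P c -> measurable_fun setT k ->
  (forall x, 0 <= k x <= 1) ->
  (forall B, measurable B -> Ex P (fun x => c x * \1_(k @^-1` B) x) = 0) ->
  Ex P (fun x => c x * k x) = 0.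
Proof.
move=> Ic mk k01 H.
have mB (B : set R) : measurable B -> measurable (k @^-1` B).
  by move=> mB; rewrite -[X in measurable X]setTI; apply: mk.
pose B m (i : nat) : set R := `[i.+1%:R / m.+1%:R, +oo[%classic.
have mBB m i : measurable (B m i) by exact: measurable_itv.
have mBi m i : measurable (k @^-1` B m i) by exact: mB.
have stE m x : c x * stair m (k x) =
    m.+1%:R^-1 * \sum_(i < m.+1) c x * \1_(k @^-1` B m i) x.
  rewrite /stair mulrCA; congr (_ * _); rewrite mulr_sumr; apply: eq_bigr => i _.
  by rewrite indicE; congr (_ * (nat_of_bool _)%:R); apply/idP/idP; rewrite inE /B /= in_itv/= andbT.
have Ist m : intg P (fun x => c x * stair m (k x)).
  rewrite (_ : (fun x => _) = fun x => m.+1%:R^-1 * \sum_(i < m.+1) c x * \1_(k @^-1` B m i) x).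
    by apply: intgZ; apply: intg_sum => i _; apply: intgMi.
  by apply/funext => x; exact: stE.
have Est m : Ex P (fun x => c x * stair m (k x)) = 0.
  rewrite (Ex_eq P (stE m)) ExZ; last first.
    by apply: intg_sum => i _; apply: intgMi.
  rewrite Ex_sum; last by move=> i _; apply: intgMi.
  by rewrite big1 ?mulr0// => i _; apply: H.
have Ick : intg P (fun x => c x * k x).
  apply: (@intgMb _ _ _ _ _ _ 1) => // x; have := k01 x.
  by move=> /andP[k0 k1]; rewrite ger0_norm.
apply: (@eq0_of_le_inv _ (Ex P (fun x => `|c x|))) => m.
rewrite -[X in `|X|]subr0 -(Est m) -ExB//.
apply: (le_trans (Ex_norm _)); first exact: intgB.
rewrite mulrC -ExZ; last exact: intg_norm.
apply: Ex_le; [by apply/intg_norm/intgB|by apply/intgZ/intg_norm|].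
by move=> x; rewrite -mulrBr normrM mulrC ler_wpM2r// stair_close.
Qed.

Definition clip (M t : R) := Num.max (- M) (Num.min M t).

Lemma clip_le (M t : R) : 0 <= M -> `|clip M t| <= M.
Proof.
by move=> M0; rewrite /clip ler_norml le_max lexx ge_max ge_min lexx/= andbT ge0_cp.
Qed.

Lemma clip_id (M t : R) : `|t| <= M -> clip M t = t.
Proof.
by rewrite ler_norml /clip => /andP[a b]; rewrite min_r// max_r.
Qed.

Lemma clip_norm (M t : R) : 0 <= M -> `|clip M t| <= `|t|.
Proof.
move=> M0; have [h|h] := lerP `|t| M; first by rewrite clip_id.
by rewrite (le_trans (clip_le t M0))// ltW.
Qed.

Lemma measurable_clip (M : R) : measurable_fun setT (clip M).
Proof.
have : measurable_fun [set: R] (cst (- M) \max (cst M \min (@idfun R))).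
  apply: measurable_maxr; first exact: measurable_cst.
  by apply: measurable_minr; [exact: measurable_cst|exact: measurable_id].
exact.
Qed.

Lemma clip_cvg (t : R) : (fun n : nat => clip n%:R t) @ \oo --> t.
Proof.
apply: cvg_near_cst; near=> n; apply: clip_id; near: n; exact: nbhs_infty_ger.
Unshelve. all: by end_near. Qed.

Lemma Ex_mul_eq0_bounded (c k : T -> R) (M : R) : intg P c -> measurable_fun setT k ->
  (forall x, `|k x| <= M) ->
  (forall B, measurable B -> Ex P (fun x => c x * \1_(k @^-1` B) x) = 0) ->
  Ex P (fun x => c x * k x) = 0.
Proof.
move=> Ic mk kM H.
(* The affine map [g] below sends the range of [k] into [0, 1]. The constant that it adds
   contributes a multiple of E[c], which is 0 by the hypothesis for the whole line. *)
have M1 : 0 < 2 * (`|M| + 1) by rewrite mulr_gt0// ltr_pwDr.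
pose g (t : R) := (t + (`|M| + 1)) * (2 * (`|M| + 1))^-1.
have mg : measurable_fun setT g.
  by apply: measurable_funM => //; apply: measurable_funD.
have := @Ex_mul_eq0_unit c (g \o k) Ic _ _ _.
rewrite (_ : (fun x => c x * _) = fun x => (2 * (`|M| + 1))^-1 * (c x * k x) + 2^-1 * c x); last first.
  apply/funext => x; rewrite /= /g; field; apply/eqP; lra.
have Ick : intg P (fun x => c x * k x) by exact: intgMb kM.
have Ec : Ex P c = 0.
  rewrite -(H setT measurableT); apply: Ex_eq => x.
  by rewrite preimage_setT indicT mulr1.
rewrite ExD; [|exact: intgZ..].
rewrite !ExZ// Ec mulr0 addr0 => /(_ _ _ _)/eqP; rewrite mulf_eq0 invr_eq0 (gt_eqF M1)/=.
move=> h; apply/eqP/h.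
- exact: measurableT_comp.
- move=> x; have := kM x; have := ler_norm M; rewrite ler_norml /g /= => h1 /andP[h2 h3].
  by rewrite ler_pdivrMr// divr_ge0 ?(ltW M1)//; lra.
- move=> B mB; rewrite comp_preimage; apply: H.
  by rewrite -[X in measurable X]setTI; apply: mg.
Qed.

(** Clipping [k] at level [n] reduces to the bounded case; since clipping never increases the
    modulus, [|c k|] dominates. *)
Lemma Ex_mul_eq0 (c k : T -> R) : intg P c -> measurable_fun setT k ->
  intg P (fun x => c x * k x) ->
  (forall B, measurable B -> Ex P (fun x => c x * \1_(k @^-1` B) x) = 0) ->
  Ex P (fun x => c x * k x) = 0.
Proof.
move=> Ic mk Ick H.
have mc := intg_meas Ic.
have mcl n : measurable_fun setT (fun x => clip n%:R (k x)).
  by apply: measurableT_comp => //; exact: measurable_clip.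
have /cvg_lim <- // : (fun n : nat => Ex P (fun x => c x * clip n%:R (k x))) @ \oo -->
    Ex P (fun x => c x * k x).
  apply: (Ex_dct _ _ _ (intg_norm Ick)).
  - by move=> n; apply: measurable_funM.
  - exact: measurable_funM.
  - by move=> x; apply: cvgM; [exact: cvg_cst|exact: clip_cvg].
  - by move=> n x; rewrite !normrM ler_wpM2l// clip_norm.
apply/cvg_lim => //; apply: cvg_near_cst; near=> n.
apply: (@Ex_mul_eq0_bounded _ _ n%:R) => // [x|B mB]; first exact: clip_le.
have -> : (fun x => clip n%:R (k x)) @^-1` B = k @^-1` (clip n%:R @^-1` B) by [].
by apply: H; rewrite -[X in measurable X]setTI; apply: measurable_clip.
Unshelve. all: by end_near. Qed.

End Orth.

(** * Borel sets of matrices and the filtration *)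

Section MatrixBorel.
Variables (R : realType) (m n : nat).
Implicit Types x : 'M[R]_(m, n).

Lemma mx_norm_ltP x (e : R) : 0 < e ->
  `|x| < e <-> forall i j, `|x i j| < e.
Proof.
move=> e0; rewrite [`|x|]mx_normrE; split => [|H].
  by move/bigmax_ltP => [_ H] i j; exact: (H (i, j)).
by apply/bigmax_ltP; split => // -[i j] _; exact: H.
Qed.

Lemma mx_norm_leP x (e : R) : 0 <= e ->
  `|x| <= e <-> forall i j, `|x i j| <= e.
Proof.
move=> e0; rewrite [`|x|]mx_normrE; split => [|H].
  by move/bigmax_leP => [_ H] i j; exact: (H (i, j)).
by apply/bigmax_leP; split => // -[i j] _; exact: H.
Qed.

Lemma mx_coord_le x i j : `|x i j| <= `|x|.
Proof. by have /(mx_norm_leP _ (normr_ge0 x)) := lexx `|x|. Qed.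

Lemma continuous_borel_measurable (g : 'M[R]_(m, n) -> R) : continuous g ->
  measurable_fun setT (g : borel 'M[R]_(m, n) -> R).
Proof.
move=> /continuousP cg; apply: (measurability _ (RGenOpens.measurableE R)).
move=> _ [_ [a [b ->] <-]]; rewrite setTI.
by apply: sub_sigma_algebra; apply: cg; exact: interval_open.
Qed.

Lemma measurable_coord i j :
  measurable_fun setT (fun x : borel 'M[R]_(m, n) => (x : 'M[R]_(m, n)) i j).
Proof. by apply: continuous_borel_measurable; exact: coord_continuous. Qed.

(* Balls with rational centres and radii [1 / n] form a countable base. *)
Definition rat_ball (c : 'M[rat]_(m, n) * nat) : set 'M[R]_(m, n) :=
  [set x | `|x - map_mx ratr c.1| < c.2.+1%:R^-1].

Lemma open_bigcup_rat_ball (V : set 'M[R]_(m, n)) : open V ->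
  V = \bigcup_c (if `[< rat_ball c `<=` V >] then rat_ball c else set0).
Proof.
move=> oV; apply/seteqP; split => [x Vx|x [c _]]; last first.
  by case: ifPn => // /asboolP cV; exact: cV.
have /nbhs_ballP[e /= e0 eV] : nbhs x V by exact: open_nbhs_nbhs.
pose k := Num.truncn (2 / e).
have ke : 2 * k.+1%:R^-1 < e.
  rewrite ltr_pdivrMr ?ltr0n// -ltr_pdivrMl// mulrC.
  by have /andP[_] := truncn_itv (divr_ge0 (ler0n R 2) (ltW e0)).
have k0 : 0 < k.+1%:R^-1 :> R by rewrite invr_gt0 ltr0n.
have H i j : {q : rat | `|x i j - ratr q| < k.+1%:R^-1}.
  have h : x i j - k.+1%:R^-1 < x i j + k.+1%:R^-1.
    by rewrite ltrD2l (lt_trans _ k0)// oppr_lt0.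
  apply: cid; have [q] := rat_in_itvoo h.
  rewrite in_itv/= => /andP[q1 q2]; exists q.
  by rewrite distrC ltr_distl q1 q2.
exists ((\matrix_(i, j) sval (H i j)), k) => //.
rewrite ifT.
  by apply/(mx_norm_ltP _ k0) => i j; rewrite !mxE; exact: svalP (H i j).
apply/asboolP => y /(mx_norm_ltP _ k0) yb; apply: eV; rewrite -ball_normE /=.
apply/(mx_norm_ltP _ e0) => i j; rewrite !mxE.
have := yb i j; have := svalP (H i j); rewrite /= !mxE => h1 h2.
rewrite (_ : x i j - y i j = (x i j - ratr (sval (H i j))) - (y i j - ratr (sval (H i j)))); last by ring.
by apply: (le_lt_trans (ler_normB _ _)); apply: lt_trans ke; rewrite mulr_natl mulr2n ltrD.
Qed.

(** A ball of the maximum norm is a finite intersection of conditions on single entries, and every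
    open set is a countable union of rational balls. *)
Lemma measurable_mx d (T : measurableType d) (G : T -> 'M[R]_(m, n)) :
  (forall i j, measurable_fun setT (fun t => G t i j)) ->
  measurable_fun setT (G : T -> borel 'M[R]_(m, n)).
Proof.
move=> mG; apply: (@measurability _ _ T (borel 'M[R]_(m, n)) setT G open erefl).
move=> _ [V oV <-]; rewrite setTI (open_bigcup_rat_ball oV) preimage_bigcup.
apply: countable_bigcupT_measurable => [|c]; first exact: countableP.
case: ifPn => _; last by rewrite preimage_set0; exact: measurable0.
have c0 : 0 < c.2.+1%:R^-1 :> R by rewrite invr_gt0 ltr0n.
rewrite (_ : G @^-1` rat_ball c = \bigcap_(i in [set: 'I_m]) \bigcap_(j in [set: 'I_n])
   ((fun t => G t i j) @^-1` ball (ratr (c.1 i j) : R) c.2.+1%:R^-1)).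
  apply: fin_bigcap_measurable; first exact: finite_finset.
  move=> i _; apply: fin_bigcap_measurable; first exact: finite_finset.
  move=> j _; rewrite -[X in measurable X]setTI; apply: mG => //.
  exact: measurable_ball.
apply/seteqP; split => [t /(mx_norm_ltP _ c0) H i _ j _|t H].
  by have := H i j; rewrite !mxE -ball_normE /= distrC.
apply/(mx_norm_ltP _ c0) => i j; rewrite !mxE distrC.
by have := H i I j I; rewrite -ball_normE.
Qed.

End MatrixBorel.

Section Filtration.
Variables (R : realType) (N d : nat).
Local Notation XX := (pathspace R N d).
Implicit Types x : 'M[R]_(N, d).

(* [trunc n] is a retraction that generates [Ft n]: measurability with respect
   to [Ft n] becomes invariance under [trunc n]. *)
Definition trunc (n : nat) x : 'M[R]_(N, d) :=
  \matrix_(k, i) if (k < n)%N then x k i else 0.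

Lemma truncE n x (k : 'I_N) i : trunc n x k i = if (k < n)%N then x k i else 0.
Proof. by rewrite mxE. Qed.

Lemma trunc_trunc n m x : trunc n (trunc m x) = trunc (minn n m) x.
Proof.
by apply/matrixP => k i; rewrite !truncE leq_min; case: (k < n)%N; case: (k < m)%N.
Qed.

Lemma trunc_idem n x : trunc n (trunc n x) = trunc n x.
Proof. by rewrite trunc_trunc minnn. Qed.

Lemma measurable_trunc n : measurable_fun setT (trunc n : XX -> XX).
Proof.
apply: measurable_mx => k i.
rewrite (_ : (fun t => trunc n t k i) = if (k < n)%N then fun t : XX => (t : 'M[R]_(N, d)) k i else cst 0).
  by case: ifP => // _; exact: measurable_coord.
by apply/funext => x; rewrite truncE; case: ifP.
Qed.

Lemma Xt_this (k : 'I_N) x : Xt (this_time k) x = row k x.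
Proof. by rewrite /Xt liftK. Qed.

Lemma Xt_trunc (m : 'I_N.+1) n x : (m <= n)%N -> Xt m (trunc n x) = Xt m x.
Proof.
move=> mn; rewrite /Xt; case: unliftP => // k mk.
apply/rowP => i; rewrite !mxE; rewrite mk /= in mn.
by rewrite mn.
Qed.

Lemma measurable_Xt (m : 'I_N.+1) : measurable_fun setT (Xt m : XX -> borel 'rV[R]_d).
Proof.
apply: measurable_mx => i0 i; rewrite /Xt; case: unlift => [k|].
  rewrite (_ : (fun t => _) = (fun x : XX => (x : 'M[R]_(N, d)) k i)); first exact: measurable_coord.
  by apply/funext => x; rewrite mxE.
rewrite (_ : (fun t => _) = cst 0) //.
by apply/funext => x; rewrite mxE.
Qed.

(** The sets on the right form a sigma-algebra that contains the generators. Conversely, [trunc n]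
    is measurable from [Ft n] to the Borel sets, because each of its entries is 0 or an entry of one
    of X_1, ..., X_n. *)
Lemma FtE (n : 'I_N.+1) (A : set XX) :
  Ft n A <-> measurable A /\ trunc n @^-1` A = A.
Proof.
split.
  suff : @Ft R N d n `<=` [set A : set XX | measurable A /\ trunc n @^-1` A = A] by exact.
  apply: smallest_sub.
    split => [|B [mB BE]|F FE].
    - by split => //; exact: measurable0.
    - split; first by rewrite setTD; exact: measurableC.
      by rewrite setTD -{2}BE.
    - split; first by apply: bigcup_measurable => k _; have [] := FE k.
      rewrite preimage_bigcup; apply: eq_bigcup => // k _; by have [] := FE k.
  move=> B [m /= mn [V mV <-]]; rewrite setTI; split.
    by rewrite -[X in measurable X]setTI; apply: measurable_Xt.
  by apply/seteqP; split => x /=; rewrite Xt_trunc.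
move=> [mA AE]; rewrite -AE.
pose G : set (set XX) := \bigcup_(m in [set m : 'I_N.+1 | (m <= n)%N])
        preimage_set_system setT (Xt m) (@measurable _ (borel 'rV[R]_d)).
have : measurable_fun setT (trunc n : g_sigma_algebraType G -> XX).
  apply: measurable_mx => k i; have [kn|kn] := boolP (k < n)%N; last first.
    rewrite (_ : (fun t => _) = cst 0) //.
    by apply/funext => x; rewrite truncE (negbTE kn).
  move=> _ B mB; rewrite setTI; apply: sub_sigma_algebra.
  (* Row [k] is the position at time [k + 1], and [k + 1 <= n]. *)
  exists (this_time k) => //=.
  exists ((fun v : borel 'rV[R]_d => (v : 'rV[R]_d) 0 i) @^-1` B).
    by rewrite -[X in measurable X]setTI; apply: measurable_coord.
  by rewrite setTI; apply/seteqP; split => x /=; rewrite truncE kn Xt_this mxE.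
by move=> /(_ measurableT A mA); rewrite setTI.
Qed.

Lemma Ft_measurable (n : 'I_N.+1) (A : set XX) : Ft n A -> measurable A.
Proof. by move=> /FtE[]. Qed.

Lemma measurable_wrtE d' (U : measurableType d') (n : 'I_N.+1) (g : XX -> U) :
  measurable_fun setT g -> (forall x, g (trunc n x) = g x) -> measurable_wrt (Ft n) g.
Proof.
move=> mg gE B mB; apply/FtE; split.
  by rewrite -[X in measurable X]setTI; apply: mg.
by apply/seteqP; split => x /=; rewrite gE.
Qed.

Lemma measurable_wrt_meas d' (U : measurableType d') (n : 'I_N.+1) (g : XX -> U) :
  measurable_wrt (Ft n) g -> measurable_fun setT g.
Proof. by move=> mg _ B mB; rewrite setTI; apply: (@Ft_measurable n); exact: mg. Qed.

(** Points of R are Borel, so the fibre of [g] through [x] lies in [Ft n] and contains [trunc n x]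
    together with [x]. *)
Lemma measurable_wrt_trunc (n : 'I_N.+1) (g : XX -> R) :
  measurable_wrt (Ft n) g -> forall x, g (trunc n x) = g x.
Proof.
move=> mg x; have /FtE[_ gE] := mg [set g x] (measurable_set1 _).
have : (trunc n @^-1` (g @^-1` [set g x])) x by rewrite gE /=.
by [].
Qed.

End Filtration.

(** * Inequalities for powers *)

Section PowerInequalities.
Variable R : realType.
Implicit Types a b c t s : R.

Lemma powR_mono (r : R) a b : 0 <= r -> 0 <= a -> a <= b -> a `^ r <= b `^ r.
Proof.
by move=> r0 a0 ab; apply: ge0_ler_powR => //; rewrite nnegrE// (le_trans a0).
Qed.

Lemma powRK (r : R) t : r != 0 -> 0 <= t -> (t `^ r) `^ r^-1 = t.
Proof. by move=> r0 t0; rewrite -powRrM divff// powRr1. Qed.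

Lemma powRVK (r : R) t : r != 0 -> 0 <= t -> (t `^ r^-1) `^ r = t.
Proof. by move=> r0 t0; rewrite -powRrM mulVf// powRr1. Qed.

Lemma powR_le_add1 (s r : R) t : 0 <= s -> s <= r -> 0 <= t -> t `^ s <= 1 + t `^ r.
Proof.
move=> s0 sr t0; have [t1|/ltW t1] := leP t 1.
  by rewrite (le_trans (powR_mono s0 t0 t1))// powR1 lerDl powR_ge0.
by rewrite (le_trans (ler_powR t1 sr))// lerDr.
Qed.

Lemma le_add1_powR (r : R) t : 1 <= r -> 0 <= t -> t <= 1 + t `^ r.
Proof. by move=> r1 t0; rewrite -[X in X <= _](powRr1 t0) powR_le_add1. Qed.

Lemma powR_add_le (r : R) a c : 0 <= r ->
  `|a + c| `^ r <= 2 `^ r * (`|a| `^ r + `|c| `^ r).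
Proof.
move=> r0; wlog ac : a c / `|c| <= `|a| => [H|].
  have [|/ltW] := lerP `|c| `|a|; first exact: H.
  by rewrite addrC [X in _ * X]addrC; exact: H.
rewrite (@le_trans _ _ ((2 * `|a|) `^ r))//.
  by apply: powR_mono => //; rewrite (le_trans (ler_normD _ _))// mulr_natl mulr2n lerD.
by rewrite powRM// ler_wpM2l ?powR_ge0// lerDl powR_ge0.
Qed.

(** Convexity of the power at |a| / (1 - s) and |c| / s with weights 1 - s and s. The factor of
    [|a| ^ r] tends to 1 as [s] tends to 0, which the cruder bound with [2 ^ r] does not provide. *)
Lemma powR_add_convex (r s : R) a c : 1 <= r -> 0 < s -> s < 1 ->
  `|a + c| `^ r <= (1 - s) `^ (1 - r) * `|a| `^ r + s `^ (1 - r) * `|c| `^ r.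
Proof.
move=> r1 s0 s1; have s1' : 0 < 1 - s by rewrite subr_gt0.
have r0 : 0 <= r by exact: le_trans r1.
pose x := `|a| / (1 - s); pose y := `|c| / s.
have x0 : 0 <= x by rewrite divr_ge0// ltW.
have y0 : 0 <= y by rewrite divr_ge0// ltW.
have s01 : (0 <= s <= 1) by rewrite !ltW.
have sp : Itv.spec (@Itv.num_sem R) (Itv.Real `[0%Z, 1%Z]) s.
  by rewrite /= /Itv.num_sem ger0_real ?ltW//= in_itv/= !ltW.
pose u : {i01 R} := Itv.mk sp.
have := @convex_powR R r r1 u y x.
rewrite !inE /= !in_itv /= !andbT => /(_ y0 x0) H.
rewrite convRE [X in X `^ _ <= _]convRE /= in H; set L := (X in X `^ r <= _) in H.
have LE : L = `|a| + `|c|.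
  rewrite /L /x /y /unstable.onem; field; apply/andP; split; rewrite gt_eqF//.
have powN w : 0 < w -> w * (w^-1) `^ r = w `^ (1 - r).
  move=> w0; rewrite powRD; last by rewrite (gt_eqF w0) implybT.
  by rewrite powRr1 ?ltW// -powR_inv1 ?ltW// -powRrM mulN1r.
apply: (@le_trans _ _ (L `^ r)).
  by rewrite LE; apply: powR_mono => //; exact: ler_normD.
apply: (le_trans H); rewrite /x /y !powRM ?invr_ge0 ?(ltW s0) ?(ltW s1')//.
rewrite addrC /unstable.onem; apply: lerD.
  by rewrite -(powN _ s1') -mulrA [X in _ * X]mulrC.
by rewrite -(powN _ s0) -mulrA [X in _ * X]mulrC.
Qed.

End PowerInequalities.

Section Conjugate.
Variables (R : realType) (p q : R).
Hypotheses (p1 : 1 < p) (qE : q = p / (p - 1)).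
Implicit Types a b c t : R.

Lemma p_gt0 : 0 < p. Proof. exact: lt_trans p1. Qed.

Lemma pB1_gt0 : 0 < p - 1. Proof. by rewrite subr_gt0. Qed.

Lemma q_gt1 : 1 < q.
Proof. by rewrite qE ltr_pdivlMr ?pB1_gt0// mul1r gtrBl. Qed.

Lemma q_gt0 : 0 < q. Proof. exact: lt_trans q_gt1. Qed.

Lemma conj_pq : p^-1 + q^-1 = 1.
Proof. by rewrite qE invf_div -[X in X + _]mul1r -mulrDl addrC subrK divff// gt_eqF// p_gt0. Qed.

Lemma conj_mul : (q - 1) * p = q.
Proof. by rewrite qE; field; rewrite gt_eqF// pB1_gt0. Qed.

Lemma conj_mul' : (p - 1) * q = p.
Proof. by rewrite qE; field; rewrite gt_eqF// pB1_gt0. Qed.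

Lemma young a b : 0 <= a -> 0 <= b -> a * b <= a `^ q / q + b `^ p / p.
Proof.
move=> a0 b0; apply: conjugate_powR => //; rewrite ?q_gt0 ?p_gt0//.
by rewrite addrC conj_pq.
Qed.

Lemma young1 a b : 0 <= a -> 0 <= b -> a * b <= a `^ q + b `^ p.
Proof.
move=> a0 b0; apply: (le_trans (young a0 b0)).
by rewrite lerD// ler_pdivrMr ?q_gt0 ?p_gt0// ler_peMr ?powR_ge0// ltW// q_gt1.
Qed.

(** Young's inequality for [a / c] and [c t], where [c ^ p = e]. *)
Lemma young_eps (e : R) : 0 < e ->
  exists2 A, 0 <= A & forall a t, 0 <= a -> 0 <= t -> a * t <= A * a `^ q + e * t `^ p.
Proof.
move=> e0; pose c := e `^ p^-1; have c0 : 0 < c by exact: powR_gt0.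
exists (c^-1 `^ q); first exact: powR_ge0.
move=> a t a0 t0.
have -> : a * t = (c^-1 * a) * (c * t) by field; rewrite gt_eqF.
apply: (le_trans (young1 _ _)); rewrite ?mulr_ge0 ?invr_ge0 ?(ltW c0)//.
by rewrite !powRM ?invr_ge0 ?(ltW c0)// /c powRVK ?gt_eqF ?p_gt0// ltW.
Qed.

(** The duality map between L^q and L^p: [psi t * t] and [|psi t| ^ p] both equal [|t| ^ q], which
    is the equality case of Hoelder's inequality. *)
Definition psi t := Num.sg t * `|t| `^ (q - 1).

Lemma norm_psi t : `|psi t| = `|t| `^ (q - 1).
Proof.
rewrite /psi normrM (ger0_norm (powR_ge0 _ _)) normr_sg.
have [->|t0] := eqVneq t 0; last by rewrite mul1r.
by rewrite mul0r normr0 powR0// gt_eqF// subr_gt0 q_gt1.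
Qed.

Lemma norm_psi_powR t : `|psi t| `^ p = `|t| `^ q.
Proof. by rewrite norm_psi -powRrM conj_mul. Qed.

Lemma mul_psi t : psi t * t = `|t| `^ q.
Proof.
by rewrite /psi mulrAC -normrEsg mulr_powRB1// q_gt0.
Qed.

(* [q psi] is the derivative of [|.|^q]. *)
Lemma powR_tangent a b : `|b| `^ q + q * (psi b * (a - b)) <= `|a| `^ q.
Proof.
have H : q * (psi b * a) <= `|a| `^ q + (q - 1) * `|b| `^ q.
  have h : psi b * a <= `|a| * `|psi b|.
    by rewrite -normrM mulrC ler_norm.
  have := young (normr_ge0 a) (normr_ge0 (psi b)); rewrite norm_psi_powR => h2.
  have {h2}h := le_trans h h2.
  rewrite -(@ler_pM2l _ q^-1) ?invr_gt0 ?q_gt0// mulKf ?gt_eqF ?q_gt0//.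
  apply: (le_trans h); rewrite mulrDr [q^-1 * _]mulrC lerD2l mulrA mulrBr mulr1.
  by rewrite mulVf ?gt_eqF ?q_gt0// mulrC -[X in X - _]conj_pq addrK.
by rewrite mulrBr mul_psi mulrBr; lra.
Qed.

(** At 0 the sign jumps, but the modulus [|t| ^ (q - 1)] vanishes there as [q > 1]; away from 0 the
    sign is locally constant. *)
Lemma continuous_psi : continuous psi.
Proof.
have q10 : 0 < q - 1 by rewrite subr_gt0 q_gt1.
move=> t; have [->|t0] := eqVneq t 0.
  apply/cvgrPdist_le => e e0; near=> s.
  rewrite {1}/psi sgr0 mul0r sub0r normrN norm_psi.
  have q1n : q - 1 != 0 by rewrite gt_eqF.
  rewrite -[leRHS](powRVK q1n) ?(ltW e0)//.
  apply: powR_mono; rewrite ?(ltW q10)//.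
  near: s; apply: cvgr0_norm_le; first exact: cvg_id.
  exact: powR_gt0.
apply: cvgM.
  apply: cvg_near_cst; have [t1|t1] := ltrP 0 t.
    near=> s; have s1 : 0 < s by near: s; exact: lt_nbhsr.
    by rewrite !gtr0_sg.
  have {}t1 : t < 0 by rewrite lt_neqAle t0.
  near=> s; have s1 : s < 0 by near: s; exact: lt_nbhsl.
  by rewrite !ltr0_sg.
have H : {for t, continuous ((@powR R ^~ (q - 1)) \o (@Num.norm R R))}.
  apply: continuous_comp; first exact: norm_continuous.
  apply: differentiable_continuous; apply/derivable1_diffP.
  by apply: derivable_powR; rewrite in_itv/= andbT normr_gt0.
exact: H.
Unshelve. all: by end_near. Qed.

End Conjugate.

Section UniformContinuity.
Context (R : realType) (V W : normedModType R).

(** Only [x] is confined to the compact set; [y] may leave it, as a displaced path does in the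
    Taylor estimate. *)
Lemma compact_unif_continuous (g : V -> W) (A : set V) (e : R) :
  compact A -> continuous g -> 0 < e ->
  exists2 eta : R, 0 < eta &
    forall x y, A x -> `|y - x| <= eta -> `|g y - g x| <= e.
Proof.
move=> /compact_near_coveringP cA cg e0.
have := cA R (0^'+) (fun eta x => forall y, `|y - x| <= eta -> `|g y - g x| <= e).
have /[swap] /[apply] : forall x, A x -> \forall x' \near x & eta \near 0^'+,
    forall y, `|y - x'| <= eta -> `|g y - g x'| <= e.
  move=> x Ax; have := cg x => /cvgrPdist_le /(_ (e / 2)).
  rewrite divr_gt0// => /(_ isT) /nbhs_ballP[r /= r0 rg].
  exists (ball x (r / 2), [set eta | eta < r / 2]) => /=.
    split; first by apply: nbhsx_ballx; rewrite divr_gt0.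
    by apply: nbhs_right_lt; rewrite divr_gt0.
  move=> [x' eta] /= [xx' er] y yx'.
  have h1 : `|g x - g x'| <= e / 2.
    by apply: rg; apply: le_ball xx'; rewrite ler_pdivrMr// ler_peMr ?(ltW r0)// ler1n.
  have h2 : `|g x - g y| <= e / 2.
    apply: rg; rewrite -ball_normE /=; move: xx'; rewrite -ball_normE /= => xx'.
    rewrite (_ : x - y = (x - x') - (y - x')); last by rewrite opprB addrA subrK.
    rewrite (splitr r) (le_lt_trans (ler_normB _ _))// ltrD// (le_lt_trans yx')//.
  rewrite (_ : g y - g x' = (g x - g x') - (g x - g y)); last by rewrite opprB [RHS]addrC addrA subrK.
  by rewrite (le_trans (ler_normB _ _))// (splitr e) lerD.
move=> H; near (0 : R)^'+ => eta; exists eta => //.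
have HA : A `<=` (fun x => forall y, `|y - x| <= eta -> `|g y - g x| <= e) by near: eta.
by move=> x y Ax; exact: HA.
Unshelve. all: by end_near. Qed.

End UniformContinuity.

Lemma compact_mx_ball (R : realType) m n (K : R) : compact [set x : 'M[R]_(m, n) | `|x| <= K].
Proof.
have -> : [set x : 'M[R]_(m, n) | `|x| <= K] =
   vec_mx @` [set v : 'rV[R]_(m * n) | `|v| <= K].
  apply/seteqP; split => [x /= xK|_ [v /= vK <-]].
    exists (mxvec x); last by rewrite mxvecK.
    have K0 : 0 <= K by exact: le_trans xK.
    apply/(mx_norm_leP _ K0) => i j; rewrite (ord1 i).
    case/mxvec_indexP : j => a b; rewrite mxvecE.
    exact: le_trans (mx_coord_le x a b) xK.
  have K0 : 0 <= K by exact: le_trans vK.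
  apply/(mx_norm_leP _ K0) => i j; rewrite mxE.
  exact: le_trans (mx_coord_le v _ _) vK.
apply: continuous_compact.
  apply: continuous_subspaceT => v B /nbhs_ballP[e /= e0 eB].
  apply/nbhs_ballP; exists e => // w vw; apply: eB; move: vw.
  rewrite -!ball_normE /= => vw; rewrite -linearB.
  apply/(mx_norm_ltP _ e0) => i j.
  by rewrite mxE (le_lt_trans (mx_coord_le _ _ _)).
apply: bounded_closed_compact.
  exists K; split; first exact: num_real.
  by move=> M KM v /= vK; rewrite (le_trans vK)// ltW.
rewrite (_ : [set v : 'rV_(m * n) | `|v| <= K] = (@Num.norm _ 'rV[R]_(m * n)) @^-1` [set t | t <= K])//.
apply: closed_comp; last exact: closed_le.
by move=> x _; exact: norm_continuous.
Qed.

Lemma measurable_powR_comp d (T : measurableType d) (R : realType) (f : T -> R) (r : R) :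
  measurable_fun setT f -> measurable_fun setT (fun x => `|f x| `^ r).
Proof.
by move=> mf; apply: (measurableT_comp (measurable_powR r)); exact: measurableT_comp.
Qed.

Lemma measurable_sg (R : realType) : measurable_fun [set: R] (fun t : R => Num.sg t).
Proof.
rewrite (_ : (fun t => _) = fun t : R => \1_[set s : R | 0 < s] t - \1_[set s : R | s < 0] t).
  apply: measurable_funB; apply/measurable_indicP.
    rewrite (_ : [set s | _] = `]0, +oo[%classic); first exact: measurable_itv.
    by apply/seteqP; split => s /=; rewrite in_itv/= andbT.
  rewrite (_ : [set s | _] = `]-oo, 0[%classic); first exact: measurable_itv.
  by apply/seteqP; split => s /=; rewrite in_itv/=.
apply/funext => t; rewrite !indicE; case: (sgrP t) => [->|t0|t0].
- by rewrite !memNset ?subr0//= ltxx.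
- by rewrite mem_set// memNset ?subr0//= ltNge (ltW t0).
- by rewrite memNset ?mem_set ?sub0r//= ltNge (ltW t0).
Qed.

Lemma measurable_psi (R : realType) (q : R) : measurable_fun setT (psi q).
Proof.
by apply: measurable_funM; [exact: measurable_sg|apply: measurable_powR_comp].
Qed.

Lemma indic_preim (T T' : Type) (R : realType) (f : T -> T') (A : set T') x :
  \1_(f @^-1` A) x = \1_A (f x) :> R.
Proof. by rewrite !indicE. Qed.

(** * Conditional expectations *)

Section ExpectationLimits.
Context d (T : measurableType d) (R : realType) (P : probability T R).

Lemma fatou_bound (f_ : nat -> T -> R) (f : T -> R) (C : R) :
  (forall n, intg P (f_ n)) -> (forall n x, 0 <= f_ n x) -> measurable_fun setT f ->
  (forall x, f_ ^~ x @ \oo --> f x) -> (forall n, Ex P (f_ n) <= C) ->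
  intg P f /\ Ex P f <= C.
Proof.
move=> If f0 mf cf fC.
have f0' x : 0 <= f x by apply: (cvgr_to_ge (cf x)); exact: nearW.
have H : (\int[P]_x (f x)%:E <= C%:E)%E.
  rewrite (_ : (\int[P]_x (f x)%:E = \int[P]_x limn_einf (fun n => (f_ n x)%:E))%E); last first.
    apply: eq_integral => x _; apply/esym.
    have cfx : (fun n => (f_ n x)%:E) @ \oo --> (f x)%:E.
      by apply/fine_cvgP; split; [exact: nearW|exact: cf].
    by rewrite is_cvg_limn_einfE; [exact/cvg_lim|apply/cvg_ex; exists (f x)%:E].
  apply: (le_trans (@fatou _ _ _ P _ measurableT (fun n x => (f_ n x)%:E) _ _)).
  - by move=> n; apply: measurable_int (If n).
  - by move=> n x _; rewrite lee_fin.
  rewrite limn_einf_lim; apply: lime_le; first exact: is_cvg_einfs.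
  apply: nearW => n; rewrite (@le_trans _ _ (\int[P]_x (f_ n x)%:E)%E)//.
    by apply: ereal_inf_lbound; exists n => //=.
  by rewrite ExE// lee_fin.
have Iff : intg P f by apply: intg_ge0 => //; exact: le_lt_trans H (ltry _).
by split => //; rewrite ExE// lee_fin in H.
Qed.

End ExpectationLimits.

Section CondExp.
Context d (T : measurableType d) (R : realType) (P : probability T R) (r : T -> T).
Hypotheses (mr : measurable_fun setT r) (rr : forall x, r (r x) = r x).

(* [r] stands for the sigma-algebra that it generates. *)
Definition rmeas (g : T -> R) := measurable_fun setT g /\ forall x, g (r x) = g x.

(* [E[c | r] = 0] *)
Definition centered (c : T -> R) :=
  forall A, measurable A -> Ex P (fun x => c x * \1_A (r x)) = 0.

Lemma measurable_preim (A : set T) : measurable A -> measurable (r @^-1` A).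
Proof. by move=> mA; rewrite -[X in measurable X]setTI; apply: mr. Qed.

Lemma centered_orth c k : intg P c -> centered c -> rmeas k ->
  intg P (fun x => c x * k x) -> Ex P (fun x => c x * k x) = 0.
Proof.
move=> Ic cc [mk kr] Ick; apply: Ex_mul_eq0 => // B mB.
rewrite -(cc (k @^-1` B)); last by rewrite -[X in measurable X]setTI; apply: mk.
by apply: Ex_eq => x; rewrite !(indic_preim _ k) kr.
Qed.

(** The Radon-Nikodym theorem is applied to image measures under [r]. The density composed with [r]
    is then invariant under [r], because [r] is idempotent. *)
Lemma condexp_exists g : intg P g ->
  exists h, [/\ rmeas h, intg P h & centered (fun x => g x - h x)].
Proof.
move=> Ig.
pose X : {mfun T >-> T} := HB.pack r (isMeasurableFun.Build _ _ _ _ r mr).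
pose Q : probability T R := distribution P X.
have [nu nuE] : exists nu : {charge set T -> \bar R},
    forall A, nu A = (\int[P]_(x in r @^-1` A) (g x)%:E)%E.
  unshelve (eexists (pushforward (induced_charge Ig) r)); [exact: mr|by []].
have nuQ : nu `<< Q.
  apply/null_content_dominatesP => A mA QA; rewrite nuE.
  apply: null_set_integral => //; first exact: measurable_preim.
  exact: (measurable_funTS (measurable_int P Ig)).
pose h0 := fine \o (Radon_Nikodym nu Q).
have h0E x : (h0 x)%:E = Radon_Nikodym nu Q x.
  by rewrite /h0 /= fineK// Radon_Nikodym_fin_num.
have Ih0 : intg Q h0.
  have := Radon_Nikodym_integrable nuQ; apply: eq_integrable => // x _.
  by rewrite -h0E.
have QP : forall A, measurable A -> P (r @^-1` A) = Q A by [].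
exists (h0 \o r); split.
- split; last by move=> x /=; rewrite rr.
  by apply: measurableT_comp => //; exact: intg_meas Ih0.
- exact: (intg_image_inv mr QP).
move=> A mA.
have mrA := measurable_preim mA.
have Ihr : intg P (h0 \o r) by exact: (intg_image_inv mr QP).
have E (u : T -> R) : (fun x => u x * \1_A (r x)) = (fun x => u x * \1_(r @^-1` A) x).
  by apply/funext => x; rewrite !indicE.
rewrite (@Ex_eq _ _ _ P _ (fun x => g x * \1_A (r x) - h0 (r x) * \1_A (r x))); last first.
  by move=> x; rewrite mulrBl.
rewrite ExB; last 2 first.
- by rewrite (E g); exact: intgMi.
- by rewrite (E (h0 \o r)); exact: intgMi.
rewrite (E g).
apply/eqP; rewrite subr_eq0; apply/eqP.
have /esym := Radon_Nikodym_integral nuQ mA; rewrite nuE intg_int//.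
under eq_integral do rewrite -h0E.
rewrite intg_int// => -[<-].
by rewrite (Ex_image mr QP)//; exact: intgMi.
Qed.

Lemma rmeas_comp (phi : R -> R) g : measurable_fun setT phi -> rmeas g -> rmeas (phi \o g).
Proof.
move=> mphi [mg gr]; split; first exact: measurableT_comp.
by move=> x /=; rewrite gr.
Qed.

(** Conditional Jensen inequality by tangents: [|h|^q + q psi(h) (g - h) <= |g|^q]. Restricting to
    [|h| <= n] makes the middle term integrable, with mean 0 by centering; Fatou's lemma then
    removes the restriction. *)
Lemma condexp_pow (p q : R) g h : 1 < p -> q = p / (p - 1) ->
  intg P g -> rmeas h -> intg P h -> centered (fun x => g x - h x) ->
  intg P (fun x => `|g x| `^ q) ->
  intg P (fun x => `|h x| `^ q) /\
  Ex P (fun x => `|h x| `^ q) <= Ex P (fun x => `|g x| `^ q).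
Proof.
move=> p1 qE Ig rh Ih cgh Igq; have [mh _] := rh.
have q1 := q_gt1 p1 qE; have q0 : 0 < q by exact: lt_trans q1.
pose S (n : nat) : set R := `[- n%:R, n%:R]%classic.
have mS n : measurable (S n) by exact: measurable_itv.
have inS n t : \1_(S n) t = (`|t| <= n%:R)%R%:R :> R.
  by rewrite indicE; congr (nat_of_bool _)%:R; apply/idP/idP; rewrite inE /S /= in_itv/= ler_norml.
have mI n : measurable_fun setT (\1_(S n) : R -> R) by apply/measurable_indicP.
pose k n t := q * psi q t * \1_(S n) t.
have mk n : measurable_fun setT (k n).
  by apply: measurable_funM => //; apply: measurable_funM => //; exact: measurable_psi.
have kb n t : `|k n t| <= q * n%:R `^ (q - 1).
  rewrite /k inS normrM [`|q * _|]normrM (gtr0_norm q0) (norm_psi p1 qE) -mulrA ler_wpM2l ?(ltW q0)//.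
  case: (boolP (`|t| <= n%:R)) => /= tn; last by rewrite normr0 mulr0 powR_ge0.
  by rewrite normr1 mulr1 powR_mono// subr_ge0 ltW.
have Ikn n : intg P (fun x => (g x - h x) * k n (h x)).
  by apply: (intgMb (intgB Ig Ih)); [exact: measurableT_comp|move=> x; exact: kb].
have Ekn n : Ex P (fun x => (g x - h x) * k n (h x)) = 0.
  by apply: centered_orth => //; [exact: intgB|exact: rmeas_comp].
have mhq : measurable_fun setT (fun x => `|h x| `^ q) by exact: measurable_powR_comp.
have If n : intg P (fun x => `|h x| `^ q * \1_(S n) (h x)).
  apply: (@intg_bounded _ _ _ _ _ (n%:R `^ q)).
    by apply: measurable_funM => //; exact: measurableT_comp.
  move=> x; rewrite inS normrM (ger0_norm (powR_ge0 _ _)).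
  case: (boolP (`|h x| <= n%:R)) => /= tn; last by rewrite normr0 mulr0 powR_ge0.
  by rewrite normr1 mulr1 powR_mono// ltW.
apply: (@fatou_bound _ _ _ _ (fun n x => `|h x| `^ q * \1_(S n) (h x))) => //.
- move=> x; apply: cvg_near_cst; near=> n; rewrite /= inS (_ : `|h x| <= n%:R) ?mulr1//.
  by near: n; exact: nbhs_infty_ger.
- move=> n; rewrite -[leLHS]addr0 -(Ekn n) -ExD//.
  apply: Ex_le => // [|x]; first exact: intgD.
  rewrite /k inS; case: (`|h x| <= n%:R) => /=; last by rewrite !mulr0 addr0 powR_ge0.
  by rewrite !mulr1 [_ * (q * _)]mulrC -mulrA; exact: powR_tangent p1 qE _ _.
Unshelve. all: by end_near. Qed.

(** Testing [g - h] against the indicator of [h > B] shows that the positive part of [h - B] has the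
    mean of [g - B] on that event, which is at most 0. *)
Lemma condexp_excess g h (B : R) : intg P g -> rmeas h -> intg P h ->
  centered (fun x => g x - h x) -> (forall x, g x <= B) ->
  forall A, measurable A -> Ex P (fun x => Num.max 0 (h x - B) * \1_A (r x)) = 0.
Proof.
move=> Ig rh Ih cgh gB A mA; have [mh hr] := rh.
pose S : set R := `]B, +oo[%classic.
have inS t : \1_S t = (B < t)%R%:R :> R.
  by rewrite indicE; congr (nat_of_bool _)%:R; apply/idP/idP; rewrite inE /S /= in_itv/= andbT.
have mI : measurable_fun setT (\1_S : R -> R).
  by apply/measurable_indicP; exact: measurable_itv.
pose u x := (h x - B) * \1_S (h x).
have uE x : Num.max 0 (h x - B) = u x.
  rewrite /u inS; case: ltP => h1; rewrite ?mulr1 ?mulr0.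
    by rewrite max_r// subr_ge0 ltW.
  by rewrite max_l// subr_le0.
have u0 x : 0 <= u x by rewrite -uE le_max lexx.
have mw : measurable_fun setT (fun x => \1_S (h x) : R) by exact: measurableT_comp.
have wb x : `|\1_S (h x) : R| <= 1 by rewrite inS; case: ltP => _; rewrite ?normr1 ?normr0.
have Iu : intg P u by apply: (intgMb (intgB Ih (intg_cst P B)) mw wb).
have Igw : intg P (fun x => (g x - h x) * \1_S (h x)).
  by apply: (intgMb (intgB Ig Ih) mw wb).
have Egw : Ex P (fun x => (g x - h x) * \1_S (h x)) = 0.
  by apply: centered_orth => //; [exact: intgB|exact: rmeas_comp].
have Eu : Ex P u <= 0.
  rewrite -[leLHS]addr0 -[X in _ + X]Egw -ExD// -[leRHS](Ex_cst P 0); apply: Ex_le.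
  - exact: intgD.
  - exact: intg_cst.
  - move=> x; rewrite /u -mulrDl inS; case: (B < h x) => /=; rewrite ?mulr0//.
    by have := gB x; lra.
have mrA : measurable (r @^-1` A) by exact: measurable_preim.
have IuA : intg P (fun x => u x * \1_A (r x)).
  by have := intgMi mrA Iu; apply: eq_integrable.
apply/le_anti/andP; split; last first.
  by apply: Ex_ge0 => x; rewrite mulr_ge0// ?uE// indicE.
apply: (le_trans _ Eu); rewrite (@Ex_eq _ _ _ P _ (fun x => u x * \1_A (r x))).
  by apply: Ex_le => // x; rewrite ler_piMr// indicE; case: (_ \in _).
by move=> x; rewrite uE.
Qed.

(** The bound is wanted at every point and not only almost surely, so a version of the conditional
    expectation is clipped; the excess above [B] and below [- B] integrates to 0 by
    [condexp_excess]. *)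
Lemma condexp_bounded (g : T -> R) (B : R) : measurable_fun setT g -> (forall x, `|g x| <= B) ->
  exists h, [/\ rmeas h, forall x, `|h x| <= B & centered (fun x => g x - h x)].
Proof.
move=> mg gB; have Ig : intg P g by exact: intg_bounded gB.
have B0 : 0 <= B by exact: le_trans (gB point).
have [h [rh Ih cgh]] := condexp_exists Ig.
have [mh hr] := rh.
exists (clip B \o h); split.
- by apply: rmeas_comp => //; exact: measurable_clip.
- by move=> x; exact: clip_le.
move=> A mA; have mrA : measurable (r @^-1` A) by exact: measurable_preim.
(* Clipping subtracts the excess above [B] and adds the excess below [- B]. *)
have clipE a : clip B a = a - Num.max 0 (a - B) + Num.max 0 (- a - B).
  rewrite /clip; case: (lerP B a) => h1.
    rewrite (@max_r _ _ 0 (a - B)) ?subr_ge0// (@max_l _ _ 0 (- a - B)); last lra.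
    by rewrite max_r; lra.
  rewrite (@max_l _ _ 0 (a - B)); last lra.
  case: (lerP a (- B)) => h2.
    by rewrite (@max_r _ _ 0 (- a - B)); lra.
  by rewrite (@max_l _ _ 0 (- a - B)); lra.
have E1 := condexp_excess Ig rh Ih cgh (fun x => le_trans (ler_norm _) (gB x)) mA.
have E2 : Ex P (fun x => Num.max 0 (- h x - B) * \1_A (r x)) = 0.
  apply: (@condexp_excess (fun x => - g x) (fun x => - h x)) => //.
  - exact: intgN.
  - by apply: (@rmeas_comp -%R).
  - exact: intgN.
  - move=> A' mA'; rewrite (@Ex_eq _ _ _ P _ (fun x => - 1 * ((g x - h x) * \1_A' (r x)))).
      rewrite ExZ ?cgh ?mulr0//.
      have := intgMi (measurable_preim mA') (intgB Ig Ih); exact: eq_integrable.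
    by move=> x; ring.
  - by move=> x; rewrite (le_trans (ler_norm _))// normrN.
have mM (u : T -> R) : measurable_fun setT u -> measurable_fun setT (fun x => Num.max 0 (u x)).
  by move=> mu; apply: (@measurable_maxr _ _ _ _ (cst 0) u).
have IM (u : T -> R) : intg P u -> intg P (fun x => Num.max 0 (u x) * \1_A (r x)).
  move=> Iu; have : intg P (fun x => Num.max 0 (u x)).
    apply: (intg_le _ (intg_norm Iu)); first by apply: mM; exact: intg_meas Iu.
    by move=> x; rewrite ger0_norm ?le_max ?lexx// ge_max normr_ge0 ler_norm.
  by move/(intgMi mrA); apply: eq_integrable.
have I0 : intg P (fun x => (g x - h x) * \1_A (r x)).
  by have := intgMi mrA (intgB Ig Ih); apply: eq_integrable.
have I1 := IM _ (intgB Ih (intg_cst P B)).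
have I2 := IM _ (intgB (intgN Ih) (intg_cst P B)).
rewrite (@Ex_eq _ _ _ P _ (fun x => (g x - h x) * \1_A (r x) +
   Num.max 0 (h x - B) * \1_A (r x) - Num.max 0 (- h x - B) * \1_A (r x))).
  by rewrite ExB ?ExD ?E1 ?E2 ?cgh ?addr0 ?subr0//; exact: intgD.
by move=> x /=; rewrite clipE; ring.
Qed.

End CondExp.

(** * Density of Lipschitz functions *)

Section Lipschitz.
Variables (R : realType) (m n : nat).
Local Notation MM := 'M[R]_(m, n).
Implicit Types phi : MM -> R.

Definition lip phi := exists2 K : R, 0 <= K & forall x y, `|phi x - phi y| <= K * `|x - y|.

Lemma lip_measurable phi : lip phi -> measurable_fun setT (phi : borel MM -> R).
Proof.
move=> [K K0 phiK]; apply: continuous_borel_measurable => x B /nbhs_ballP[e /= e0 eB].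
have K1 : 0 < K + 1 by rewrite ltr_wpDl.
apply/nbhs_ballP; exists (e / (K + 1)) => [|y]; first exact: divr_gt0.
rewrite -ball_normE /= ltr_pdivlMr// => xy; apply: eB; rewrite -ball_normE /=.
rewrite (le_lt_trans (phiK x y))// (le_lt_trans _ xy)// mulrC ler_wpM2l//.
by rewrite lerDl.
Qed.

Lemma lip_cst c : lip (fun=> c).
Proof. by exists 0 => // x y; rewrite subrr normr0 mul0r. Qed.

Lemma lipD phi1 phi2 : lip phi1 -> lip phi2 -> lip (fun x => phi1 x + phi2 x).
Proof.
move=> [K1 K10 H1] [K2 K20 H2]; exists (K1 + K2); first exact: addr_ge0.
move=> x y; rewrite (_ : _ - _ = (phi1 x - phi1 y) + (phi2 x - phi2 y)); last by ring.
by rewrite (le_trans (ler_normD _ _))// mulrDl lerD.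
Qed.

Lemma lipZ c phi : lip phi -> lip (fun x => c * phi x).
Proof.
move=> [K K0 H]; exists (`|c| * K); first exact: mulr_ge0.
by move=> x y; rewrite -mulrBr normrM -mulrA ler_wpM2l.
Qed.

Lemma lip_sum k (F : 'I_k -> MM -> R) : (forall i, lip (F i)) ->
  lip (fun x => \sum_i F i x).
Proof.
elim: k F => [|k IH] F H.
  by rewrite (_ : (fun x => _) = fun=> 0); [exact: lip_cst|apply/funext => x; rewrite big_ord0].
rewrite (_ : (fun x => _) = fun x => \sum_(i < k) F (widen_ord (leqnSn k) i) x + F ord_max x).
  by apply: lipD => //; apply: (IH (fun i => F (widen_ord (leqnSn k) i))).
by apply/funext => x; rewrite big_ord_recr.
Qed.

Lemma max_lip (a b c e : R) : `|Num.max a b - Num.max c e| <= `|a - c| + `|b - e|.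
Proof.
wlog : a b c e / b <= a.
  move=> H; have /orP[|ba] := le_total b a; first exact: H.
  by rewrite maxC (maxC c) [leRHS]addrC; exact: H.
move=> ba; rewrite (max_l ba) ler_norml; have [h1|/ltW h1] := lerP c e.
  have := ler_norm (a - c); have := ler_norm (c - a); rewrite distrC.
  have := ler_norm (b - e); have := ler_norm (e - b); rewrite (distrC e).
  by move=> *; apply/andP; split; lra.
have := ler_norm (a - c); have := ler_norm (c - a); rewrite distrC.
have := normr_ge0 (b - e).
by move=> *; apply/andP; split; lra.
Qed.

Lemma lip_max phi1 phi2 : lip phi1 -> lip phi2 -> lip (fun x => Num.max (phi1 x) (phi2 x)).
Proof.
move=> [K1 K10 H1] [K2 K20 H2]; exists (K1 + K2); first exact: addr_ge0.
by move=> x y; rewrite (le_trans (max_lip _ _ _ _))// mulrDl lerD.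
Qed.

Lemma lip_norm (q : MM) : lip (fun x => `|x - q|).
Proof.
exists 1 => // x y; rewrite mul1r (le_trans (ler_dist_dist _ _))//.
by rewrite opprB addrA subrK.
Qed.

Section Density.
Variable P : probability (borel MM) R.

Definition lip_approx (A : set (borel MM)) := measurable A /\
  forall e : R, 0 < e -> exists phi : MM -> R, [/\ lip phi, forall x, 0 <= phi x <= 1 &
    Ex P (fun x => `|phi x - \1_A x|) <= e].

Lemma intg_approx phi (A : set (borel MM)) : measurable A -> lip phi ->
  (forall x, 0 <= phi x <= 1) -> intg P (fun x => `|phi x - \1_A x|).
Proof.
move=> mA lphi phi01; apply: intg_norm; apply: intgB; last exact: intg_indic.
apply: (@intg_bounded _ _ _ _ _ 1); first exact: lip_measurable.
by move=> x; have /andP[h1 h2] := phi01 x; rewrite ger0_norm.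
Qed.

Lemma lip_approxC A : lip_approx A -> lip_approx (~` A).
Proof.
move=> [mA H]; split; first exact: measurableC.
move=> e /H[phi [lphi phi01 phie]]; exists (fun x => 1 + (- 1) * phi x); split.
- by apply: lipD; [exact: lip_cst|exact: lipZ].
- by move=> x; have /andP[h1 h2] := phi01 x; apply/andP; split; lra.
- apply: le_trans phie; apply: eq_ler; apply: Ex_eq => x.
  rewrite (_ : \1_(~` A) x = 1 - \1_A x :> R).
    by rewrite -normrN; congr `|_|; ring.
  by rewrite !indicE in_setC; case: (x \in A) => /=; rewrite ?subrr ?subr0.
Qed.

Lemma lip_approxU A B : lip_approx A -> lip_approx B -> lip_approx (A `|` B).
Proof.
move=> [mA HA] [mB HB]; split; first exact: measurableU.
move=> e e0; have e2 : 0 < e / 2 by rewrite divr_gt0.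
have [f [lf f01 fe]] := HA _ e2; have [g [lg g01 ge]] := HB _ e2.
have h01 x : 0 <= Num.max (f x) (g x) <= 1.
  have /andP[f0 f1] := f01 x; have /andP[g0 g1] := g01 x.
  by rewrite le_max f0 ge_max f1 g1.
exists (fun x => Num.max (f x) (g x)); split => //; first exact: lip_max.
rewrite [leRHS](splitr e) (le_trans _ (lerD fe ge))//.
rewrite -ExD; [|exact: intg_approx..].
apply: Ex_le.
- by apply: intg_approx => //; [exact: measurableU|exact: lip_max].
- by apply: intgD; exact: intg_approx.
- move=> x; rewrite (_ : \1_(A `|` B) x = Num.max (\1_A x) (\1_B x) :> R).
    exact: max_lip.
  rewrite !indicE in_setU; case: (x \in A); case: (x \in B) => //=;
  by rewrite /= ?maxxx// ?(max_l ler01) ?(max_r ler01).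
Qed.

Lemma lip_approx0 : lip_approx set0.
Proof.
split; first exact: measurable0.
move=> e e0; exists (fun=> 0); split; first exact: lip_cst.
- by move=> x; rewrite lexx ler01.
- rewrite (@Ex_eq _ _ _ P _ (fun=> 0)) ?Ex_cst ?ltW// => x.
  by rewrite indic0 subrr normr0.
Qed.

Lemma Ex_indic_cvg (F : nat -> set (borel MM)) A : (forall k, measurable (F k)) ->
  measurable A -> (forall x, (fun k => \1_(F k) x : R) @ \oo --> (\1_A x : R)) ->
  (fun k => Ex P (fun x => `|\1_(F k) x - \1_A x|)) @ \oo --> (0 : R).
Proof.
move=> mF mA FA; rewrite -[X in _ --> X](Ex_cst P 0).
apply: (Ex_dct _ _ _ (intg_cst P 1)) => //.
- move=> k; apply: measurableT_comp => //; apply: measurable_funB; exact/measurable_indicP.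
- move=> x; rewrite -[X in _ --> X](normr0 R) -(subrr (\1_A x)).
  by apply: cvg_norm; apply: cvgB; [exact: FA|exact: cvg_cst].
- move=> k x; rewrite normr_id !indicE; case: (_ \in _); case: (_ \in _) => /=;
  by rewrite ?subrr ?subr0 ?sub0r ?normrN ?normr1 ?normr0.
Qed.

Lemma lip_approx_cvg (F : nat -> set (borel MM)) A : (forall k, lip_approx (F k)) ->
  measurable A -> (forall x, (fun k => \1_(F k) x : R) @ \oo --> (\1_A x : R)) ->
  lip_approx A.
Proof.
move=> HF mA FA; split => // e e0; have e2 : 0 < e / 2 by rewrite divr_gt0.
have mF k : measurable (F k) by have [] := HF k.
have := Ex_indic_cvg mF mA FA => /cvgr0_norm_le /(_ _ e2)[k _ /(_ k (leqnn k)) /= Hk].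
have [_ /(_ _ e2)[f [lf f01 fe]]] := HF k.
exists f; split => //.
rewrite [leRHS](splitr e) (le_trans _ (lerD fe (le_trans (ler_norm _) Hk)))//.
have I1 : intg P (fun x => `|\1_(F k) x - \1_A x|).
  by apply: intg_norm; apply: intgB; exact: intg_indic.
rewrite -ExD//; last exact: intg_approx.
apply: Ex_le; [exact: intg_approx|by apply: intgD => //; exact: intg_approx|].
move=> x; rewrite (_ : f x - \1_A x = (f x - \1_(F k) x) + (\1_(F k) x - \1_A x)).
  exact: ler_normD.
by ring.
Qed.

Lemma lip_approx_bigcup (F : nat -> set (borel MM)) : (forall k, lip_approx (F k)) ->
  lip_approx (\bigcup_k F k).
Proof.
move=> HF; apply: (@lip_approx_cvg (fun k => \big[setU/set0]_(i < k) F i)).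
- elim=> [|k IH]; first by rewrite big_ord0; exact: lip_approx0.
  by rewrite big_ord_recr /=; apply: lip_approxU.
- by apply: bigcup_measurable => k _; have [] := HF k.
- move=> x; apply: cvg_near_cst; have [[k _ Fkx]|nx] := pselect ((\bigcup_k F k) x).
    exists k.+1 => // j /= kj; rewrite !indicE !mem_set//; first by exists k.
    by rewrite -bigcup_mkord; exists k.
  apply: nearW => k; rewrite !indicE !memNset// -bigcup_mkord => -[i _ Fix]; apply: nx.
  by exists i.
Qed.

(** The clamp of [u] to [0, 1], written with maxima, sums and multiples only, so that the closure
    properties of [lip] apply. *)
Definition ramp (u : R) := 1 + (- 1) * Num.max 0 (1 + (- 1) * Num.max 0 u).

Lemma ramp0 u : u <= 0 -> ramp u = 0.
Proof. by move=> u0; rewrite /ramp (max_l u0) mulr0 addr0 (max_r ler01) mulr1 subrr. Qed.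

Lemma ramp1 u : 1 <= u -> ramp u = 1.
Proof.
move=> u1; rewrite /ramp (max_r (le_trans ler01 u1)) max_l ?mulr0 ?addr0//.
by rewrite mulN1r subr_le0.
Qed.

Lemma ramp01 u : 0 <= ramp u <= 1.
Proof.
rewrite /ramp !mulN1r subr_ge0 gerBl le_max lexx ge_max ler01/= gerBl le_max lexx.
by [].
Qed.

Lemma lip_approx_ball (c : MM) (e : R) : lip_approx [set x | `|x - c| < e].
Proof.
have mF : measurable ([set x | `|x - c| < e] : set (borel MM)).
  rewrite (_ : [set x | _] = (fun x : borel MM => `|(x : MM) - c|) @^-1` `]-oo, e[%classic).
    rewrite -[X in measurable X]setTI.
    by apply: (lip_measurable (lip_norm c) measurableT); exact: measurable_itv.
  by apply/seteqP; split => s /=; rewrite in_itv/=.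
(* For [k > 0], [f k] is 1 at points of depth at least [1 / k] in the ball and 0 outside the ball,
   hence it converges pointwise to the indicator. *)
pose f (k : nat) x := ramp (k%:R * (e + (- 1) * `|x - c|)).
have lf k : lip (f k).
  apply: lipD; first exact: lip_cst.
  apply/lipZ/lip_max; first exact: lip_cst.
  apply: lipD; first exact: lip_cst.
  apply/lipZ/lip_max; first exact: lip_cst.
  apply/lipZ/lipD; [exact: lip_cst|exact/lipZ/lip_norm].
split => // r r0.
have : (fun k => Ex P (fun x => `|f k x - \1_[set x | `|x - c| < e] x|)) @ \oo --> (0 : R).
  rewrite -[X in _ --> X](Ex_cst P 0).
  apply: (Ex_dct _ _ _ (intg_cst P 1)) => //.
  - by move=> k; apply: intg_meas; apply: intg_approx => // x; exact: ramp01.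
  - move=> x; apply: cvg_near_cst; rewrite indicE; have [xc|xc] := ltrP `|x - c| e.
      rewrite mem_set//=; near=> k; rewrite /f ramp1 ?subrr ?normr0//.
      have d0 : 0 < e - `|x - c| by rewrite subr_gt0.
      rewrite mulN1r -ler_pdivrMr// div1r; near: k; exact: nbhs_infty_ger.
    apply: nearW => k; rewrite memNset /=; last by rewrite ltNge xc.
    rewrite /f ramp0 ?subrr ?normr0// mulN1r mulr_ge0_le0// subr_le0//.
  - move=> k x; rewrite normr_id; have /andP[h0 h1] := ramp01 (k%:R * (e + (- 1) * `|x - c|)).
    by rewrite indicE /f; case: (_ \in _) => /=; rewrite ler_norml; apply/andP; split; lra.
move=> /cvgr0_norm_le /(_ _ r0)[k _ /(_ k (leqnn k)) /= Hk].
exists (f k); split => //; first by move=> x; exact: ramp01.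
exact: le_trans (ler_norm _) Hk.
Unshelve. all: by end_near. Qed.

(* The approximable sets form a sigma-algebra that contains the balls. *)
Lemma lip_approx_measurable A : measurable A -> lip_approx A.
Proof.
move: A; apply: smallest_sub; last first.
  move=> V oV; rewrite (open_bigcup_rat_ball oV).
  pose F (c : ('M[rat]_(m, n) * nat)%type) : set MM :=
    if `[< rat_ball c `<=` V >] then rat_ball c else set0.
  rewrite (_ : \bigcup_c _ = \bigcup_k (if unpickle k is Some c then F c else set0)); last first.
    apply/seteqP; split => [x [c _ xc]|x [k _]].
      by exists (pickle c) => //; rewrite pickleK.
    by case: unpickle => // c xc; exists c.
  apply: lip_approx_bigcup => k; case: unpickle => [c|]; last exact: lip_approx0.
  by rewrite /F; case: ifPn => _; [exact: lip_approx_ball|exact: lip_approx0].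
split; first exact: lip_approx0.
- by move=> A; rewrite setTD; exact: lip_approxC.
- by move=> F HF; exact: lip_approx_bigcup.
Qed.

(** The staircase of [psi] is uniformly within [e / 2], and each of its indicators is replaced by a
    Lipschitz function within [e / 2] in mean; an average of functions with values in [0, 1] stays
    in [0, 1]. *)
Lemma lip_dense01 (psi : borel MM -> R) (e : R) : measurable_fun setT psi ->
  (forall x, 0 <= psi x <= 1) -> 0 < e ->
  exists phi : MM -> R, [/\ lip phi, forall x, 0 <= phi x <= 1 &
    Ex P (fun x => `|phi x - psi x|) <= e].
Proof.
move=> mpsi psi01 e0; have e2 : 0 < e / 2 by rewrite divr_gt0.
pose k := Num.truncn (2 / e).
have ke : k.+1%:R^-1 <= e / 2.
  rewrite -[leRHS]invf_div lef_pV2 ?posrE ?ltr0n ?divr_gt0// ltW//.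
  by have /andP[_] := truncn_itv (divr_ge0 (ler0n R 2) (ltW e0)).
pose S (i : nat) : set R := `[i.+1%:R / k.+1%:R, +oo[%classic.
have inS i t : \1_(S i) t = (i.+1%:R / k.+1%:R <= t)%R%:R :> R.
  by rewrite indicE; congr (nat_of_bool _)%:R; apply/idP/idP; rewrite inE /S /= in_itv/= andbT.
have mS i : measurable (psi @^-1` S i).
  by rewrite -[X in measurable X]setTI; apply: mpsi => //; exact: measurable_itv.
have /all_sig[F HF] (i : 'I_k.+1) : {phi | [/\ lip phi, forall x, 0 <= phi x <= 1 &
    Ex P (fun x => `|phi x - \1_(psi @^-1` S i) x|) <= e / 2]}.
  by apply: cid; have [_] := lip_approx_measurable (mS i); exact.
have k0 : 0 < k.+1%:R^-1 :> R by rewrite invr_gt0 ltr0n.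
pose phi x := k.+1%:R^-1 * \sum_i F i x.
have lphi : lip phi by apply/lipZ/lip_sum => i; have [] := HF i.
have phi01 x : 0 <= phi x <= 1.
  apply/andP; split.
    by rewrite mulr_ge0 ?(ltW k0)// sumr_ge0// => i _; have [_ /(_ x)/andP[]] := HF i.
  rewrite /phi mulrC ler_pdivrMr ?ltr0n// mul1r.
  have -> : k.+1%:R = \sum_(i < k.+1) 1 :> R by rewrite sumr_const card_ord.
  rewrite ler_sum// => i _.
  by have [_ /(_ x)/andP[]] := HF i.
exists phi; split => //.
have Iphi : intg P phi.
  apply: (@intg_bounded _ _ _ _ _ 1); first exact: lip_measurable.
  by move=> x; have /andP[h0 h1] := phi01 x; rewrite ger0_norm.
have Ipsi : intg P psi.
  apply: (@intg_bounded _ _ _ _ _ 1) => //.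
  by move=> x; have /andP[h0 h1] := psi01 x; rewrite ger0_norm.
have IF (i : 'I_k.+1) : intg P (fun x => `|F i x - \1_(psi @^-1` S i) x|).
  by have [? ? _] := HF i; exact: intg_approx.
pose g x := k.+1%:R^-1 * (\sum_i `|F i x - \1_(psi @^-1` S i) x|) + k.+1%:R^-1.
have Ig : intg P g.
  by apply: intgD (intg_cst _ _); apply: intgZ; apply: intg_sum => i _; exact: IF.
apply: (@le_trans _ _ (Ex P g)).
  apply: Ex_le => //; first by apply/intg_norm/intgB.
  move=> x; rewrite (_ : phi x - psi x = (phi x - stair k (psi x)) - (psi x - stair k (psi x))); last by ring.
  rewrite (le_trans (ler_normB _ _))// lerD//; last exact: stair_close.
  rewrite /phi /stair -mulrBr normrM (gtr0_norm k0) ler_wpM2l ?(ltW k0)//.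
  rewrite -sumrB (le_trans (ler_norm_sum _ _ _))// ler_sum// => i _.
  by rewrite (indic_preim _ psi) inS.
rewrite ExD; [|by apply: intgZ; apply: intg_sum => i _; exact: IF|exact: intg_cst].
rewrite Ex_cst ExZ; last by apply: intg_sum => i _; exact: IF.
rewrite Ex_sum; last by move=> i _; exact: IF.
rewrite [leRHS](splitr e) lerD// mulrC ler_pdivrMr ?ltr0n//.
rewrite (@le_trans _ _ (\sum_(i < k.+1) e / 2))//; last first.
  by rewrite sumr_const card_ord mulr_natr.
by apply: ler_sum => i _; have [] := HF i.
Qed.

Lemma lip_dense (psi : borel MM -> R) (B e : R) : measurable_fun setT psi ->
  (forall x, `|psi x| <= B) -> 0 < e ->
  exists phi : MM -> R, [/\ lip phi, forall x, `|phi x| <= B &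
    Ex P (fun x => `|phi x - psi x|) <= e].
Proof.
move=> mpsi psiB e0; have B0 : 0 <= B by exact: le_trans (psiB point).
(* If [B = 0], then [psi] vanishes and [psi0] is 0 because the inverse of 0 is 0, so the affine
   relation [psiE] holds in this case too. *)
pose psi0 x := (psi x + B) / (2 * B).
have psiE x : psi x = 2 * B * psi0 x - B.
  rewrite /psi0; have [B1|B1] := eqVneq B 0.
    by have := psiB x; rewrite B1 normr_le0 => /eqP ->; rewrite !(mulr0, mul0r, addr0, subr0).
  by field; rewrite B1.
have psi01 x : 0 <= psi0 x <= 1.
  have := psiB x; rewrite ler_norml => /andP[h1 h2].
  have [B1|B1] := eqVneq B 0; first by rewrite /psi0 B1 mulr0 invr0 mulr0 lexx ler01.
  have {}B1 : 0 < B by rewrite lt_neqAle eq_sym B1.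
  rewrite /psi0 ler_pdivrMr ?mulr_gt0// divr_ge0 ?mulr_ge0//=; lra.
have mpsi0 : measurable_fun setT psi0.
  by apply: measurable_funM => //; apply: measurable_funD.
have eB : 0 < e / (2 * B + 1) by rewrite divr_gt0// ltr_wpDl// mulr_ge0.
have [f [lf f01 fe]] := lip_dense01 mpsi0 psi01 eB.
have If : intg P (fun x => `|f x - psi0 x|).
  apply/intg_norm/intgB; apply: (@intg_bounded _ _ _ _ _ 1) => //.
  - exact: lip_measurable.
  - by move=> x; have /andP[h0 h1] := f01 x; rewrite ger0_norm.
  - by move=> x; have /andP[h0 h1] := psi01 x; rewrite ger0_norm.
exists (fun x => - B + 2 * B * f x); split.
- by apply: lipD; [exact: lip_cst|exact: lipZ].
- move=> x; have /andP[h0 h1] := f01 x; rewrite ler_norml; apply/andP; split.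
    by rewrite lerDl !mulr_ge0.
  by have := ler_wpM2l (mulr_ge0 (ler0n R 2) B0) h1; rewrite mulr1; lra.
rewrite (@Ex_eq _ _ _ P _ (fun x => 2 * B * `|f x - psi0 x|)).
  rewrite ExZ// (le_trans (ler_wpM2l _ fe)) ?mulr_ge0//.
  rewrite mulrA ler_pdivrMr ?ltr_wpDl ?mulr_ge0// mulrC ler_wpM2l ?(ltW e0)//.
  by rewrite lerDl.
move=> x; rewrite psiE -[in RHS](ger0_norm (mulr_ge0 (ler0n R 2) B0)) -normrM.
by congr `|_|; ring.
Qed.

End Density.
End Lipschitz.

(** * Increments and the Taylor expansion *)

Section Increments.
Variables (R : realType) (N d : nat).
Implicit Types (x y z : 'M[R]_(N, d)) (k : 'I_N) (i : 'I_d).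

Definition inc k i x : R := incr k x 0 i.

(** The position at a time given by a plain natural number, so that sums of increments telescope;
    row [m] is the position at time [m + 1], and the value is 0 at time 0 and beyond the horizon. *)
Definition pos (n : nat) i x : R :=
  if n is m.+1 then (if insub m is Some k then x k i else 0) else 0.

Lemma XtE (n : 'I_N.+1) i x : Xt n x 0 i = pos n i x.
Proof.
rewrite /Xt; case: unliftP => [j ->|->]; last by rewrite mxE.
by rewrite /= insubT ?ltn_ord// => h; rewrite mxE; congr (x _ i); apply: val_inj.
Qed.

Lemma pos_this k i x : pos k.+1 i x = x k i.
Proof. by rewrite /= insubT ?ltn_ord// => h; congr (x _ i); apply: val_inj. Qed.

Lemma incE k i x : inc k i x = pos k.+1 i x - pos k i x.
Proof. by rewrite /inc /incr !mxE !XtE. Qed.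

Lemma posD n i x y : pos n i (x + y) = pos n i x + pos n i y.
Proof.
case: n => [|n] /=; first by rewrite addr0.
by case: insub => [k|]; rewrite ?mxE ?addr0.
Qed.

Lemma posN n i x : pos n i (- x) = - pos n i x.
Proof.
case: n => [|n] /=; first by rewrite oppr0.
by case: insub => [k|]; rewrite ?mxE ?oppr0.
Qed.

Lemma incB k i x y : inc k i (x - y) = inc k i x - inc k i y.
Proof. by rewrite !incE !posD !posN; ring. Qed.

Lemma sum_inc k i x : x k i = \sum_(j < N | (j <= k)%N) inc j i x.
Proof.
rewrite (eq_bigr (fun j : 'I_N => pos j.+1 i x - pos j i x)); last by move=> j _; exact: incE.
transitivity (\sum_(j < k.+1) (pos j.+1 i x - pos j i x)); last first.
  by rewrite (big_ord_widen N (fun j => pos j.+1 i x - pos j i x)) ?ltn_ord.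
by rewrite -(big_mkord xpredT (fun j => pos j.+1 i x - pos j i x)) telescope_sumr// subr0 pos_this.
Qed.

Lemma inc_le k i x : `|inc k i x| <= 2 * `|x|.
Proof.
have H n : `|pos n i x| <= `|x|.
  case: n => [|n] /=; first by rewrite normr0.
  by case: insub => [j|]; rewrite ?normr0//; exact: mx_coord_le.
by rewrite incE (le_trans (ler_normB _ _))// mulr_natl mulr2n lerD.
Qed.

Definition inc1 x := \sum_(k < N) \sum_(i < d) `|inc k i x|.

Lemma inc1_ge0 x : 0 <= inc1 x.
Proof. by apply: sumr_ge0 => k _; apply: sumr_ge0. Qed.

Lemma norm_le_inc1 x : `|x| <= inc1 x.
Proof.
apply/mx_norm_leP => [|k i]; first exact: inc1_ge0.
rewrite (sum_inc k i x) (le_trans (ler_norm_sum _ _ _))//.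
rewrite (@le_trans _ _ (\sum_(j < N) `|inc j i x|))//.
  by rewrite [leRHS](bigID (fun j : 'I_N => (j <= k)%N))/= lerDl sumr_ge0.
by apply: ler_sum => j _; rewrite (bigD1 i)//= lerDl sumr_ge0.
Qed.

Lemma inc1_le x : inc1 x <= (N * d)%:R * 2 * `|x|.
Proof.
rewrite (@le_trans _ _ (\sum_(k < N) \sum_(i < d) (2 * `|x|)))//.
  by apply: ler_sum => k _; apply: ler_sum => i _; exact: inc_le.
by rewrite !sumr_const !card_ord -mulrnA -mulr_natl !natrM; apply: eq_ler; ring.
Qed.

Definition incp (p : R) x := \sum_(k < N) \sum_(i < d) `|inc k i x| `^ p.

Lemma incp_ge0 p x : 0 <= incp p x.
Proof. by apply: sumr_ge0 => k _; apply: sumr_ge0 => i _; exact: powR_ge0. Qed.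

Lemma inc_incp p k i x : `|inc k i x| `^ p <= incp p x.
Proof.
rewrite /incp (bigD1 k)//= (bigD1 i)//= -addrA lerDl addr_ge0//.
  by apply: sumr_ge0 => j _; exact: powR_ge0.
by apply: sumr_ge0 => j _; apply: sumr_ge0 => l _; exact: powR_ge0.
Qed.

Lemma inc1_incp p x : 0 < p -> inc1 x `^ p <= (N * d)%:R `^ p * incp p x.
Proof.
move=> p0; have pn : p != 0 by rewrite gt_eqF.
have : inc1 x <= (N * d)%:R * (incp p x) `^ p^-1.
  rewrite (@le_trans _ _ (\sum_(k < N) \sum_(i < d) (incp p x) `^ p^-1))//.
    apply: ler_sum => k _; apply: ler_sum => i _.
    rewrite -[leLHS](@powRK _ p)//; apply: powR_mono; rewrite ?invr_ge0 ?powR_ge0 ?(ltW p0)//.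
    exact: inc_incp.
  by rewrite !sumr_const !card_ord -mulrnA -mulr_natl !natrM; apply: eq_ler; ring.
move/(powR_mono (ltW p0) (inc1_ge0 x)) => /le_trans; apply.
by rewrite powRM ?powR_ge0// powRVK// incp_ge0.
Qed.

Lemma lnormE (p : R) k x y : p != 0 ->
  lnorm p (incr k x - incr k y) `^ p = \sum_(i < d) `|inc k i (x - y)| `^ p.
Proof.
move=> p0; rewrite /lnorm powRVK//; last by apply: sumr_ge0 => i _; exact: powR_ge0.
by apply: eq_bigr => i _; rewrite incB /inc !mxE.
Qed.

Lemma costE (p : R) x y : p != 0 -> cost p x y = incp p (x - y).
Proof. by move=> p0; apply: eq_bigr => k _; rewrite lnormE. Qed.

Lemma measurable_inc k i : measurable_fun setT (inc k i : pathspace R N d -> R).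
Proof.
have H (n : 'I_N.+1) : measurable_fun setT (fun x : pathspace R N d => Xt n x 0 i).
  exact: measurableT_comp (measurable_coord _ _) (measurable_Xt n).
rewrite (_ : inc k i = fun x : pathspace R N d => Xt (this_time k) x 0 i - Xt (prev_time k) x 0 i).
  exact: measurable_funB.
by apply/funext => x; rewrite /inc /incr !mxE.
Qed.

Lemma measurable_norm_path : measurable_fun setT (fun x : pathspace R N d => `|x : 'M[R]_(N, d)|).
Proof.
have := lip_measurable (lip_norm (0 : 'M[R]_(N, d))).
by under eq_fun do rewrite subr0.
Qed.

End Increments.

Section Taylor.
Variables (R : realType) (N d : nat) (f : 'M[R]_(N, d) -> R).
Hypothesis f1 : C1 f.
Implicit Types (x y z : 'M[R]_(N, d)).

Definition pairing x z := \sum_(k < N) \sum_(i < d) DD f x k i * inc k i z.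

(** Summation by parts: each position is the sum of the increments up to its time, so the increment
    number [j] collects the partial derivatives with respect to all positions from [j] on. This is
    how [DD] arises. *)
Lemma derive_pairing x z : 'D_z f x = pairing x z.
Proof.
have [df _] := f1.
rewrite deriveE// [in LHS](matrix_sum_delta z) linear_sum /=.
under eq_bigr => k _.
  rewrite linear_sum; under eq_bigr => i _ do rewrite linearZ /= -deriveE//.
  over.
rewrite /= /pairing exchange_big [RHS]exchange_big /=; apply: eq_bigr => i _.
under eq_bigr => k _ do rewrite (sum_inc k i z) scaler_suml.
rewrite (exchange_big_dep xpredT)//=; apply: eq_bigr => j _.
rewrite mxE /DD_ summxE mulr_suml; apply: eq_bigr => k _.
by rewrite mxE mulrC.
Qed.

Lemma taylor_mvt x z : exists2 s : R, 0 < s < 1 & f (x + z) - f x = pairing (x + s *: z) z.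
Proof.
have [df _] := f1.
pose g (s : R) := f (x + s *: z).
have dg (s : R) : is_derive s 1 g (pairing (x + s *: z) z).
  have E : (fun h : R => h^-1 *: (g (h *: 1 + s) - g s)) =
           (fun h : R => h^-1 *: (f (h *: z + (x + s *: z)) - f (x + s *: z))).
    apply/funext => h; rewrite /g; congr (_ *: (f _ - _)).
    by rewrite [h *: 1]mulr1 scalerDl addrCA.
  split.
    have D : derivable f (x + s *: z) z by exact: diff_derivable.
    by rewrite /derivable /= E; exact: D.
  by rewrite -derive_pairing /derive /= E.
have cg : {within `[0, 1], continuous g}.
  by apply: derivable_within_continuous => s _; exact: (@ex_derive _ _ _ _ _ _ _ (dg s)).
have [c] := @MVT _ g (fun s => pairing (x + s *: z) z) 0 1 ltr01 (fun s _ => dg s) cg.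
rewrite in_itv /= => c01; rewrite /g scale1r scale0r addr0 subr0 mulr1 => ->.
by exists c.
Qed.

Lemma pairing_le x (M : R) z : (forall k i, `|DD f x k i| <= M) ->
  `|pairing x z| <= M * inc1 z.
Proof.
move=> H; rewrite (le_trans (ler_norm_sum _ _ _))// /inc1 mulr_sumr ler_sum// => k _.
rewrite (le_trans (ler_norm_sum _ _ _))// mulr_sumr ler_sum// => i _.
by rewrite normrM ler_wpM2r.
Qed.

Lemma pairingB_le x y (M : R) z : (forall k i, `|DD f y k i - DD f x k i| <= M) ->
  `|pairing y z - pairing x z| <= M * inc1 z.
Proof.
move=> H; rewrite /pairing -sumrB.
rewrite (le_trans (ler_norm_sum _ _ _))// /inc1 mulr_sumr ler_sum// => k _.
rewrite -sumrB (le_trans (ler_norm_sum _ _ _))// mulr_sumr ler_sum// => i _.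
by rewrite -mulrBl normrM ler_wpM2r.
Qed.

Lemma continuous_DD k i : continuous (fun x => DD f x k i).
Proof.
have [_ cg] := f1; move=> x.
have H (r : seq 'I_N) : {for x, continuous (fun x => \sum_(j <- r | (k <= j)%N) grad f j x 0 i)}.
  elim: r => [|j r IH].
    rewrite (_ : (fun x => _) = fun=> 0); first exact: cst_continuous.
    by apply/funext => y; rewrite big_nil.
  rewrite (_ : (fun x => _) = fun x => (if (k <= j)%N then grad f j x 0 i else 0) +
      \sum_(j <- r | (k <= j)%N) grad f j x 0 i).
    apply: continuousD => //; case: (k <= j)%N; last exact: cst_continuous.
    apply: (@continuous_comp _ _ _ (grad f j) (fun v : 'rV[R]_d => v 0 i) x).
      exact: cg.
    exact: coord_continuous.
  by apply/funext => y; rewrite big_cons; case: ifP => //; rewrite add0r.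
rewrite (_ : (fun x => _) = fun x => \sum_(j < N | (k <= j)%N) grad f j x 0 i); first exact: H.
by apply/funext => y; rewrite mxE /DD_ summxE.
Qed.

Lemma continuous_DDmx : continuous (DD f).
Proof.
move=> x B [P HP PB].
have FF : Filter (nbhs x) by exact: nbhs_filter.
have H : nbhs x (fun y => forall i j, P i j (DD f y i j)).
  apply: (@filter_forall _ _ (fun i y => forall j, P i j (DD f y i j)) _ FF) => i.
  apply: (@filter_forall _ _ (fun j y => P i j (DD f y i j)) _ FF) => j.
  exact: (@continuous_DD i j x _ (HP i j)).
by apply: filterS H => y Py; exact: PB.
Qed.

Variables (p q C : R).
Hypotheses (p1 : 1 < p) (qE : q = p / (p - 1)).
Hypothesis fC : forall x, `|DD f x| <= C * (1 + `|x| `^ (p - 1)).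

Let p0 : 0 < p. Proof. exact: lt_trans p1. Qed.
Let pB0 : 0 < p - 1. Proof. by rewrite subr_gt0. Qed.

Lemma growth_ge0 : 0 <= C.
Proof.
have := le_trans (normr_ge0 _) (fC 0).
by rewrite normr0 powR0 ?addr0 ?mulr1// gt_eqF.
Qed.

Lemma DD_segment x z (s : R) : 0 < s < 1 -> forall k i,
  `|DD f (x + s *: z) k i| <= C * (1 + 2 `^ (p - 1)) * (1 + `|x| `^ (p - 1) + (inc1 z) `^ (p - 1)).
Proof.
move=> /andP[s0 s1] k i; rewrite (le_trans (mx_coord_le _ k i))// (le_trans (fC _))//.
rewrite -[leRHS]mulrA ler_wpM2l ?growth_ge0//.
have h : `|x + s *: z| `^ (p - 1) <= 2 `^ (p - 1) * (`|x| `^ (p - 1) + (inc1 z) `^ (p - 1)).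
  have := powR_add_le `|x| (inc1 z) (ltW pB0).
  rewrite normr_id (ger0_norm (inc1_ge0 z)) => /(le_trans _); apply.
  apply: powR_mono => //; first exact: ltW.
  rewrite ger0_norm ?addr_ge0 ?inc1_ge0// (le_trans (ler_normD _ _))// lerD2l normrZ.
  rewrite (le_trans _ (norm_le_inc1 z))// ler_piMl// ger0_norm; exact: ltW.
have := powR_ge0 2 (p - 1); have := powR_ge0 `|x| (p - 1); have := powR_ge0 (inc1 z) (p - 1).
move: h; move: (2 `^ (p - 1)) (`|x| `^ (p - 1)) (inc1 z `^ (p - 1)) (`|x + s *: z| `^ (p - 1)).
by move=> a b c e h h1 h2 h3; nra.
Qed.

(** The mean value theorem and the growth condition leave [(1 + |x|^(p-1)) t + t^p] with
    [t = inc1 z]. Young's inequality for [1 + |x|^(p-1)] and [t / delta], together with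
    [(p - 1) q = p], puts a factor [delta] in front of the term in [x]. The scale [delta] is free: 1
    serves for integrability, the size of the displacement for large costs. *)
Lemma crude_bound : exists2 A, 0 <= A & forall x z (delta : R), 0 < delta ->
  `|f (x + z) - f x| <= A * delta * (1 + `|x| `^ p) + A * (delta * (inc1 z / delta) `^ p + inc1 z `^ p).
Proof.
pose C1 := C * (1 + 2 `^ (p - 1)).
have C10 : 0 <= C1 by rewrite mulr_ge0 ?growth_ge0 ?addr_ge0 ?powR_ge0.
exists (C1 * (1 + 2 `^ q)); first by rewrite mulr_ge0 ?addr_ge0 ?powR_ge0.
move=> x z delta d0; have [s s01 ->] := taylor_mvt x z.
apply: (le_trans (pairing_le z (@DD_segment x z s s01))).
rewrite -/C1; clearbody C1; rewrite -!mulrA -mulrDr ler_wpM2l//.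
set t := inc1 z; have t0 : 0 <= t by exact: inc1_ge0.
have H1 : t `^ (p - 1) * t = t `^ p by rewrite mulrC mulr_powRB1.
have xp0 := powR_ge0 `|x| (p - 1).
have H2 : (1 + `|x| `^ (p - 1)) * (t / delta) <=
    2 `^ q * (1 + `|x| `^ p) + (t / delta) `^ p.
  rewrite (le_trans (young1 p1 qE _ _))// ?addr_ge0 ?divr_ge0 ?(ltW d0)// lerD2r.
  have := powR_add_le 1 (`|x| `^ (p - 1)) (ltW (q_gt0 p1 qE)).
  by rewrite (ger0_norm (addr_ge0 _ _))// normr1 powR1 (ger0_norm xp0) -powRrM (conj_mul' p1 qE).
have {H2} := ler_wpM2l (ltW d0) H2.
have -> : delta * ((1 + `|x| `^ (p - 1)) * (t / delta)) = (1 + `|x| `^ (p - 1)) * t.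
  by field; rewrite gt_eqF.
have := powR_ge0 (t / delta) p; have := powR_ge0 t p; have := powR_ge0 2 q; have := powR_ge0 `|x| p.
rewrite [(_ + t `^ (p - 1)) * t]mulrDl H1.
move: (t `^ p) ((t / delta) `^ p) (`|x| `^ p) (2 `^ q) ((1 + `|x| `^ (p - 1)) * t) => a b c e g h1 h2 h3 h4 h5.
have : 0 <= e * a by exact: mulr_ge0.
have : 0 <= e * (delta * b) by rewrite !mulr_ge0// ltW.
have : 0 <= delta * (1 + c) by rewrite mulr_ge0 ?(ltW d0)// addr_ge0.
by nra.
Qed.

(* The modulus of continuity of [DD f] on a ball gives the first term; the other
   two account for large displacements [z] and for large paths [x]. *)
Lemma taylor_bound (e : R) : 0 < e -> exists2 A, 0 <= A &
  forall K : R, exists2 B, 0 <= B & forall x z (delta : R), 0 < delta ->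
  `|f (x + z) - f x - pairing x z| <=
    e * delta * (1 + (inc1 z / delta) `^ p) + B * inc1 z `^ p +
    delta * A * ((K < `|x|)%R%:R * (1 + `|x| `^ p)).
Proof.
move=> e0.
pose C1 := C * (1 + 2 `^ (p - 1)) * 2 + 1.
have C10 : 0 < C1 by rewrite ltr_wpDl// !mulr_ge0 ?growth_ge0 ?addr_ge0 ?powR_ge0.
have crude x z : `|f (x + z) - f x - pairing x z| <=
    C1 * ((1 + `|x| `^ (p - 1)) * inc1 z + inc1 z `^ p).
  have [s s01 ->] := taylor_mvt x z.
  have h1 := pairing_le z (@DD_segment x z s s01).
  have h2 : `|pairing x z| <= C * (1 + `|x| `^ (p - 1)) * inc1 z.
    by apply: pairing_le => k i; exact: le_trans (mx_coord_le _ _ _) (fC x).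
  rewrite (le_trans (ler_normB _ _))// (le_trans (lerD h1 h2))// /C1.
  have H1 : inc1 z `^ (p - 1) * inc1 z = inc1 z `^ p by rewrite mulrC mulr_powRB1// inc1_ge0.
  rewrite -H1; have := inc1_ge0 z; have := growth_ge0; have := powR_ge0 2 (p - 1).
  have := powR_ge0 `|x| (p - 1); have := powR_ge0 (inc1 z) (p - 1).
  move: (inc1 z) (2 `^ (p - 1)) (`|x| `^ (p - 1)) (inc1 z `^ (p - 1)) => t a b c c0 b0 a0 C0 t0.
  have Ct : 0 <= C * t by rewrite mulr_ge0.
  have : 0 <= C * t * b by rewrite mulr_ge0.
  have : 0 <= C * t * c by rewrite mulr_ge0.
  have : 0 <= C * t * a by rewrite mulr_ge0.
  have : 0 <= C * t * a * b by rewrite !mulr_ge0.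
  have : 0 <= C * t * a * c by rewrite !mulr_ge0.
  have : 0 <= t * b by rewrite !mulr_ge0.
  have : 0 <= c * t by rewrite !mulr_ge0.
  by move=> *; lra.
have [A0 A00 HA] := young_eps p1 qE (divr_gt0 e0 C10).
exists (C1 * A0 * 2 `^ q); first by rewrite !mulr_ge0 ?powR_ge0 ?(ltW C10).
move=> K.
have [eta eta0 Heta] := compact_unif_continuous (@compact_mx_ball R N d K) continuous_DDmx e0.
exists (C1 * ((1 + `|K| `^ (p - 1)) * eta `^ (1 - p) + 1)).
  by rewrite mulr_ge0 ?(ltW C10)// addr_ge0// mulr_ge0 ?powR_ge0// addr_ge0 ?powR_ge0.
move=> x z delta d0; set t := inc1 z; have t0 : 0 <= t by exact: inc1_ge0.
have td0 : 0 <= t / delta by rewrite divr_ge0// ltW.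
have tdp := powR_ge0 (t / delta) p; have tp := powR_ge0 t p; have xp := powR_ge0 `|x| p.
have ed0 : 0 <= e * delta by rewrite mulr_ge0// ltW.
set B := C1 * _; have BC : C1 <= B.
  by rewrite /B -[leLHS]mulr1 ler_wpM2l ?(ltW C10)// lerDr mulr_ge0 ?powR_ge0// addr_ge0 ?powR_ge0.
have B0 : 0 <= B by apply: le_trans BC; exact: ltW.
have T2 : 0 <= e * delta * (1 + (t / delta) `^ p) by rewrite mulr_ge0// addr_ge0.
have T1 : 0 <= B * t `^ p by rewrite mulr_ge0.
have T3 : 0 <= delta * (C1 * A0 * 2 `^ q) * ((K < `|x|)%R%:R * (1 + `|x| `^ p)).
  by rewrite !mulr_ge0 ?powR_ge0 ?(ltW C10) ?(ltW d0)// addr_ge0.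
move: T3; have [xK|Kx] := lerP `|x| K => T3.
  have [te|et] := lerP t eta.
    have [s /andP[s0 s1] ->] := taylor_mvt x z.
    have h : `|pairing (x + s *: z) z - pairing x z| <= e * t.
      apply: pairingB_le => k i.
      have := mx_coord_le (DD f (x + s *: z) - DD f x) k i; rewrite !mxE => /le_trans; apply.
      apply: Heta => //; rewrite addrAC subrr add0r normrZ (le_trans _ te)//.
      by rewrite (le_trans _ (norm_le_inc1 z))// ler_piMl// ger0_norm; exact: ltW.
    apply: (@le_trans _ _ (e * delta * (1 + (t / delta) `^ p))); last by rewrite -addrA lerDl addr_ge0.
    apply: (le_trans h); rewrite -mulrA ler_wpM2l ?(ltW e0)//.
    rewrite mulrC -ler_pdivrMr// le_add1_powR// ltW//.
  (* Displacements larger than [eta]: here [t <= eta^(1-p) t^p], so the crude bound is a multiple of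
     [t^p]. *)
  apply: (@le_trans _ _ (B * t `^ p)); last by rewrite [leRHS]addrAC lerDr addr_ge0.
  rewrite (le_trans (crude x z))// -/t /B -mulrA ler_wpM2l ?(ltW C10)//.
  rewrite [leRHS]mulrDl mul1r lerD2r -mulrA.
  have xK' : 1 + `|x| `^ (p - 1) <= 1 + `|K| `^ (p - 1).
    by rewrite lerD2l powR_mono ?(ltW pB0)// (le_trans xK)// ler_norm.
  apply: ler_pM => //.
  have eE : eta `^ (1 - p) = (eta `^ (p - 1))^-1 by rewrite -powRN opprB.
  rewrite eE ler_pdivlMl ?powR_gt0// -(mulr_powRB1 t0 p0) mulrC ler_wpM2l//.
  by rewrite powR_mono ?(ltW pB0) ?(ltW eta0)// ltW.
(* Paths outside the ball: Young's inequality with weight [e / C1] on [(t / delta)^p] leaves a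
   multiple of [delta * (1 + |x|^p)], whose coefficient does not depend on [K]. *)
rewrite (le_trans (crude x z))// -/t mul1r.
have H2 : (1 + `|x| `^ (p - 1)) * (t / delta) <=
    A0 * (2 `^ q * (1 + `|x| `^ p)) + e / C1 * (t / delta) `^ p.
  rewrite (le_trans (HA _ _ _ td0)) ?addr_ge0 ?powR_ge0// lerD2r ler_wpM2l//.
  have := powR_add_le 1 (`|x| `^ (p - 1)) (ltW (q_gt0 p1 qE)).
  have xp0 := powR_ge0 `|x| (p - 1).
  by rewrite (ger0_norm (addr_ge0 _ _))// normr1 powR1 (ger0_norm xp0) -powRrM (conj_mul' p1 qE).
have {H2} := ler_wpM2l (mulr_ge0 (ltW C10) (ltW d0)) H2.
have -> : C1 * delta * ((1 + `|x| `^ (p - 1)) * (t / delta)) = C1 * ((1 + `|x| `^ (p - 1)) * t).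
  by field; rewrite gt_eqF.
have -> : C1 * delta * (A0 * (2 `^ q * (1 + `|x| `^ p)) + e / C1 * (t / delta) `^ p) =
  delta * (C1 * A0 * 2 `^ q) * (1 + `|x| `^ p) + e * delta * (t / delta) `^ p.
  by field; rewrite gt_eqF.
have : C1 * t `^ p <= B * t `^ p by rewrite ler_wpM2r.
rewrite [C1 * (_ * t + _)]mulrDr [e * delta * (1 + _)]mulrDr mulr1 => h1 h2.
rewrite (le_trans (lerD h2 h1))// -subr_ge0; apply: le_trans ed0 _.
by apply: eq_ler; ring.
Qed.

End Taylor.

Lemma Ex_indic d (T : measurableType d) (R : realType) (P : probability T R) (A : set T) :
  measurable A -> Ex P \1_A = fine (P A).
Proof. by move=> mA; rewrite /Rintegral integral_indic// setIT. Qed.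

Notation rF n := (@rmeas _ (pathspace _ _ _) _ (@trunc _ _ _ n)).
Notation cF mu n := (@centered _ (pathspace _ _ _) _ mu (@trunc _ _ _ n)).

Section Filtered.
Variables (R : realType) (N d : nat).
Local Notation XX := (pathspace R N d).
Local Notation XX2 := (XX * XX)%type.
Implicit Types (mu nu : probability XX R) (n : 'I_N.+1).

Lemma rmeas_wrt n (g : XX -> R) : rF n g <-> measurable_wrt (Ft n) g.
Proof.
split=> [[mg gr]|mg]; first exact: measurable_wrtE.
by split; [exact: measurable_wrt_meas mg|exact: measurable_wrt_trunc].
Qed.

Lemma Ft_indic n (A : set XX) x : Ft n A -> \1_A (trunc n x) = \1_A x :> R.
Proof. by move=> /FtE[_ AE]; rewrite -[in RHS]AE. Qed.

Lemma is_condE_centered mu n (g h : XX -> R) : intg mu g ->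
  is_condE mu (Ft n) g h <-> [/\ rF n h, intg mu h & cF mu n (fun x => g x - h x)].
Proof.
move=> Ig; split=> [[mh Ih H]|[rh Ih H]].
  split => // [|A mA]; first exact/rmeas_wrt.
  have FA : Ft n (trunc n @^-1` A).
    apply/FtE; split; first exact: measurable_preim (@measurable_trunc R N d n) _ mA.
    by apply/seteqP; split => x /=; rewrite trunc_idem.
  have mA' := Ft_measurable FA.
  have := H _ FA; rewrite !intg_int// => -[E].
  rewrite (@Ex_eq _ _ _ mu _ (fun x => g x * \1_(trunc n @^-1` A) x - h x * \1_(trunc n @^-1` A) x)).
    by rewrite ExB ?E ?subrr//; exact: intgMi.
  by move=> x; rewrite mulrBl.
split => //; first exact/rmeas_wrt.
move=> A FA; have mA := Ft_measurable FA; rewrite !intg_int//; congr EFin.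
apply/eqP; rewrite eq_sym -subr_eq0 -ExB; [|exact: intgMi..].
apply/eqP; rewrite -[RHS](H _ mA); apply: Ex_eq => x.
by rewrite (Ft_indic _ FA) mulrBl.
Qed.

Lemma condE_spec mu n (g : XX -> R) : intg mu g ->
  [/\ rF n (condE mu (Ft n) g), intg mu (condE mu (Ft n) g) &
      cF mu n (fun x => g x - condE mu (Ft n) g x)].
Proof.
move=> Ig; apply/(is_condE_centered n _ Ig).
have [h [rh Ih H]] := @condexp_exists _ XX R mu _ (@measurable_trunc R N d n) (@trunc_idem R N d n) _ Ig.
apply: (@xgetPex _ (cst 0) [set h | is_condE mu (Ft n) g h]).
by exists h; apply/(is_condE_centered n _ Ig).
Qed.

Lemma rF_le (m n : nat) (g : XX -> R) : (m <= n)%N -> rF m g -> rF n g.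
Proof.
move=> mn [mg gr]; split => // x.
by rewrite -gr trunc_trunc (minn_idPl mn) gr.
Qed.

Lemma cF_le mu (m n : nat) (c : XX -> R) : (m <= n)%N -> cF mu n c -> cF mu m c.
Proof.
move=> mn H A mA.
rewrite -(H (trunc m @^-1` A)); last exact: measurable_preim (@measurable_trunc R N d m) _ mA.
apply: Ex_eq => x; rewrite (indic_preim _ (trunc m)) trunc_trunc (minn_idPl mn)//.
Qed.

Lemma rF_inc (k : 'I_N) (i : 'I_d) (n : nat) : (k < n)%N -> rF n (inc k i : XX -> R).
Proof.
move=> kn; split; first exact: measurable_inc.
move=> x; rewrite /inc /incr !mxE; congr (_ - _); congr (fun_of_matrix _ 0 i);
  rewrite Xt_trunc//; exact: ltnW.
Qed.

Lemma Xt_sum (n : 'I_N.+1) (i : 'I_d) x : Xt n x 0 i = \sum_(k < N | (k < n)%N) inc k i x :> R.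
Proof.
rewrite XtE; case: n => [[|n] /= nN]; first by rewrite big_pred0.
have := sum_inc (Ordinal (nN : (n < N)%N)) i x; rewrite -pos_this /= => ->.
by apply: eq_bigl => k; rewrite ltnS.
Qed.

Lemma intg_Xt nu (n : 'I_N.+1) (i : 'I_d) : (forall k, intg nu (inc k i)) ->
  intg nu (fun x : XX => Xt n x 0 i).
Proof.
move=> H; rewrite (_ : (fun x => _) = fun x : XX => \sum_(k < N | (k < n)%N) inc k i x).
  by apply: intg_sum => k _; exact: H.
by apply/funext => x; rewrite Xt_sum.
Qed.

(** The increment [inc k i] runs from time [k] to time [k + 1]. A difference X_n - X_m is a sum of
    increments that start at time [m] or later, and each of them is centered given a past that
    contains the events of [Ft m]. *)
Lemma martingaleP nu : martingale_measure nu <->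
  (forall k i, intg nu (inc k i) /\ cF nu k (inc k i : XX -> R)).
Proof.
split => [[Ix H] k i|H].
  have incX (x : 'M[R]_(N, d)) : inc k i x = Xt (this_time k) x 0 i - Xt (prev_time k) x 0 i.
    by rewrite /inc /incr !mxE.
  have Iinc : intg nu (inc k i).
    rewrite (_ : inc k i = fun x : XX => Xt (this_time k) x 0 i - Xt (prev_time k) x 0 i).
      by apply: intgB; exact: Ix.
    by apply/funext => x; rewrite incX.
  split => //.
  have := H (prev_time k) (this_time k) _ i => /(_ (leqnSn k)).
  move=> /(is_condE_centered _ _ (Ix (this_time k) i))[_ _ H1] A mA.
  by rewrite -(H1 A mA); apply: Ex_eq => x; rewrite incX.
have Ix n i : intg nu (fun x : XX => Xt n x 0 i) by apply: intg_Xt => k; have [] := H k i.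
split => // m n mn i; apply/(is_condE_centered m _ (Ix n i)); split => //.
  split; first exact: intg_meas (Ix m i).
  by move=> x; rewrite Xt_trunc.
move=> A mA.
have E x : Xt n x 0 i - Xt m x 0 i = \sum_(k < N | (m <= k < n)%N) inc k i x :> R.
  have S : \sum_(k < N | (k < n)%N) inc k i x =
    \sum_(k < N | (k < m)%N) inc k i x + \sum_(k < N | (m <= k < n)%N) inc k i x.
    rewrite (bigID (fun k : 'I_N => (k < m)%N))/=; congr (_ + _); apply: eq_bigl => k.
      by case: (ltnP k m) => km; rewrite ?andbF// andbT (leq_trans km).
    by rewrite andbC -leqNgt.
  by rewrite !Xt_sum S addrAC subrr add0r.
rewrite (@Ex_eq _ _ _ nu _ (fun x : XX => \sum_(k < N | (m <= k < n)%N) inc k i x * \1_A (trunc m x))).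
  rewrite Ex_sum; last first.
    move=> k _; have [Ik _] := H k i.
    have := intgMi (measurable_preim (@measurable_trunc R N d m) mA) Ik.
    exact.
  rewrite big1// => k /andP[mk _]; have [_ Ck] := H k i.
  exact: (cF_le mk Ck).
by move=> x; rewrite E mulr_suml.
Qed.

Section Causal.
Variables (mu : probability XX R) (pi : probability XX2 R).
Hypothesis pi1 : forall A, measurable A -> pi (fst @^-1` A) = mu A.
Hypothesis cpi : causal mu pi.

(* Causality: conditionally on the whole path [x], events of [Ft n] in [y] have
   an [Ft n]-measurable probability. *)
Lemma causal_orth n (c b : XX -> R) : intg mu c -> cF mu n c -> rF n b ->
  intg pi (fun z : XX2 => c z.1 * b z.2) -> Ex pi (fun z : XX2 => c z.1 * b z.2) = 0.
Proof.
move=> Ic cc rb Icb; have [mb _] := rb.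
have [k kE km] := cpi.
have mfst : measurable_fun setT (fst : XX2 -> XX) by exact: measurable_fst.
have msnd : measurable_fun setT (snd : XX2 -> XX) by exact: measurable_snd.
have Ic1 : intg pi (fun z : XX2 => c z.1).
  exact: (intg_image_inv mfst pi1 Ic).
apply: Ex_mul_eq0 => //; first exact: measurableT_comp.
move=> B mB; pose U := b @^-1` B.
have FU : Ft n U by move/rmeas_wrt : rb; exact.
have mU := Ft_measurable FU.
pose kU x := fine (k x U).
have kle x : (k x U <= 1)%E.
  by rewrite -(@prob_kernel _ _ _ _ _ k x); apply: le_measure => //; rewrite inE.
have kfin x : k x U \is a fin_num.
  by rewrite ge0_fin_numE//; apply: le_lt_trans (kle x) _; exact: ltry.
have kUE x : (kU x)%:E = k x U by rewrite /kU fineK.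
have mk : measurable_fun setT (k ^~ U) by exact: measurable_kernel.
have mkU : measurable_fun setT kU.
  by apply/measurable_EFinP; rewrite (_ : EFin \o kU = k ^~ U)//; apply/funext => x /=; rewrite kUE.
have kU0 x : 0 <= kU x by rewrite fine_ge0.
have kU1 x : `|kU x| <= 1.
  by rewrite ger0_norm// -lee_fin kUE.
have IkU : intg mu kU by exact: intg_bounded kU1.
have IkU1 : intg pi (fun z : XX2 => kU z.1) by exact: (intg_image_inv mfst pi1 IkU).
(* By the disintegration, [1_U(Y) - k(X, U)] is orthogonal to [c(X)]. There remains the mean of [c]
   times [k(., U)], which is measurable at time [n] up to null sets. *)
pose c' (z : XX2) := \1_U z.2 - kU z.1 : R.
have mU2 : measurable (snd @^-1` U : set XX2).
  by rewrite -[X in measurable X]setTI; apply: msnd.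
have Ic' : intg pi c'.
  by apply: intgB => //; exact: (intg_indic pi mU2).
have c'b z : `|c' z| <= 2.
  rewrite (le_trans (ler_normB _ _))// -[leRHS]/(1 + 1) lerD ?kU1// indicE.
  by case: (_ \in _) => /=; rewrite ?normr1 ?normr0.
have Ec' : Ex pi (fun z => c' z * c z.1) = 0.
  apply: Ex_mul_eq0 => //; first exact: measurableT_comp (intg_meas Ic) mfst.
    rewrite (_ : (fun z => _) = fun z : XX2 => c z.1 * c' z).
      by apply: (intgMb Ic1 (intg_meas Ic') c'b).
    by apply/funext => z; rewrite mulrC.
  move=> B' mB'; pose A := c @^-1` B'.
  have mA : measurable A by rewrite -[X in measurable X]setTI; apply: intg_meas Ic _ _ _.
  have mA1 : measurable (fst @^-1` A : set XX2).
    by rewrite -[X in measurable X]setTI; apply: mfst.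
  rewrite (@Ex_eq _ _ _ pi _ (fun z : XX2 => \1_(A `*` U) z - kU z.1 * \1_A z.1)); last first.
    move=> z; rewrite (_ : \1_(_ @^-1` B') z = \1_A z.1 :> R)// /c' mulrBl; congr (_ - _).
    by rewrite !indicE in_setX mulrC; case: (_ \in _); case: (_ \in _); rewrite ?mulr0 ?mulr1.
  have mAU : measurable (A `*` U : set XX2) by exact: measurableX.
  have IkA : intg mu (fun x => kU x * \1_A x) by exact: intgMi.
  rewrite ExB; [|exact: intg_indic|exact: (intg_image_inv mfst pi1 IkA)].
  rewrite Ex_indic// -(Ex_image mfst pi1 IkA) kE//.
  apply/eqP; rewrite subr_eq0; apply/eqP; rewrite /Rintegral; congr fine.
  apply: eq_integral => x _; rewrite EFinM kUE indicE.
  have [xA|xA] := boolP (x \in A).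
    by rewrite mule1; congr (k x _); rewrite in_xsectionX.
  by rewrite mule0 notin_xsectionX// measure0.
have Icc' : intg pi (fun z => c' z * c z.1).
  rewrite (_ : (fun z => _) = fun z : XX2 => c z.1 * c' z).
    by apply: (intgMb Ic1 (intg_meas Ic') c'b).
  by apply/funext => z; rewrite mulrC.
have Ick : intg mu (fun x => c x * kU x) by exact: intgMb kU1.
rewrite (@Ex_eq _ _ _ pi _ (fun z : XX2 => c' z * c z.1 + c z.1 * kU z.1)); last first.
  by move=> z; rewrite (_ : \1_(_ @^-1` B) z = \1_U z.2 :> R)// /c'; ring.
rewrite ExD//; last exact: (intg_image_inv mfst pi1 Ick).
rewrite Ec' add0r -(Ex_image mfst pi1 Ick).
apply: Ex_mul_eq0 => // B' mB'.
(* Causality places the event in the completion only; it is exchanged for an event of [Ft n] that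
   differs from it by a null set, which does not change the integral. *)
have [A FA AE] : completion mu (Ft n) (kU @^-1` B').
  have := km n U FU (EFin @` B') (measurable_image_EFin mB').
  congr (completion _ _ _); apply/seteqP; split => x /=.
    by rewrite -kUE => -[t Bt [<-]].
  by move=> Bx; exists (kU x).
have mA := Ft_measurable FA.
have mkB : measurable (kU @^-1` B') by rewrite -[X in measurable X]setTI; apply: mkU.
transitivity (Ex mu (fun x => c x * \1_A x)); last first.
  by rewrite -[RHS](cc A mA); apply: Ex_eq => x; rewrite (Ft_indic _ FA).
rewrite /Rintegral; congr fine; apply: ae_eq_integral => //.
- exact: (measurable_int mu (intgMi mkB Ic)).
- exact: (measurable_int mu (intgMi mA Ic)).
- apply: negligibleS AE => x /=; apply: contra_notP => nx _; congr (_ * _)%:E.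
  rewrite !indicE; congr (nat_of_bool _)%:R; apply/idP/idP; rewrite !inE => h.
    by apply: contrapT => nA; apply: nx; left.
  by apply: contrapT => nA; apply: nx; right.
Qed.

End Causal.

End Filtered.

(** * The upper estimate *)

Section YoungIntegrable.
Context d (T : measurableType d) (R : realType) (P : probability T R) (p q : R).
Hypotheses (p1 : 1 < p) (qE : q = p / (p - 1)).
Implicit Types a b : T -> R.

Lemma intg_young a b : measurable_fun setT a -> measurable_fun setT b ->
  intg P (fun x => `|a x| `^ q) -> intg P (fun x => `|b x| `^ p) ->
  intg P (fun x => a x * b x).
Proof.
move=> ma mb Ia Ib; apply: (intg_le _ (intgD Ia Ib)); first exact: measurable_funM.
by move=> x; rewrite normrM young1.
Qed.

Lemma intg_powR_le (r : R) a : 1 <= r -> measurable_fun setT a ->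
  intg P (fun x => `|a x| `^ r) -> intg P a.
Proof.
move=> r1 ma Ia; apply: (intg_le ma (intgD (intg_cst P 1) Ia)) => x.
exact: le_add1_powR.
Qed.

Lemma intg_powRD (r : R) a b : 0 <= r -> measurable_fun setT a -> measurable_fun setT b ->
  intg P (fun x => `|a x| `^ r) -> intg P (fun x => `|b x| `^ r) ->
  intg P (fun x => `|a x + b x| `^ r).
Proof.
move=> r0 ma mb Ia Ib; apply: (intg_le _ (intgZ (2 `^ r) (intgD Ia Ib))).
  by apply: measurable_powR_comp; exact: measurable_funD.
by move=> x; rewrite ger0_norm ?powR_ge0// powR_add_le.
Qed.

End YoungIntegrable.

Section Upper.
Variables (R : realType) (N d : nat) (p q C : R) (f : 'M[R]_(N, d) -> R).
Local Notation XX := (pathspace R N d).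
Local Notation XX2 := (XX * XX)%type.
Local Notation MM := 'M[R]_(N, d).
Variable mu : probability XX R.
Implicit Types (k : 'I_N) (i : 'I_d).
Hypotheses (p1 : 1 < p) (qE : q = p / (p - 1)) (f1 : C1 f).
Hypothesis fC : forall x, `|DD f x| <= C * (1 + `|x| `^ (p - 1)).
Hypothesis mm : martingale_measure mu.
Hypothesis mp : intg mu (fun x : XX => `|x : MM| `^ p).

Let p0 : 0 < p. Proof. exact: lt_trans p1. Qed.
Let q0 : 0 < q. Proof. exact: q_gt0 p1 qE. Qed.
Let pn0 : p != 0. Proof. by rewrite gt_eqF. Qed.

Definition Df k i (x : XX) : R := DD f x k i.

Lemma measurable_Df k i : measurable_fun setT (Df k i).
Proof. by rewrite /Df; apply: continuous_borel_measurable; exact: continuous_DD. Qed.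

Lemma intg_Dfq k i : intg mu (fun x => `|Df k i x| `^ q).
Proof.
apply: (intg_le _ (intgZ (C `^ q * 2 `^ q) (intgD (intg_cst mu 1) mp))).
  exact: measurable_powR_comp (measurable_Df k i).
move=> x; rewrite ger0_norm ?powR_ge0//.
have C0 := growth_ge0 p1 fC.
have xp0 := powR_ge0 `|x : MM| (p - 1).
apply: (@le_trans _ _ ((C * (1 + `|x : MM| `^ (p - 1))) `^ q)).
  by apply: powR_mono; rewrite ?(ltW q0)// (le_trans (mx_coord_le _ _ _)).
rewrite powRM ?addr_ge0// -mulrA ler_wpM2l ?powR_ge0//.
have := powR_add_le 1 (`|x : MM| `^ (p - 1)) (ltW q0).
by rewrite (ger0_norm (addr_ge0 _ _))// normr1 powR1 (ger0_norm xp0) -powRrM (conj_mul' p1 qE).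
Qed.

Lemma intg_Df k i : intg mu (Df k i).
Proof.
by apply: (intg_powR_le (ltW (q_gt1 p1 qE))); [exact: measurable_Df|exact: intg_Dfq].
Qed.

Lemma intg_incp_mu k i : intg mu (fun x => `|inc k i x| `^ p).
Proof.
apply: (intg_le _ (intgZ (2 `^ p) mp)).
  exact: measurable_powR_comp (measurable_inc k i).
move=> x; rewrite ger0_norm ?powR_ge0// -powRM//.
by apply: powR_mono; rewrite ?(ltW p0)// inc_le.
Qed.

Definition Gf k i : XX -> R := condE mu (Ft (this_time k)) (Df k i).

Lemma Gf_spec k i : [/\ rF k.+1 (Gf k i), intg mu (Gf k i) &
  cF mu k.+1 (fun x => Df k i x - Gf k i x)].
Proof. exact: (condE_spec (this_time k) (intg_Df k i)). Qed.

Lemma intg_Gfq k i : intg mu (fun x => `|Gf k i x| `^ q).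
Proof.
have [rG IG cG] := Gf_spec k i.
by have [] := condexp_pow p1 qE (intg_Df k i) rG IG cG (intg_Dfq k i).
Qed.

Section Coupling.
Variables (nu : probability XX R) (pi : probability XX2 R).
Hypothesis pi1 : forall A, measurable A -> pi (fst @^-1` A) = mu A.
Hypothesis pi2 : forall A, measurable A -> pi (snd @^-1` A) = nu A.
Local Notation W := (fun z : XX2 => (z.2 : MM) - (z.1 : MM)).
Hypothesis Iw : intg pi (fun z : XX2 => incp p (W z)).

Let mfst : measurable_fun setT (fst : XX2 -> XX). Proof. exact: measurable_fst. Qed.
Let msnd : measurable_fun setT (snd : XX2 -> XX). Proof. exact: measurable_snd. Qed.

Lemma measurable_incw k i : measurable_fun setT (fun z : XX2 => inc k i (W z)).
Proof.
rewrite (_ : (fun z => _) = fun z : XX2 => inc k i z.2 - inc k i z.1).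
  by apply: measurable_funB; apply: measurableT_comp (measurable_inc k i) _.
by apply/funext => z; rewrite incB.
Qed.

Lemma measurable_inc1w : measurable_fun setT (fun z : XX2 => inc1 (W z)).
Proof.
apply: measurable_sum => k; apply: measurable_sum => i.
by apply: measurableT_comp => //; exact: measurable_incw.
Qed.

Lemma intg_incwp k i : intg pi (fun z : XX2 => `|inc k i (W z)| `^ p).
Proof.
apply: (intg_le _ Iw); first exact: measurable_powR_comp (measurable_incw k i).
by move=> z; rewrite ger0_norm ?powR_ge0// inc_incp.
Qed.

Lemma intg_inc1wp : intg pi (fun z : XX2 => inc1 (W z) `^ p).
Proof.
apply: (intg_le _ (intgZ ((N * d)%:R `^ p) Iw)).
  apply: (measurableT_comp (measurable_powR p)); exact: measurable_inc1w.
by move=> z; rewrite ger0_norm ?powR_ge0// inc1_incp.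
Qed.

Lemma Ex_inc1wp : Ex pi (fun z : XX2 => inc1 (W z) `^ p) <=
  (N * d)%:R `^ p * Ex pi (fun z : XX2 => incp p (W z)).
Proof.
rewrite -ExZ//; apply: Ex_le; [exact: intg_inc1wp|exact: intgZ|].
by move=> z; exact: inc1_incp.
Qed.

Lemma intg_inc2p k i : intg pi (fun z : XX2 => `|inc k i z.2| `^ p).
Proof.
rewrite (_ : (fun z => _) = fun z : XX2 => `|inc k i z.1 + inc k i (W z)| `^ p).
  apply: (intg_powRD (ltW p0)).
  - exact: measurableT_comp (measurable_inc k i) mfst.
  - exact: measurable_incw.
  - exact: (intg_image_inv mfst pi1 (intg_incp_mu k i)).
  - exact: intg_incwp.
by apply/funext => z; rewrite incB addrC subrK.
Qed.

Lemma measurable_f : measurable_fun setT (f : XX -> R).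
Proof.
have [df _] := f1; apply: continuous_borel_measurable => x.
exact: differentiable_continuous.
Qed.

Lemma intg_f_mu : intg mu (f : XX -> R).
Proof.
have [A A0 HA] := crude_bound f1 p1 qE fC.
pose g (x : XX) := `|f 0| + (A * (1 + 0) + A * (2 * ((N * d)%:R * 2) `^ p * `|x : MM| `^ p)).
apply: (@intg_le _ _ _ mu _ g); first exact: measurable_f.
  apply: intgD (intg_cst _ _) _; apply: intgD (intg_cst _ _) _; apply: intgZ.
  exact: intgZ.
move=> x; rewrite (_ : f x = f 0 + (f (0 + x) - f 0)); last by rewrite add0r addrC subrK.
rewrite (le_trans (ler_normD _ _))// lerD2l.
have := HA 0 x 1 ltr01; rewrite normr0 powR0// mulr1 divr1 mul1r => /le_trans; apply.
have K : inc1 x `^ p <= ((N * d)%:R * 2) `^ p * `|x : MM| `^ p.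
  by rewrite -powRM//; apply: powR_mono; [exact: ltW|exact: inc1_ge0|exact: inc1_le].
by rewrite lerD2l ler_wpM2l// -[leRHS]mulrA mulr_natl mulr2n lerD.
Qed.

Lemma intg_fdiff : intg pi (fun z : XX2 => f z.2 - f z.1).
Proof.
have [A A0 HA] := crude_bound f1 p1 qE fC.
have I1 : intg pi (fun z : XX2 => `|z.1 : MM| `^ p) by exact: (intg_image_inv mfst pi1 mp).
apply: (@intg_le _ _ _ _ _ (fun z : XX2 => A * (1 + `|z.1 : MM| `^ p) + A * (2 * inc1 (W z) `^ p))).
- by apply: measurable_funB; apply: measurableT_comp measurable_f _.
- apply: intgD; apply: intgZ; last by apply: intgZ; exact: intg_inc1wp.
  by apply: intgD (intg_cst _ _) _.
- move=> z; have := HA z.1 (W z) 1 ltr01; rewrite subrKC mulr1 divr1 mul1r.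
  by rewrite [X in _ <= _ + _ * X](_ : _ = 2 * inc1 (W z) `^ p)//; ring.
Qed.

Lemma intg_f_nu : intg nu (f : XX -> R).
Proof.
apply: (intg_image msnd pi2 measurable_f).
have I1 : intg pi (fun z : XX2 => f z.1) by exact: (intg_image_inv mfst pi1 intg_f_mu).
have := intgD intg_fdiff I1; apply: eq_integrable => // z _ /=.
by rewrite subrK.
Qed.

Lemma Ex_fdiff : Ex nu (f : XX -> R) - Ex mu (f : XX -> R) = Ex pi (fun z : XX2 => f z.2 - f z.1).
Proof.
rewrite (Ex_image msnd pi2 intg_f_nu) (Ex_image mfst pi1 intg_f_mu) -ExB//.
- exact: (intg_image_inv msnd pi2 intg_f_nu).
- exact: (intg_image_inv mfst pi1 intg_f_mu).
Qed.

Hypothesis nm : martingale_measure nu.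
Hypotheses (c1 : causal mu pi) (c2 : causal nu (pushforward pi (@swap R N d))).

Let mswap : measurable_fun setT (@swap R N d : XX2 -> XX2).
Proof. by apply: measurable_fun_pair. Qed.

(* Causality removes [D_k - G_k], and causality of the swapped coupling together
   with the martingale property of [nu] allows one to subtract [h]. *)
Lemma Ex_increment_term k i (h : XX -> R) : rF k h -> intg mu (fun x => `|h x| `^ q) ->
  intg pi (fun z : XX2 => (Gf k i z.1 - h z.1) * inc k i (W z)) /\
  Ex pi (fun z : XX2 => Df k i z.1 * inc k i (W z)) =
  Ex pi (fun z : XX2 => (Gf k i z.1 - h z.1) * inc k i (W z)).
Proof.
move=> rh Ihq; have [rG IG cG] := Gf_spec k i; have [mG _] := rG; have [mh _] := rh.
have mD := measurable_Df k i; have mI := measurable_inc (R := R) k i.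
have m1 (g : XX -> R) : measurable_fun setT g -> measurable_fun setT (fun z : XX2 => g z.1).
  by move=> mg; exact: measurableT_comp mg mfst.
have I1 (g : XX -> R) : intg mu g -> intg pi (fun z : XX2 => g z.1).
  by move=> Ig; exact: (intg_image_inv mfst pi1 Ig).
have mI2 : measurable_fun setT (fun z : XX2 => inc k i z.2) by exact: measurableT_comp mI msnd.
have Iq (g : XX -> R) : measurable_fun setT g -> intg mu (fun x => `|g x| `^ q) ->
    intg pi (fun z : XX2 => g z.1 * inc k i z.2).
  move=> mg Ig; apply: (intg_young p1 qE (m1 _ mg) mI2 (I1 _ Ig)); exact: intg_inc2p.
have Imu (g : XX -> R) : measurable_fun setT g -> intg mu (fun x => `|g x| `^ q) ->
    intg mu (fun x => g x * inc k i x).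
  by move=> mg Ig; apply: (intg_young p1 qE mg mI Ig (intg_incp_mu k i)).
have mDG : measurable_fun setT (fun x => Df k i x - Gf k i x) by exact: measurable_funB.
have IDGq : intg mu (fun x => `|Df k i x - Gf k i x| `^ q).
  apply: (intg_powRD (ltW q0) mD (measurable_funN mG) (intg_Dfq k i)).
  by under eq_fun do rewrite normrN; exact: intg_Gfq.
have IDG : intg mu (fun x => Df k i x - Gf k i x) by exact: intgB (intg_Df k i) IG.
have [Iinc cinc] := (martingaleP mu).1 mm k i.
have [Iincn cincn] := (martingaleP nu).1 nm k i.
have E1 : Ex pi (fun z : XX2 => (Df k i z.1 - Gf k i z.1) * inc k i z.2) = 0.
  apply: (causal_orth pi1 c1 (n := this_time k) IDG cG _ (Iq _ mDG IDGq)).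
  by apply: rF_inc; exact: leqnn.
have E2 : Ex mu (fun x => (Df k i x - Gf k i x) * inc k i x) = 0.
  apply: (centered_orth IDG cG _ (Imu _ mDG IDGq)).
  by apply: rF_inc; exact: leqnn.
have E3 : Ex pi (fun z : XX2 => h z.1 * inc k i z.2) = 0.
  pose S : {mfun XX2 >-> XX2} := HB.pack (@swap R N d : XX2 -> XX2) (isMeasurableFun.Build _ _ _ _ _ mswap).
  pose pis : probability XX2 R := distribution pi S.
  have pisE : forall A, measurable A -> pi (@swap R N d @^-1` A) = pis A by [].
  have pis1 A : measurable A -> pis (fst @^-1` A) = nu A by move=> mA; rewrite -pi2.
  have cs : causal nu pis by exact: c2.
  have mhs : measurable_fun setT (fun z : XX2 => inc k i z.1 * h z.2).
    apply: measurable_funM; first exact: measurableT_comp mI mfst.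
    exact: measurableT_comp mh msnd.
  have Ihs : intg pis (fun z : XX2 => inc k i z.1 * h z.2).
    apply: (intg_image mswap pisE) => //.
    have := Iq _ mh Ihq; apply: eq_integrable => // z _ /=.
    by rewrite mulrC.
  have := causal_orth pis1 cs (n := prev_time k) Iincn cincn rh Ihs.
  rewrite (Ex_image mswap pisE Ihs) => <-; apply: Ex_eq => z /=.
  by rewrite mulrC.
have E4 : Ex mu (fun x => h x * inc k i x) = 0.
  rewrite (@Ex_eq _ _ _ mu _ (fun x => inc k i x * h x)); last by move=> x; rewrite mulrC.
  apply: (centered_orth Iinc cinc rh).
  have := Imu _ mh Ihq; apply: eq_integrable => // x _ /=.
  by rewrite mulrC.
have IGh : intg pi (fun z : XX2 => (Gf k i z.1 - h z.1) * inc k i (W z)).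
  have H (g : XX -> R) : measurable_fun setT g -> intg mu (fun x => `|g x| `^ q) ->
      intg pi (fun z : XX2 => g z.1 * inc k i (W z)).
    move=> mg Ig; apply: (intg_young p1 qE (m1 _ mg) (measurable_incw k i) (I1 _ Ig)).
    exact: intg_incwp.
  apply: (H (fun x => Gf k i x - h x)); first exact: measurable_funB.
  apply: (intg_powRD (ltW q0) mG (measurable_funN mh) (intg_Gfq k i)).
  by under eq_fun do rewrite normrN.
split => //.
have J1 := Iq _ mDG IDGq; have J2 := I1 _ (Imu _ mDG IDGq).
have J3 := Iq _ mh Ihq; have J4 := I1 _ (Imu _ mh Ihq).
rewrite (@Ex_eq _ _ _ pi _ (fun z : XX2 => (Gf k i z.1 - h z.1) * inc k i (W z) +
  (((Df k i z.1 - Gf k i z.1) * inc k i z.2 - (Df k i z.1 - Gf k i z.1) * inc k i z.1) +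
   (h z.1 * inc k i z.2 - h z.1 * inc k i z.1)))); last first.
  by move=> z; rewrite incB; ring.
rewrite ExD//; last by apply: intgD; exact: intgB.
rewrite ExD; [|exact: intgB..]; rewrite !ExB//.
rewrite E1 E3 -(Ex_image mfst pi1 (Imu _ mDG IDGq)) -(Ex_image mfst pi1 (Imu _ mh Ihq)).
by rewrite E2 E4 !subr0 !addr0.
Qed.

(** Hoelder's inequality in product form: Young's inequality for [|G - h| / v] and [|w| / rho] is
    summed and integrated, and the two parts add up to 1 / q + 1 / p = 1. The divisions are the
    reason for [v] and [rho] positive. *)
Lemma Ex_pairing_le (h : 'I_N -> 'I_d -> XX -> R) (v rho : R) :
  (forall k i, rF k (h k i)) -> (forall k i, intg mu (fun x => `|h k i x| `^ q)) ->
  0 < v -> 0 < rho ->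
  Ex mu (fun x => \sum_(k < N) \sum_(i < d) `|Gf k i x - h k i x| `^ q) <= v `^ q ->
  Ex pi (fun z : XX2 => incp p (W z)) <= rho `^ p ->
  intg pi (fun z : XX2 => pairing f z.1 (W z)) /\
  Ex pi (fun z : XX2 => pairing f z.1 (W z)) <= v * rho.
Proof.
move=> rh Ih v0 rho0 hv hrho.
have H k i := Ex_increment_term i (rh k i) (Ih k i).
have ID k i : intg pi (fun z : XX2 => Df k i z.1 * inc k i (W z)).
  apply: (intg_young p1 qE) => //.
  - exact: measurableT_comp (measurable_Df k i) mfst.
  - exact: measurable_incw.
  - exact: (intg_image_inv mfst pi1 (intg_Dfq k i)).
  - exact: intg_incwp.
have Ip : intg pi (fun z : XX2 => pairing f z.1 (W z)).
  by apply: intg_sum => k _; apply: intg_sum => i _; exact: ID.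
split => //.
have IG k i : intg mu (fun x => `|Gf k i x - h k i x| `^ q).
  have [[mG _] _ _] := Gf_spec k i; have [mh _] := rh k i.
  apply: (intg_powRD (ltW q0) mG (measurable_funN mh) (intg_Gfq k i)).
  by under eq_fun do rewrite normrN; exact: Ih.
have IS : intg mu (fun x => \sum_(k < N) \sum_(i < d) `|Gf k i x - h k i x| `^ q).
  by apply: intg_sum => k _; apply: intg_sum => i _.
rewrite Ex_sum; last by move=> k _; apply: intg_sum => i _; exact: ID.
under eq_bigr => k _.
  rewrite Ex_sum; last by move=> i _; exact: ID.
  under eq_bigr => i _ do rewrite (H k i).2.
  rewrite -Ex_sum; last by move=> i _; exact: (H k i).1.
  over.
rewrite -Ex_sum; last by move=> k _; apply: intg_sum => i _; exact: (H k i).1.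
pose F (z : XX2) := v * rho * (q^-1 * v^-1 `^ q * (\sum_(k < N) \sum_(i < d) `|Gf k i z.1 - h k i z.1| `^ q)
   + p^-1 * rho^-1 `^ p * incp p (W z)).
have IS1 := intg_image_inv mfst pi1 IS.
have IF : intg pi F by apply: intgZ; apply: intgD; exact: intgZ.
apply: (@le_trans _ _ (Ex pi F)).
  apply: Ex_le => //.
    by apply: intg_sum => k _; apply: intg_sum => i _; exact: (H k i).1.
  move=> z; rewrite /F /incp !mulr_sumr -big_split mulr_sumr; apply: ler_sum => k _.
  rewrite /= !mulr_sumr -big_split mulr_sumr; apply: ler_sum => i _ /=.
  set g := Gf k i z.1 - _; set w := inc k i _.
  apply: (le_trans (ler_norm _)); rewrite normrM.
  have -> : `|g| * `|w| = v * rho * ((v^-1 * `|g|) * (rho^-1 * `|w|)).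
    by field; rewrite !gt_eqF.
  rewrite ler_wpM2l ?mulr_ge0 ?(ltW v0) ?(ltW rho0)//.
  have := young p1 qE (a := v^-1 * `|g|) (b := rho^-1 * `|w|).
  rewrite !mulr_ge0 ?invr_ge0 ?(ltW v0) ?(ltW rho0)// => /(_ isT isT) /le_trans; apply.
  by rewrite !powRM ?invr_ge0 ?(ltW v0) ?(ltW rho0)// [_ / q]mulrC [_ / p]mulrC !mulrA.
rewrite /F ExZ; last by apply: intgD; exact: intgZ.
rewrite ExD; [|exact: intgZ..]; rewrite !ExZ// -(Ex_image mfst pi1 IS).
rewrite -[leRHS]mulr1 ler_wpM2l ?mulr_ge0 ?(ltW v0) ?(ltW rho0)//.
rewrite -(conj_pq p1 qE) addrC; apply: lerD.
  rewrite -mulrA -[leRHS]mulr1 ler_wpM2l ?invr_ge0 ?(ltW p0)//.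
  rewrite (le_trans (ler_wpM2l (powR_ge0 _ _) hrho))// -powRM ?invr_ge0 ?(ltW rho0)//.
  by rewrite mulVf ?gt_eqF// powR1.
rewrite -mulrA -[leRHS]mulr1 ler_wpM2l ?invr_ge0 ?(ltW q0)//.
rewrite (le_trans (ler_wpM2l (powR_ge0 _ _) hv))// -powRM ?invr_ge0 ?(ltW v0)//.
by rewrite mulVf ?gt_eqF// powR1.
Qed.

End Coupling.

Lemma measurable_tail (K : R) :
  measurable_fun setT (fun x : XX => (K < `|x : MM|)%R%:R : R).
Proof.
have H : measurable_fun setT (\1_(`]K, +oo[%classic) : R -> R).
  by apply/measurable_indicP; exact: measurable_itv.
rewrite (_ : (fun x => _) = (\1_(`]K, +oo[%classic) : R -> R) \o (fun x : XX => `|x : MM|)).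
  exact: measurableT_comp H (@measurable_norm_path R N d).
apply/funext => x; rewrite /= indicE; congr (nat_of_bool _)%:R.
by apply/idP/idP; rewrite inE /= in_itv/= andbT.
Qed.

Lemma tail_small (e : R) : 0 < e -> exists K : R,
  Ex mu (fun x : XX => (K < `|x : MM|)%R%:R * (1 + `|x : MM| `^ p)) <= e.
Proof.
move=> e0; pose g (x : XX) := 1 + `|x : MM| `^ p.
have Ig : intg mu g by apply: intgD => //; exact: intg_cst.
have g0 x : 0 <= g x by rewrite addr_ge0// powR_ge0.
have : (fun n : nat => Ex mu (fun x : XX => (n%:R < `|x : MM|)%R%:R * g x)) @ \oo --> Ex mu (fun=> 0).
  apply: (Ex_dct _ _ _ Ig) => //.
  - move=> n; apply: measurable_funM; last exact: intg_meas Ig.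
    exact: measurable_tail.
  - move=> x; apply: cvg_near_cst; near=> n.
    rewrite ltNge (_ : `|x : MM| <= n%:R) ?mul0r//.
    by near: n; exact: nbhs_infty_ger.
  - move=> n x; rewrite normrM (ger0_norm (g0 x)).
    by case: (_ < _); rewrite ?normr1 ?normr0 ?mul0r ?mul1r.
rewrite Ex_cst => /cvgr0_norm_le /(_ _ e0)[n _ /(_ n (leqnn n)) /= Hn].
by exists n%:R; exact: le_trans (ler_norm _) Hn.
Unshelve. all: by end_near. Qed.

Let Wd := (fun z : XX2 => (z.2 : MM) - (z.1 : MM)).

(** The crude bound at scale [rho] is of order [rho + rho^p]. Both terms are at most
    [(rho / delta)^p * delta] since [rho >= delta] and [delta <= 1], and this is the form that the
    growth of the penalty can absorb. *)
Lemma increase_le_large : exists2 A, 0 <= A &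
  forall (nu : probability XX R) (pi : probability XX2 R) (delta rho : R),
  coupling mu nu pi -> intg pi (fun z => incp p (Wd z)) ->
  Ex pi (fun z => incp p (Wd z)) <= rho `^ p ->
  0 < delta <= 1 -> delta <= rho ->
  intg nu (f : XX -> R) /\
  Ex nu (f : XX -> R) - Ex mu (f : XX -> R) <= A * (rho / delta) `^ p * delta.
Proof.
have [A A0 HA] := crude_bound f1 p1 qE fC.
pose m := Ex mu (fun x : XX => 1 + `|x : MM| `^ p).
have Im : intg mu (fun x : XX => 1 + `|x : MM| `^ p) by apply: intgD => //; exact: intg_cst.
have m0 : 0 <= m by apply: Ex_ge0 => x; rewrite addr_ge0// powR_ge0.
pose M := (N * d)%:R `^ p : R.
have M0 : 0 <= M by exact: powR_ge0.
exists (A * m + A * (2 * M)); first by rewrite addr_ge0// !mulr_ge0.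
move=> nu pi delta rho [pi1 pi2] Iw hrho /andP[d0 d1] dr.
have rho0 : 0 < rho by exact: lt_le_trans dr.
split; first exact: (intg_f_nu pi1 pi2 Iw).
rewrite (Ex_fdiff pi1 pi2 Iw).
have I1 : intg pi (fun z : XX2 => 1 + `|z.1 : MM| `^ p).
  by apply: (intg_image_inv _ pi1 Im); exact: measurable_fst.
have I2 := intg_inc1wp Iw.
have tE (t : R) : 0 <= t -> (t / rho) `^ p = rho^-1 `^ p * t `^ p.
  by move=> t0; rewrite mulrC powRM// invr_ge0 ltW.
pose F (z : XX2) := A * rho * (1 + `|z.1 : MM| `^ p) +
   A * (rho * rho^-1 `^ p + 1) * inc1 (Wd z) `^ p.
apply: (@le_trans _ _ (Ex pi F)).
  apply: Ex_le; first exact: intg_fdiff.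
    by apply: intgD; exact: intgZ.
  move=> z; have := HA z.1 (Wd z) rho rho0; rewrite subrKC tE ?inc1_ge0// => h.
  by rewrite (le_trans (ler_norm _))// (le_trans h)// /F; apply: eq_ler; ring.
rewrite /F ExD; [|exact: intgZ..]; rewrite !ExZ//.
rewrite -(Ex_image _ pi1 Im); last exact: measurable_fst.
rewrite -/m mulrDl mulrDl; apply: lerD.
  rewrite mulrAC -!mulrA ler_wpM2l// ler_wpM2l//.
  rewrite -ler_pdivrMr//; apply: le1r_powR; last exact: ltW.
  by rewrite ler_pdivlMr// mul1r.
have h1 := le_trans (Ex_inc1wp Iw) (ler_wpM2l M0 hrho).
rewrite -!mulrA ler_wpM2l//.
have r1 : 1 <= rho / delta by rewrite ler_pdivlMr// mul1r.
have E1 : rho * rho^-1 `^ p * rho `^ p = rho.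
  by rewrite -mulrA -powRM ?invr_ge0 ?(ltW rho0)// mulVf ?gt_eqF// powR1 mulr1.
have h2 : rho <= (rho / delta) `^ p * delta.
  by rewrite -ler_pdivrMr//; apply: le1r_powR; last exact: ltW.
have h3 : rho `^ p <= (rho / delta) `^ p * delta.
  rewrite (_ : rho `^ p = (rho / delta) `^ p * delta `^ p); last first.
    by rewrite -powRM ?divr_ge0 ?(ltW rho0) ?(ltW d0)// divfK// gt_eqF.
  rewrite ler_wpM2l ?powR_ge0// -[leRHS](powRr1 (ltW d0)).
  by apply: ger_powR; rewrite ?d0 ?d1// ltW.
apply: (@le_trans _ _ ((rho * rho^-1 `^ p + 1) * (M * rho `^ p))).
  by rewrite ler_wpM2l// addr_ge0// mulr_ge0 ?powR_ge0// ltW.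
rewrite (_ : _ * _ = M * (rho * rho^-1 `^ p * rho `^ p + rho `^ p)); last by ring.
by rewrite E1 mulrCA ler_wpM2l// mulr_natl mulr2n lerD.
Qed.

(** The remainder of the Taylor bound splits into three parts, each of at most [eps / 3 * delta]:
    the modulus of continuity (by the choice of [e]), the large paths (by the choice of [K]), and a
    term of order [delta^p] (by the choice of [d0], as [p > 1]). *)
Lemma increase_le_small (h : 'I_N -> 'I_d -> XX -> R) (v U eps : R) :
  (forall k i, rF k (h k i)) -> (forall k i, intg mu (fun x => `|h k i x| `^ q)) ->
  0 < v -> 0 < U -> 0 < eps ->
  Ex mu (fun x => \sum_(k < N) \sum_(i < d) `|Gf k i x - h k i x| `^ q) <= v `^ q ->
  exists2 d0, 0 < d0 &
  forall (nu : probability XX R) (pi : probability XX2 R) (delta rho : R),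
  martingale_measure nu -> bicausal mu nu pi -> intg pi (fun z => incp p (Wd z)) ->
  Ex pi (fun z => incp p (Wd z)) <= rho `^ p ->
  0 < delta < d0 -> 0 < rho <= U * delta ->
  Ex nu (f : XX -> R) - Ex mu (f : XX -> R) <= v * rho + eps * delta.
Proof.
move=> rh Ih v0 U0 eps0 hv.
pose M := (N * d)%:R `^ p : R.
have M0 : 0 <= M by exact: powR_ge0.
pose e := eps / 3 / (1 + M * U `^ p).
have MU0 : 0 <= M * U `^ p by rewrite mulr_ge0// powR_ge0.
have MU : 0 < 1 + M * U `^ p by rewrite ltr_pwDl.
have eps3 : 0 < eps / 3 by rewrite divr_gt0.
have e0 : 0 < e by rewrite divr_gt0.
(* [A] is fixed before [K], so the tail beyond [K] can be made small relative to [A]. Only [B]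
   depends on [K], and it multiplies a power of [delta] larger than 1. *)
have [A A0 HA] := taylor_bound f1 p1 qE fC e0.
have A1 : 0 < A + 1 by rewrite ltr_wpDl.
have [K HK] := tail_small (divr_gt0 eps3 A1).
have [B B0 HB] := HA K.
pose c := B * M * U `^ p + 1.
have c0 : 0 < c by rewrite ltr_wpDl// -mulrA mulr_ge0.
have pB : 0 < p - 1 by rewrite subr_gt0.
(* The solution of [c * d0^(p-1) = eps / 3]; the summand 1 in [c] keeps [c] positive. *)
exists ((eps / 3 / c) `^ (p - 1)^-1); first by rewrite powR_gt0// divr_gt0.
move=> nu pi delta rho nm [[pi1 pi2] c1 c2] Iw hrho /andP[d0 dd] /andP[rho0 rhoU].
rewrite (Ex_fdiff pi1 pi2 Iw).
have [Ip Hp] := Ex_pairing_le pi1 pi2 Iw nm c1 c2 rh Ih v0 rho0 hv hrho.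
have If := intg_fdiff pi1 Iw.
pose T (x : XX) := (K < `|x : MM|)%R%:R * (1 + `|x : MM| `^ p).
have IT : intg mu T.
  apply: (@intg_le _ _ _ mu _ (fun x : XX => 1 + `|x : MM| `^ p)).
  - apply: measurable_funM.
      exact: measurable_tail.
    by apply: intg_meas (intgD (intg_cst mu 1) mp).
  - by apply: intgD => //; exact: intg_cst.
  - move=> x; rewrite /T normrM [X in _ * X]ger0_norm ?addr_ge0 ?powR_ge0//.
    by case: (_ < _); rewrite ?normr1 ?normr0 ?mul0r ?mul1r// addr_ge0 ?powR_ge0.
have IT1 : intg pi (fun z : XX2 => T z.1) by apply: (intg_image_inv _ pi1 IT); exact: measurable_fst.
have I2 := intg_inc1wp Iw.
have tE (t : R) : 0 <= t -> (t / delta) `^ p = delta^-1 `^ p * t `^ p.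
  by move=> t0; rewrite mulrC powRM// invr_ge0 ltW.
pose F (z : XX2) := pairing f z.1 (Wd z) + (e * delta + (e * delta * delta^-1 `^ p + B) * inc1 (Wd z) `^ p
   + delta * A * T z.1).
have IF0 : intg pi (fun z : XX2 => e * delta + (e * delta * delta^-1 `^ p + B) * inc1 (Wd z) `^ p).
  by apply: intgD; [exact: intg_cst|exact: intgZ].
have IF1 : intg pi (fun z : XX2 => e * delta + (e * delta * delta^-1 `^ p + B) * inc1 (Wd z) `^ p
   + delta * A * T z.1).
  by apply: intgD => //; exact: intgZ.
apply: (@le_trans _ _ (Ex pi F)).
  apply: Ex_le => //; first exact: intgD.
  move=> z; rewrite /F -lerBlDl; apply: (le_trans (ler_norm _)).
  have := HB z.1 (Wd z) delta d0; rewrite subrKC tE ?inc1_ge0// => h'.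
  apply: (le_trans h'); apply: eq_ler; rewrite /T; ring.
rewrite /F ExD// lerD// ExD//; last exact: intgZ.
rewrite ExD; [|exact: intg_cst|exact: intgZ].
rewrite Ex_cst !ExZ// -(Ex_image _ pi1 IT); last exact: measurable_fst.
have hT : delta * A * Ex mu T <= eps / 3 * delta.
  rewrite mulrC mulrA mulrAC ler_wpM2r ?(ltW d0)//.
  rewrite (le_trans (ler_wpM2r A0 HK))// mulrAC ler_pdivrMr// ler_wpM2l ?(ltW eps3)//.
  by rewrite lerDl.
have h1 : Ex pi (fun z => inc1 (Wd z) `^ p) <= M * (U `^ p * delta `^ p).
  rewrite (le_trans (Ex_inc1wp Iw))// ler_wpM2l// (le_trans hrho)//.
  by rewrite -powRM ?(ltW U0) ?(ltW d0)//; apply: powR_mono; rewrite ?(ltW p0) ?(ltW rho0).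
have hE : e * delta + e * delta * delta^-1 `^ p * (M * (U `^ p * delta `^ p)) = eps / 3 * delta.
  have -> : delta^-1 `^ p = (delta `^ p)^-1.
    by rewrite -[RHS]powRN -powR_inv1 ?(ltW d0)// -powRrM mulN1r.
  rewrite /e; field; rewrite (gt_eqF MU) gt_eqF// powR_gt0//.
have hB : B * (M * (U `^ p * delta `^ p)) <= eps / 3 * delta.
  have dc : delta `^ (p - 1) <= eps / 3 / c.
    rewrite -[leRHS](@powRVK _ (p - 1)) ?gt_eqF//; last first.
      by rewrite divr_ge0// ltW.
    by apply: powR_mono; rewrite ?(ltW pB) ?(ltW d0)// ltW.
  have -> : B * (M * (U `^ p * delta `^ p)) = B * M * U `^ p * delta `^ (p - 1) * delta.
    by rewrite -(mulr_powRB1 (ltW d0) p0); ring.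
  rewrite ler_wpM2r ?(ltW d0)// (@le_trans _ _ (c * delta `^ (p - 1)))//.
    by rewrite ler_wpM2r ?powR_ge0// /c lerDl.
  by rewrite mulrC -ler_pdivlMr.
have eC : 0 <= e * delta * delta^-1 `^ p + B.
  by apply: addr_ge0 B0; apply: mulr_ge0; [apply: mulr_ge0; exact: ltW|exact: powR_ge0].
have h2 := ler_wpM2l eC h1; rewrite mulrDl in h2.
rewrite mulrDl in h2.
lra.
Qed.

End Upper.

(** * Bicausal perturbations and the lower estimate *)

Section Adapted.
Variables (R : realType) (N d : nat).
Local Notation XX := (pathspace R N d).
Local Notation XX2 := (XX * XX)%type.
Local Notation MM := 'M[R]_(N, d).
Implicit Types (T S : MM -> MM).

Definition adapted T := forall (n : nat) x, trunc n (T (trunc n x)) = trunc n (T x).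

Lemma adapted_Ft T (n : 'I_N.+1) (U : set XX) : measurable_fun setT (T : XX -> XX) ->
  adapted T -> Ft n U -> Ft n (T @^-1` U).
Proof.
move=> mT aT /FtE[mU UE]; apply/FtE; split.
  by rewrite -[X in measurable X]setTI; apply: mT.
apply/seteqP; split => x /=; rewrite -[U]UE /= aT //.
Qed.

Lemma completion_self (P : probability XX R) (G : set (set XX)) A : G A -> completion P G A.
Proof.
move=> GA; exists A => //; rewrite (_ : A `+` A = set0); first exact: negligible_set0.
by rewrite setY_def setDv setU0.
Qed.

Lemma causal_dirac (P : probability XX R) (pi : set XX2 -> \bar R) T :
  measurable_fun setT (T : XX -> XX) -> adapted T ->
  (forall A, measurable A -> pi A = \int[P]_x (\1_A (x, T x))%:E)%E -> causal P pi.
Proof.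
move=> mT aT piE; exists (kdirac mT).
  move=> A mA; rewrite piE//; apply: eq_integral => x _.
  rewrite /kdirac /= /dirac !indicE; congr (nat_of_bool _)%:R%:E.
  by apply/idP/idP; rewrite !inE /xsection /= inE.
move=> n U FU B mB; apply: completion_self.
have FTU := adapted_Ft mT aT FU.
have E x : kdirac mT x U = (\1_U (T x))%:E by [].
apply/FtE; split.
  rewrite -[X in measurable X]setTI.
  by apply: (measurable_kernel (kdirac mT) U (Ft_measurable FU)).
apply/seteqP; split => x /=; rewrite !E -!(indic_preim _ T) (Ft_indic _ FTU)//.
Qed.

Section Coupling.
Variables (mu : probability XX R) (T S : MM -> MM).
Hypotheses (mT : measurable_fun setT (T : XX -> XX)) (mS : measurable_fun setT (S : XX -> XX)).
Hypotheses (aT : adapted T) (aS : adapted S) (ST : forall x, S (T x) = x).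

(** Swapping the graph of [T] under [mu] gives the graph of [S] under the image measure, because [S]
    undoes [T]. Causality in both directions thus reduces to adaptedness of the two maps. *)
Lemma graph_coupling : exists nu (pi : probability XX2 R),
  [/\ bicausal mu nu pi, forall A, measurable A -> mu ((T : XX -> XX) @^-1` A) = nu A &
   forall A, measurable A -> mu ((fun x : XX => (x, T x : XX)) @^-1` A) = pi A].
Proof.
pose T' : {mfun XX >-> XX} := HB.pack (T : XX -> XX) (isMeasurableFun.Build _ _ _ _ _ mT).
have mG : measurable_fun setT (fun x : XX => (x, T x : XX)) by exact: measurable_fun_pair.
pose G : {mfun XX >-> XX2} := HB.pack (fun x : XX => (x, T x : XX)) (isMeasurableFun.Build _ _ _ _ _ mG).
pose nu : probability XX R := distribution mu T'.
pose pi : probability XX2 R := distribution mu G.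
have nuE : forall A, measurable A -> mu ((T : XX -> XX) @^-1` A) = nu A by [].
have piE : forall A, measurable A -> mu ((fun x : XX => (x, T x : XX)) @^-1` A) = pi A by [].
exists nu, pi; split => //; split.
- by split => A mA.
- apply: (causal_dirac mT aT) => A mA; rewrite -piE//.
  have mA1 : measurable ((fun x : XX => (x, T x : XX)) @^-1` A).
    by rewrite -[X in measurable X]setTI; exact: (mG measurableT A mA).
  transitivity (\int[mu]_x (\1_((fun x : XX => (x, T x : XX)) @^-1` A) x)%:E)%E.
    by rewrite integral_indic// setIT.
  by apply: eq_integral => x _; rewrite !indicE.
- apply: (causal_dirac mS aS) => A mA.
  have mSA : measurable_fun setT (fun y : XX => (y, S y : XX)) by exact: measurable_fun_pair.
  have mA1 : measurable ((fun y : XX => (y, S y : XX)) @^-1` A).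
    by rewrite -[X in measurable X]setTI; apply: mSA.
  rewrite (_ : (\int[nu]_x _)%E = nu ((fun y : XX => (y, S y : XX)) @^-1` A)).
    rewrite -nuE// /pushforward -piE.
      by congr (mu _); apply/seteqP; split => x /=; rewrite /swap /= ST.
    by rewrite -[X in measurable X]setTI; apply: measurable_fun_pair.
  transitivity (\int[nu]_x (\1_((fun y : XX => (y, S y : XX)) @^-1` A) x)%:E)%E.
    by apply: eq_integral => x _; rewrite !indicE.
  by rewrite integral_indic// setIT.
Qed.

End Coupling.

Section Perturbation.
Variables (e K : R) (phi m : 'I_N -> 'I_d -> MM -> R).
Hypotheses (e0 : 0 <= e) (eK : e * K < 1) (K0 : 0 <= K).
Hypothesis lphi : forall k i x y, `|phi k i x - phi k i y| <= K * `|x - y|.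
Hypothesis phiF : forall k i x, phi k i (trunc k.+1 x) = phi k i x.
Hypothesis mF : forall k i x, m k i (trunc k x) = m k i x.
Hypothesis mm : forall k i, measurable_fun setT (m k i : XX -> R).
Implicit Types (x y w : MM) (k : 'I_N) (i : 'I_d).

(** In the application [m k i] is a version of E[phi k i | F_k]. It is only measurable, whereas
    [phi k i] is Lipschitz but may depend on the row [k] itself. *)
Definition dshift k i x := phi k i x - m k i x.

Definition perturb x : MM := \matrix_(k, i) (x k i + e * \sum_(l < N | (l <= k)%N) dshift l i x).

Lemma dshift_trunc k i x : dshift k i (trunc k.+1 x) = dshift k i x.
Proof.
rewrite /dshift phiF; congr (_ - _); rewrite -[RHS]mF -[LHS]mF trunc_trunc.
by rewrite (minn_idPl (leqnSn k)).
Qed.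

Lemma dshift_le k i x (n : nat) : (k < n)%N -> dshift k i (trunc n x) = dshift k i x.
Proof. by move=> kn; rewrite -dshift_trunc trunc_trunc (minn_idPl kn) dshift_trunc. Qed.

Lemma measurable_phi k i : measurable_fun setT (phi k i : XX -> R).
Proof. by apply: lip_measurable; exists K. Qed.

Lemma measurable_dshift k i : measurable_fun setT (dshift k i : XX -> R).
Proof. by apply: measurable_funB => //; exact: measurable_phi. Qed.

Lemma measurable_perturb : measurable_fun setT (perturb : XX -> XX).
Proof.
apply: measurable_mx => k i.
rewrite (_ : (fun t => _) = fun x : XX => (x : MM) k i + e * \sum_(l < N) (if (l <= k)%N then dshift l i x else 0)).
  apply: measurable_funD; first exact: measurable_coord.
  apply: measurable_funM => //; apply: measurable_sum => l.
  by case: (l <= k)%N => //; exact: measurable_dshift.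
by apply/funext => x; rewrite mxE big_mkcond.
Qed.

Lemma adapted_perturb : adapted perturb.
Proof.
move=> n x; apply/matrixP => k i; rewrite !truncE; case: ifP => // kn.
rewrite !mxE kn; congr (_ + _ * _); apply: eq_bigr => l lk.
by rewrite dshift_le// (leq_ltn_trans lk).
Qed.

Lemma inc_perturb k i x : inc k i (perturb x) = inc k i x + e * dshift k i x.
Proof.
have posE (n : nat) : (n <= N)%N ->
    pos n i (perturb x) = pos n i x + e * \sum_(l < N | (l < n)%N) dshift l i x.
  case: n => [_|n nN]; first by rewrite /= big_pred0 ?mulr0 ?addr0.
  have := pos_this (Ordinal nN) i (perturb x); rewrite /= => ->.
  have := pos_this (Ordinal nN) i x; rewrite /= => ->.
  by rewrite mxE.
rewrite !incE !posE ?ltn_ord//; last exact: ltnW.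
rewrite (bigD1 k)//= (eq_bigl (fun l : 'I_N => (l < k)%N)); last first.
  by move=> l; rewrite ltnS ltn_neqAle andbC.
by ring.
Qed.

(* One step of the fixed point iteration recovering row n of x from y = perturb x,
   the rows before n being known and stored in s. *)
Definition row_step (n : 'I_N) (y s w : MM) : MM := \matrix_(k, i)
  if (k < n)%N then s k i else if k == n then
    y n i - e * (\sum_(l < N | (l < n)%N) dshift l i s) + e * m n i s - e * phi n i w
  else 0.

Definition row_iter (n : 'I_N) (y s : MM) (j : nat) : MM := iter j (row_step n y s) s.

(** [trunc n.+1 x] is a fixed point of the step, and the step depends on [w] only through
    [e * phi n], whose Lipschitz constant is [e * K]. *)
Lemma row_iter_contract (n : 'I_N) x w :
  `|row_step n (perturb x) (trunc n x) w - trunc n.+1 x| <= e * K * `|w - trunc n.+1 x|.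
Proof.
apply/mx_norm_leP => [|k i]; first by rewrite !mulr_ge0.
rewrite !mxE; case: ltngtP => [kn|kn|/val_inj kn].
- by rewrite ltnS (ltnW kn) subrr normr0 !mulr_ge0.
- by rewrite ltnS leqNgt kn /= -val_eqE /= gtn_eqF// subr0 normr0 !mulr_ge0.
rewrite kn eqxx ltnSn mF.
have -> : \sum_(l < N | (l < n)%N) dshift l i (trunc n x) = \sum_(l < N | (l < n)%N) dshift l i x.
  by apply: eq_bigr => l ln; rewrite dshift_le.
rewrite (bigD1 n)//= (eq_bigl (fun l : 'I_N => (l < n)%N)); last first.
  by move=> l; rewrite ltn_neqAle andbC.
rewrite (_ : _ - x n i = e * (phi n i (trunc n.+1 x) - phi n i w)); last first.
  by rewrite phiF /dshift; ring.
by rewrite normrM (ger0_norm e0) -mulrA ler_wpM2l// distrC lphi.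
Qed.

Lemma row_iter_cvg (n : 'I_N) x k i :
  (fun j => row_iter n (perturb x) (trunc n x) j k i) @ \oo --> trunc n.+1 x k i.
Proof.
pose c := `|trunc n x - trunc n.+1 x|.
have H j : `|row_iter n (perturb x) (trunc n x) j - trunc n.+1 x| <= (e * K) ^+ j * c.
  elim: j => [|j IH]; first by rewrite mul1r.
  rewrite (le_trans (row_iter_contract _ _ _))// exprS -[leRHS]mulrA ler_wpM2l// mulr_ge0//.
have cv : (fun j => (e * K) ^+ j * c) @ \oo --> (0 : R).
  rewrite -[X in _ --> X](mul0r c); apply: cvgM; last exact: cvg_cst.
  by apply: cvg_expr; rewrite ger0_norm// mulr_ge0.
apply/cvgrPdist_le => r r0; move/cvgrPdist_le : cv => /(_ r r0).
apply: filterS => j; rewrite sub0r normrN => h.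
rewrite distrC; have := mx_coord_le (row_iter n (perturb x) (trunc n x) j - trunc n.+1 x) k i.
rewrite mxE [X in _ + X]mxE => /le_trans; apply; rewrite (le_trans (H j))// (le_trans _ h)// ler_norm//.
Qed.

(** Induction on the number of rows recovered. The last clause, that only the first [n] rows of [y]
    matter, yields adaptedness of the new map at the times after the row just added. *)
Lemma partial_inverse (n : nat) : (n <= N)%N -> exists S : MM -> MM,
  [/\ measurable_fun setT (S : XX -> XX), forall x, S (perturb x) = trunc n x,
      adapted S & forall m' y, (n <= m')%N -> S (trunc m' y) = S y].
Proof.
elim: n => [_|n IH nN].
  exists (fun=> 0); split => //.
  by move=> x; apply/matrixP => k i; rewrite truncE mxE.
have [S [mS ST aS dS]] := IH (ltnW nN).
pose n' := Ordinal nN.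
pose W j (y : MM) := row_iter n' y (S y) j.
(* The upper limit makes [S'] defined and measurable at every [y]; convergence of the iteration is
   needed only on the range of [perturb]. *)
pose S' (y : MM) : MM := \matrix_(k, i) fine (limn_esup (fun j => (W j y k i)%:E)).
have cS' y k i l : (fun j => W j y k i) @ \oo --> l -> S' y k i = l.
  move=> cl; rewrite mxE.
  have : (fun j => (W j y k i)%:E) @ \oo --> l%:E by apply/fine_cvgP; split; [exact: nearW|exact: cl].
  by move=> /cvg_limn_einf_sup[_ ->].
have S'lt y k i : (k < n)%N -> S' y k i = S y k i.
  move=> kn; apply: cS'; apply: cvg_near_cst; apply: nearW => -[//|j].
  by rewrite /W /row_iter /= mxE /= kn.
have dS' m' y : (n.+1 <= m')%N -> S' (trunc m' y) = S' y.
  move=> nm; have Sm : S (trunc m' y) = S y by apply: dS; exact: ltnW.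
  have WE j : W j (trunc m' y) = W j y.
    rewrite /W Sm; elim: j => [//|j IHj]; rewrite /row_iter /= -!/(row_iter _ _ _ _) IHj.
    by apply/matrixP => k i; rewrite !mxE nm.
  apply/matrixP => k i; rewrite !mxE; congr (fine (limn_esup _)).
  by apply/funext => j; rewrite WE.
exists S'; split => //.
- apply: measurable_mx => k i.
  rewrite (_ : (fun t => _) = fine \o (fun y : XX => limn_esup (fun j => (W j y k i)%:E))); last first.
    by apply/funext => y; rewrite mxE.
  apply: measurableT_comp => //; apply: measurable_fun_limn_esup => j; apply/measurable_EFinP.
  have mW l : measurable_fun setT (W l : XX -> XX).
    elim: l => [|l IHl]; first exact: mS.
    apply: measurable_mx => k' i'.
    rewrite (_ : (fun t => _) = if (k' < n)%N then (fun y : XX => S y k' i') else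
       if k' == n' then (fun y : XX => (y : MM) n' i' - e * (\sum_(l < N) if (l < n)%N then dshift l i' (S y) else 0)
          + e * m n' i' (S y) - e * phi n' i' (W l y)) else cst 0).
      case: ifP => _; first exact: measurableT_comp (measurable_coord _ _) mS.
      case: ifP => // _; apply: measurable_funB.
        apply: measurable_funD.
          apply: measurable_funB; first exact: measurable_coord.
          apply: measurable_funM => //; apply: measurable_sum => l'; case: (l' < n)%N => //.
          exact: measurableT_comp (measurable_dshift l' i') mS.
        by apply: measurable_funM => //; exact: measurableT_comp (mm n' i') mS.
      by apply: measurable_funM => //; exact: measurableT_comp (measurable_phi n' i') IHl.
    apply/funext => y; rewrite /W /row_iter /= mxE /=.
    by case: ifP => // _; case: ifP => // _; rewrite big_mkcond.
  exact: measurableT_comp (measurable_coord _ _) (mW j).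
- move=> x; apply/matrixP => k i; apply: cS'.
  have := @row_iter_cvg n' x k i; rewrite (_ : trunc n' x = S (perturb x)); last by rewrite ST.
  exact.
- move=> m' y; have [mn|nm] := leqP m' n; last by rewrite dS'.
  apply/matrixP => k i; rewrite !truncE; case: ifP => // km.
  have kn := leq_trans km mn; rewrite !S'lt//.
  by have := aS m' y => /matrixP/(_ k i); rewrite !truncE km.
Qed.

Lemma perturb_inverse : exists S : MM -> MM,
  [/\ measurable_fun setT (S : XX -> XX), forall x, S (perturb x) = x & adapted S].
Proof.
have [S [mS ST aS _]] := partial_inverse (leqnn N).
exists S; split => // x; rewrite ST.
by apply/matrixP => k i; rewrite truncE ltn_ord.
Qed.

End Perturbation.

End Adapted.

Lemma abs_bound (R : realType) (a r1 r2 y : R) : - r1 <= y - a -> r1 <= r2 -> a - r2 <= y.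
Proof. lra. Qed.

Lemma lower_arith (R : realType) (delta u a eps x y : R) :
  x <= eps / 3 * delta -> y <= eps / 3 * delta ->
  delta * (u * a - eps) <= u * delta * a - (eps / 3 * delta + x + y).
Proof. lra. Qed.

Section Lower.
Variables (R : realType) (N d : nat) (p q C : R) (f : 'M[R]_(N, d) -> R).
Local Notation XX := (pathspace R N d).
Local Notation XX2 := (XX * XX)%type.
Local Notation MM := 'M[R]_(N, d).
Variable mu : probability XX R.
Implicit Types (k : 'I_N) (i : 'I_d).
Hypotheses (p1 : 1 < p) (qE : q = p / (p - 1)) (f1 : C1 f).
Hypothesis fC : forall x, `|DD f x| <= C * (1 + `|x| `^ (p - 1)).
Hypothesis mm : martingale_measure mu.
Hypothesis mp : intg mu (fun x : XX => `|x : 'M[R]_(N, d)| `^ p).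

Let p0 : 0 < p. Proof. exact: lt_trans p1. Qed.
Let Wd := (fun z : XX2 => (z.2 : 'M[R]_(N, d)) - (z.1 : 'M[R]_(N, d))).

Variables (phi m : 'I_N -> 'I_d -> MM -> R) (K B : R).
Hypothesis K0 : 0 <= K.
Hypothesis lphi : forall k i (x y : MM), `|phi k i x - phi k i y| <= K * `|x - y|.
Hypothesis phiF : forall k i x, phi k i (trunc k.+1 x) = phi k i x.
Hypothesis phiB : forall k i x, `|phi k i x| <= B.
Hypothesis mF : forall k i, rF k (m k i).
Hypothesis mB : forall k i x, `|m k i x| <= B.
Hypothesis cphi : forall k i, cF mu k (fun x => phi k i x - m k i x).

Let Phi := dshift phi m.

Let mPhi k i : measurable_fun setT (Phi k i : XX -> R).
Proof.
have mmx k' i' : measurable_fun setT (m k' i' : XX -> R) by have [] := mF k' i'.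
have := measurable_dshift K0 lphi mmx k i. exact.
Qed.

Let PhiB k i x : `|Phi k i x| <= 2 * B.
Proof. by rewrite (le_trans (ler_normB _ _))// mulr_natl mulr2n lerD. Qed.

Let IPhi k i : intg mu (Phi k i).
Proof.
have := @intg_bounded _ XX R mu (Phi k i) (2 * B) (mPhi k i) (PhiB k i).
exact.
Qed.

Let IPhip k i : intg mu (fun x => `|Phi k i x| `^ p).
Proof.
apply: (@intg_bounded _ _ _ _ _ ((2 * B) `^ p)); first exact: measurable_powR_comp.
by move=> x; rewrite ger0_norm ?powR_ge0// powR_mono// ltW.
Qed.

Let IDPhi k i : intg mu (fun x => Df f k i x * Phi k i x).
Proof. exact: intgMb (intg_Df p1 qE f1 fC mp k i) (mPhi k i) (PhiB k i). Qed.

(** Under [nu] an increment is that of [x] plus [e * Phi], both centered under [mu]. An event of the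
    perturbed past is an event of the past of [x], since [perturb] is adapted. *)
Lemma perturb_martingale (e : R) (nu : probability XX R) : 0 <= e ->
  (forall A : set XX, measurable A -> mu ((perturb e phi m : XX -> XX) @^-1` A) = nu A) ->
  martingale_measure nu.
Proof.
move=> e0 nuE; apply/martingaleP => k i.
have mFx k' i' x : m k' i' (trunc k' x) = m k' i' x by have [_] := mF k' i'.
have mmx k' i' : measurable_fun setT (m k' i' : XX -> R) by have [] := mF k' i'.
have mT := measurable_perturb e K0 lphi mmx.
have aT := adapted_perturb e phiF mFx.
have [Ik ck] := (martingaleP mu).1 mm k i.
have IT : intg mu (fun x => inc k i (perturb e phi m x)).
  have := intgD Ik (intgZ e (IPhi k i)); apply: eq_integrable => // x _ /=.
  by rewrite inc_perturb.
have Inu : intg nu (inc k i) by apply: (intg_image mT nuE _ IT); exact: measurable_inc.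
split => // A mA.
have mtA : measurable (@trunc R N d k @^-1` A : set XX).
  exact: measurable_preim (@measurable_trunc R N d k) _ mA.
have InuA : intg nu (fun x : XX => inc k i x * \1_(trunc k @^-1` A) x) by exact: intgMi.
have -> : Ex nu (fun x => inc k i x * \1_A (trunc k x)) =
  Ex nu (fun x : XX => inc k i x * \1_(trunc k @^-1` A) x) by [].
rewrite (Ex_image mT nuE InuA).
pose A' := (perturb e phi m : XX -> XX) @^-1` (@trunc R N d k @^-1` A).
have mA' : measurable A' by rewrite -[X in measurable X]setTI; apply: mT.
have mtA' : measurable (@trunc R N d k @^-1` A' : set XX).
  exact: measurable_preim (@measurable_trunc R N d k) _ mA'.
rewrite (@Ex_eq _ _ _ mu _ (fun x : XX => inc k i x * \1_A' (trunc k x) +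
   e * (Phi k i x * \1_A' (trunc k x)))); last first.
  move=> x; rewrite inc_perturb mulrDl -mulrA.
  have -> : \1_A' (trunc k x) = \1_(trunc k @^-1` A) (perturb e phi m x) :> R; last by [].
  rewrite /A' (indic_preim _ (perturb e phi m)) (indic_preim _ (trunc k)) aT.
  by rewrite (indic_preim _ (trunc k)).
have J1 : intg mu (fun x : XX => inc k i x * \1_A' (trunc k x)) by exact: (intgMi mtA' Ik).
have J2 : intg mu (fun x : XX => Phi k i x * \1_A' (trunc k x)) by exact: (intgMi mtA' (IPhi k i)).
rewrite ExD//; last exact: intgZ.
by rewrite ExZ// (ck _ mA') (cphi k i mA') mulr0 addr0.
Qed.

(** The pairing with the displacement is exactly [u * delta] times the sum of the products of [D]
    and [Phi]. As [Phi] is bounded, the displacement is at most [c * delta] at every path, and the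
    Taylor remainder is controlled pointwise. *)
Lemma increase_ge (u eps : R) : 0 <= u -> 0 < eps ->
  Ex mu (fun x => \sum_(k < N) \sum_(i < d) `|Phi k i x| `^ p) <= 1 ->
  exists2 d0 : R, 0 < d0 & forall delta : R, 0 < delta < d0 ->
  exists nu pi, [/\ martingale_measure nu, bicausal mu nu pi,
    intg pi (fun z => incp p (Wd z)), Ex pi (fun z => incp p (Wd z)) <= (u * delta) `^ p &
    intg nu (f : XX -> R) /\
    delta * (u * Ex mu (fun x => \sum_(k < N) \sum_(i < d) Df f k i x * Phi k i x) - eps) <=
      Ex nu (f : XX -> R) - Ex mu (f : XX -> R)].
Proof.
move=> u0 eps0 hPhi.
pose c := (N * d)%:R * (2 * B) * u : R.
have B20 k i (x : XX) : 0 <= 2 * B by exact: le_trans (PhiB k i x).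
pose cp := `|c| `^ p.
have cp0 : 0 <= cp by exact: powR_ge0.
pose e1 := eps / 3 / (1 + cp).
have eps3 : 0 < eps / 3 by rewrite divr_gt0.
have cp1 : 0 < 1 + cp by rewrite ltr_pwDl.
have e10 : 0 < e1 by rewrite divr_gt0.
have [A A0 HA] := taylor_bound f1 p1 qE fC e10.
have A1 : 0 < A + 1 by rewrite ltr_wpDl.
have [K1 HK] := tail_small mp (divr_gt0 eps3 A1).
have [B1 B10 HB] := HA K1.
pose c2 : R := B1 * cp + 1.
have c20 : 0 < c2 by rewrite ltr_wpDl// mulr_ge0.
have pB : 0 < p - 1 by rewrite subr_gt0.
have uK : 0 < u * K + 1 by rewrite ltr_wpDl// mulr_ge0.
(* The first entry makes the remainder of order [delta^p] small; the second gives [e * K < 1] for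
   [e = u * delta], the contraction condition behind the inverse. *)
exists (Num.min ((eps / 3 / c2) `^ (p - 1)^-1) (u * K + 1)^-1).
  by rewrite lt_min powR_gt0 ?invr_gt0// divr_gt0.
move=> delta /andP[d0]; rewrite lt_min => /andP[dd dK].
pose e := u * delta.
have e0 : 0 <= e by rewrite mulr_ge0// ltW.
have eK : e * K < 1.
  have : delta * (u * K + 1) < 1 by rewrite -ltr_pdivlMr// div1r.
  rewrite (_ : e * K = delta * (u * K)); last by rewrite /e; ring.
  by rewrite mulrDr mulr1; apply: lt_trans; rewrite ltrDl.
have mFx k' i' x : m k' i' (trunc k' x) = m k' i' x by have [_] := mF k' i'.
have mmx k' i' : measurable_fun setT (m k' i' : XX -> R) by have [] := mF k' i'.
have mT := measurable_perturb e K0 lphi mmx.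
have aT := adapted_perturb e phiF mFx.
have [S [mS ST aS]] := perturb_inverse e0 eK K0 lphi phiF mFx mmx.
have [nu [pi [bc nuE piE]]] := graph_coupling mu mT mS aT aS ST.
have nm := perturb_martingale e0 nuE.
have mG : measurable_fun setT (fun x : XX => (x, perturb e phi m x : XX)) by exact: measurable_fun_pair.
have incW k i x : inc k i (perturb e phi m x - x) = e * Phi k i x.
  by rewrite incB inc_perturb addrAC subrr add0r.
have incpW x : incp p (perturb e phi m x - x) = e `^ p * \sum_(k < N) \sum_(i < d) `|Phi k i x| `^ p.
  rewrite /incp mulr_sumr; apply: eq_bigr => k _; rewrite mulr_sumr; apply: eq_bigr => i _.
  by rewrite incW normrM (ger0_norm e0) powRM.
have inc1W x : inc1 (perturb e phi m x - x) <= c * delta.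
  rewrite (@le_trans _ _ (\sum_(k < N) \sum_(i < d) (e * (2 * B))))//.
    apply: ler_sum => k _; apply: ler_sum => i _; rewrite incW normrM (ger0_norm e0).
    by rewrite ler_wpM2l.
  by rewrite !sumr_const !card_ord -mulrnA -mulr_natl /c /e !natrM; apply: eq_ler; ring.
have c0 : 0 <= c.
  by rewrite -(pmulr_lge0 _ d0); apply: le_trans (inc1W point); exact: inc1_ge0.
have IS : intg mu (fun x => \sum_(k < N) \sum_(i < d) `|Phi k i x| `^ p).
  by apply: intg_sum => k _; apply: intg_sum => i _; exact: IPhip.
have mW : measurable_fun setT (fun z : XX2 => incp p (Wd z)).
  apply: measurable_sum => k; apply: measurable_sum => i.
  by apply: measurable_powR_comp; exact: measurable_incw.
have Iwmu : intg mu (fun x => incp p (Wd (x, perturb e phi m x))).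
  by have := intgZ (e `^ p) IS; apply: eq_integrable => // x _ /=; rewrite -incpW.
have Iw : intg pi (fun z => incp p (Wd z)) by exact: (intg_image mG piE mW Iwmu).
have [[pi1 pi2] _ _] := bc.
exists nu, pi; split => //.
  rewrite (Ex_image mG piE Iw).
  rewrite (@Ex_eq _ _ _ mu _ (fun x => e `^ p * \sum_(k < N) \sum_(i < d) `|Phi k i x| `^ p)).
    by rewrite ExZ// -[leRHS]mulr1 ler_wpM2l// powR_ge0.
  by move=> x; rewrite -incpW.
split; first exact: (intg_f_nu p1 qE f1 fC mp pi1 pi2 Iw).
rewrite (Ex_fdiff p1 qE f1 fC mp pi1 pi2 Iw).
have If := intg_fdiff p1 qE f1 fC mp pi1 Iw.
rewrite (Ex_image mG piE If) /=.
pose S0 (x : XX) := \sum_(k < N) \sum_(i < d) Df f k i x * Phi k i x.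
have IS0 : intg mu S0 by apply: intg_sum => k _; apply: intg_sum => i _; exact: IDPhi.
pose T (x : XX) := (K1 < `|x : 'M[R]_(N, d)|)%R%:R * (1 + `|x : 'M[R]_(N, d)| `^ p).
have IT : intg mu T.
  apply: (@intg_le _ _ _ mu _ (fun x : XX => 1 + `|x : 'M[R]_(N, d)| `^ p)).
  - apply: measurable_funM; first exact: measurable_tail.
    by apply: intg_meas (intgD (intg_cst mu 1) mp).
  - by apply: intgD => //; exact: intg_cst.
  - move=> x; rewrite /T normrM [X in _ * X]ger0_norm ?addr_ge0 ?powR_ge0//.
    by case: (_ < _); rewrite ?normr1 ?normr0 ?mul0r ?mul1r// addr_ge0 ?powR_ge0.
pose b := e1 * delta * (1 + cp) + B1 * (cp * delta `^ p).
have IF : intg mu (fun x => e * S0 x - (b + delta * A * T x)).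
  by apply: intgB; [exact: intgZ|apply: intgD; [exact: intg_cst|exact: intgZ]].
apply: (@le_trans _ _ (Ex mu (fun x => e * S0 x - (b + delta * A * T x)))); last first.
  apply: Ex_le => //; first exact: (intg_image_inv mG piE If).
  move=> x; set z := (perturb e phi m x - x : MM).
  have := HB x z delta d0; rewrite /z subrKC => h.
  have pE : pairing f x (perturb e phi m x - x) = e * S0 x.
    rewrite /pairing /S0 mulr_sumr; apply: eq_bigr => k _; rewrite mulr_sumr; apply: eq_bigr => i _.
    by rewrite incW /Df; ring.
  rewrite pE in h.
  have h1 : (inc1 (perturb e phi m x - x) / delta) `^ p <= cp.
    apply: powR_mono; [exact: ltW|by rewrite divr_ge0 ?inc1_ge0// ltW|].
    by rewrite ler_pdivrMr// ger0_norm.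
  have h2 : inc1 (perturb e phi m x - x) `^ p <= cp * delta `^ p.
    rewrite /cp -powRM ?(ltW d0)//.
    by apply: powR_mono; [exact: ltW|exact: inc1_ge0|rewrite ger0_norm].
  have h3 := ler_wpM2l B10 h2.
  have h4 := ler_wpM2l (mulr_ge0 (ltW e10) (ltW d0)) (lerD (lexx 1) h1).
  move: h; rewrite ler_norml => /andP[h _].
  have h5 := lerD (lerD h4 h3) (lexx (delta * A * T x)).
  exact: abs_bound h h5.
rewrite ExB; [|exact: intgZ|by apply: intgD; [exact: intg_cst|exact: intgZ]].
rewrite ExD; [|exact: intg_cst|exact: intgZ].
rewrite Ex_cst !ExZ// -/S0.
have hT : delta * A * Ex mu T <= eps / 3 * delta.
  rewrite mulrC mulrA mulrAC ler_wpM2r ?(ltW d0)//.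
  rewrite (le_trans (ler_wpM2r A0 HK))// mulrAC ler_pdivrMr// ler_wpM2l ?(ltW eps3)//.
  by rewrite lerDl.
have hE : e1 * delta * (1 + cp) = eps / 3 * delta.
  by rewrite /e1; field; rewrite (gt_eqF cp1).
have hB : B1 * (cp * delta `^ p) <= eps / 3 * delta.
  have dc : delta `^ (p - 1) <= eps / 3 / c2.
    rewrite -[leRHS](@powRVK _ (p - 1)) ?gt_eqF//; last first.
      by rewrite divr_ge0// ltW.
    by apply: powR_mono; rewrite ?(ltW pB) ?(ltW d0)// ltW.
  have -> : B1 * (cp * delta `^ p) = B1 * cp * delta `^ (p - 1) * delta.
    by rewrite -(mulr_powRB1 (ltW d0) p0); ring.
  rewrite ler_wpM2r ?(ltW d0)// (@le_trans _ _ (c2 * delta `^ (p - 1)))//.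
    by rewrite ler_wpM2r ?powR_ge0// /c2 lerDl.
  by rewrite mulrC -ler_pdivlMr.
rewrite /b hE /e; exact: lower_arith.
Qed.

End Lower.

(** * Duality *)

Lemma trunc_lip (R : realType) N d n (x y : 'M[R]_(N, d)) :
  `|trunc n x - trunc n y| <= `|x - y|.
Proof.
apply/mx_norm_leP => // k i; rewrite !mxE; case: ifP => _; last by rewrite subrr normr0.
by have := mx_coord_le (x - y) k i; rewrite !mxE.
Qed.

Lemma clip_lip (R : realType) (M a b : R) : 0 <= M -> `|b| <= M ->
  `|b - clip M a| <= `|b - a|.
Proof.
move=> M0 bM; have [h|h] := lerP `|a| M; first by rewrite clip_id.
have /andP[h1 h2] : - M <= b <= M by rewrite -ler_norml.
rewrite /clip; have [a0|a0] := lerP 0 a.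
  rewrite ger0_norm// in h; rewrite min_l ?(ltW h)// max_r; last lra.
  by rewrite ler0_norm; [rewrite ler0_norm; lra|lra].
rewrite ltr0_norm// in h; rewrite min_r; last lra.
rewrite max_l; last lra.
by rewrite ger0_norm; [rewrite ger0_norm; lra|lra].
Qed.

Lemma sgr_le1 (R : realType) (x : R) : `|Num.sg x| <= 1.
Proof. by rewrite normr_sg; case: (x != 0) => /=; rewrite ?ler01. Qed.

Section Duality.
Variables (R : realType) (N d : nat) (p q : R) (mu : probability (pathspace R N d) R).
Local Notation XX := (pathspace R N d).
Local Notation MM := 'M[R]_(N, d).
Hypotheses (p1 : 1 < p) (qE : q = p / (p - 1)).
Variable n : nat.

Let p0 : 0 < p. Proof. exact: lt_trans p1. Qed.
Let q1 : 1 < q. Proof. exact: q_gt1 p1 qE. Qed.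
Let q0 : 0 < q. Proof. exact: q_gt0 p1 qE. Qed.
Let pE : p = q / (q - 1).
Proof. by rewrite qE; field; rewrite ?gt_eqF ?subr_gt0//; lra. Qed.

Definition pred_Lq : set (XX -> R) := [set h | rF n h /\ intg mu (fun x => `|h x| `^ q)].

Definition dists (b : XX -> R) := [set Ex mu (fun x => `|b x - h x| `^ q) | h in pred_Lq].

(** The [q]-th power of the L^q distance of [b] to the functions measurable at time [n]; the power,
    unlike the distance, adds up over times and coordinates. *)
Definition Jinf b := inf (dists b).

Lemma pred_Lq0 : pred_Lq (fun=> 0).
Proof.
split; first by split.
by rewrite normr0; exact: intg_cst.
Qed.

Lemma has_inf_dists b : has_inf (dists b).
Proof.
split; first by exists (Ex mu (fun x => `|b x - 0| `^ q)), (fun=> 0) => //; exact: pred_Lq0.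
by exists 0 => _ [h _ <-]; apply: Ex_ge0 => x; exact: powR_ge0.
Qed.

Lemma Jinf_ge0 b : 0 <= Jinf b.
Proof.
have [h _] := has_inf_dists b; apply: lb_le_inf => //.
by move=> _ [g _ <-]; apply: Ex_ge0 => x; exact: powR_ge0.
Qed.

Lemma Jinf_le b h : pred_Lq h -> Jinf b <= Ex mu (fun x => `|b x - h x| `^ q).
Proof.
by move=> Hh; apply: ge_inf; [exact: (has_inf_dists b).2|exists h].
Qed.

Lemma Jinf_adherent b e : 0 < e -> exists2 h, pred_Lq h &
  Ex mu (fun x => `|b x - h x| `^ q) < Jinf b + e.
Proof.
by move=> e0; have [_ [h Hh <-] he] := inf_adherent e0 (has_inf_dists b); exists h.
Qed.

Lemma intg_Lq_sub (b h : XX -> R) : measurable_fun setT b -> intg mu (fun x => `|b x| `^ q) ->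
  pred_Lq h -> intg mu (fun x => `|b x - h x| `^ q).
Proof.
move=> mb Ib [[mh _] Ih].
apply: (intg_powRD (ltW q0) mb (measurable_funN mh) Ib).
by under eq_fun do rewrite normrN.
Qed.

(** If [h] were an exact nearest function to [b] and [g = b - h], then [psi q g] would be centered,
    and both E|psi g|^p and E[b psi g] would equal E|g|^q. This is why the same [J] occurs in both
    estimates. *)
Definition dual_pair (b : XX -> R) (J e : R) := exists (phi m : MM -> R) (K B : R),
  [/\ 0 <= K, forall x y, `|phi x - phi y| <= K * `|x - y|,
      forall x, phi (trunc n.+1 x) = phi x &
      (forall x, `|phi x| <= B) /\ (forall x, `|m x| <= B)] /\
  [/\ rF n m, cF mu n (fun x => phi x - m x),
      Ex mu (fun x => `|phi x - m x| `^ p) <= J + e &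
      J - e <= Ex mu (fun x => b x * (phi x - m x))].

(* For a near-minimizer [h] and [g = b - h], [psi g] attains equality in Hoelder's
   inequality, and first order optimality of [h] makes [E[psi g | F_n]] small. *)
Lemma dual_bounded (b : XX -> R) (M e : R) : rF n.+1 b -> (forall x, `|b x| <= M) ->
  0 < e -> dual_pair b (Jinf b) e.
Proof.
move=> rb bM e0; have [mb bt] := rb.
have M0 : 0 <= M by exact: le_trans (bM point).
pose B : R := (2 * M) `^ (q - 1).
have B0 : 0 <= B by exact: powR_ge0.
(* [B] bounds [psi g], and [p (2 B)^(p-1)] is a Lipschitz constant of the [p]-th power on
   [- 2 B, 2 B]; [2 M] bounds [g]. Hence [c] times E|Ph - ps| controls the errors in both estimates,
   and [4 * e1 * c = e / 2]. *)
pose c : R := p * (2 * B) `^ (p - 1) + 2 * M + 1.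
have c0 : 0 < c by rewrite ltr_wpDl// addr_ge0 ?mulr_ge0 ?powR_ge0// ltW.
pose e1 : R := e / (8 * c).
have e10 : 0 < e1 by rewrite divr_gt0// mulr_gt0.
have compM : compact [set t : R^o | `|t| <= 2 * M].
  rewrite (_ : [set t : R^o | _] = `[- (2 * M), 2 * M]%classic); first exact: segment_compact.
  by apply/seteqP; split => t /=; rewrite in_itv/= ler_norml.
have [t t0 Ht] := compact_unif_continuous compM (continuous_psi p1 qE : continuous (psi q : R^o -> R^o)) e10.
(* The defect of the near-minimizer is at most [e1 * (q * t)], so that it is still at most [e1]
   after division by the step [q * t] of the variation. *)
pose eta : R := Num.min (e1 * (q * t)) (e / 2).
have eta0 : 0 < eta by rewrite lt_min; apply/andP; split; [apply: mulr_gt0 => //; exact: mulr_gt0|exact: divr_gt0].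
have [h1 [[mh1 h1t] Ih1] h1J] := Jinf_adherent b eta0.
(* As [|b| <= M], clipping at [M] brings the near-minimizer no farther from [b]. *)
pose h := clip M \o h1.
have rh : rF n h by apply: rmeas_comp => //; exact: measurable_clip.
have [mh ht] := rh.
have hM x : `|h x| <= M by exact: clip_le.
pose g x := b x - h x.
have mg : measurable_fun setT g by exact: measurable_funB.
have gM x : `|g x| <= 2 * M by rewrite (le_trans (ler_normB _ _))// mulr_natl mulr2n lerD.
have Igq : intg mu (fun x => `|g x| `^ q).
  apply: (@intg_bounded _ _ _ _ _ ((2 * M) `^ q)); first exact: measurable_powR_comp.
  by move=> x; rewrite ger0_norm ?powR_ge0// powR_mono// ltW.
pose j := Ex mu (fun x => `|g x| `^ q).
have jJ : j <= Jinf b + eta.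
  rewrite (le_trans _ (ltW h1J))//; apply: Ex_le => //.
    apply: intg_Lq_sub => //; apply: (@intg_bounded _ _ _ _ _ (M `^ q)); first exact: measurable_powR_comp.
    by move=> x; rewrite ger0_norm ?powR_ge0// powR_mono// ltW.
  by move=> x; apply: powR_mono; rewrite ?(ltW q0)// clip_lip.
have Hh : pred_Lq h.
  split => //; apply: (@intg_bounded _ _ _ _ _ (M `^ q)); first exact: measurable_powR_comp.
  by move=> x; rewrite ger0_norm ?powR_ge0// powR_mono// ltW.
have Jj : Jinf b <= j by exact: Jinf_le.
pose ps x := psi q (g x).
have mps : measurable_fun setT ps by apply: measurableT_comp => //; exact: measurable_psi.
have psB x : `|ps x| <= B.
  by rewrite /ps (norm_psi p1 qE) powR_mono// subr_ge0 ltW.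
(* The Lipschitz approximation is taken under the law [Q] of [trunc n.+1] and then composed with
   [trunc n.+1]. This makes it depend on the first [n + 1] rows only; the accuracy is kept because
   [ps] has the same invariance. *)
pose T' : {mfun XX >-> XX} := HB.pack (@trunc R N d n.+1 : XX -> XX)
  (isMeasurableFun.Build _ _ _ _ _ (@measurable_trunc R N d n.+1)).
pose Q : probability XX R := distribution mu T'.
have QE : forall A : set XX, measurable A -> mu ((@trunc R N d n.+1 : XX -> XX) @^-1` A) = Q A by [].
have [phi0 [[K K0 lphi] phiB0 phie]] := lip_dense Q mps psB e10.
have mphi0 : measurable_fun setT (phi0 : XX -> R) by apply: lip_measurable; exists K.
pose phi (x : XX) : R := phi0 (trunc n.+1 x).
have mphi : measurable_fun setT (phi : XX -> R).
  by apply: measurableT_comp mphi0 _; exact: measurable_trunc.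
have phiB x : `|phi x| <= B by exact: phiB0.
have pst x : ps (trunc n.+1 x) = ps x.
  rewrite /ps /g bt; congr (psi _ (_ - _)).
  by rewrite -[RHS]ht -[LHS]ht trunc_trunc (minn_idPl (leqnSn n)).
have Iphi : intg mu (phi : XX -> R) by have := @intg_bounded _ XX R mu phi B mphi phiB; exact.
have Ips : intg mu ps by exact: (@intg_bounded _ XX R _ ps B mps psB).
have phips : Ex mu (fun x => `|phi x - ps x|) <= e1.
  rewrite (le_trans _ phie)// (Ex_image (@measurable_trunc R N d n.+1) QE).
    by apply: eq_ler; apply: Ex_eq => x; rewrite pst.
  by apply/intg_norm/intgB; [have := @intg_bounded _ XX R Q phi0 B mphi0 phiB0; exact|exact: (@intg_bounded _ XX R _ ps B mps psB)].
have [m [rm mB cm]] := @condexp_bounded _ XX R mu _ (@measurable_trunc R N d n) (@trunc_idem R N d n) phi B mphi phiB.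
have [mm mt] := rm.
have Im : intg mu m by exact: (@intg_bounded _ XX R _ m B mm mB).
(* The sign of [m] is measurable at time [n], so that E|m| = E[phi s]; it is also an admissible
   direction in which to vary [h]. *)
pose s x := Num.sg (m x) : R.
have rs : rF n s by apply: (rmeas_comp (@measurable_sg R)).
have [ms st] := rs.
have s1 x : `|s x| <= 1 by exact: sgr_le1.
have msn : Ex mu (fun x => `|m x|) = Ex mu (fun x => phi x * s x).
  have E : Ex mu (fun x => (phi x - m x) * s x) = 0.
    by apply: (centered_orth (intgB Iphi Im) cm rs); exact: (intgMb (intgB Iphi Im) ms s1).
  have I1 : intg mu (fun x => phi x * s x) by exact: (intgMb Iphi ms s1).
  have I2 : intg mu (fun x => m x * s x) by exact: (intgMb Im ms s1).
  have : Ex mu (fun x => phi x * s x) - Ex mu (fun x => m x * s x) = 0.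
    by rewrite -ExB// -[RHS]E; apply: Ex_eq => x; rewrite mulrBl.
  move/eqP; rewrite subr_eq0 => /eqP ->; apply: Ex_eq => x.
  by rewrite /s mulrC -normrEsg.
(* first order optimality of h in the direction of the sign of m *)
have opt : Ex mu (fun x => ps x * s x) <= 2 * e1.
  have gt x : `|g x - t * s x - g x| <= t.
    by rewrite addrAC subrr add0r normrN normrM (gtr0_norm t0) ler_piMr// ltW.
  pose ps' x := psi q (g x - t * s x).
  have mps' : measurable_fun setT ps'.
    apply: (measurableT_comp (measurable_psi q)); apply: measurable_funB => //.
    exact: measurable_funM.
  have ps'ps x : `|ps' x - ps x| <= e1.
    by apply: Ht => /=; [exact: gM|exact: gt].
  have ps'B x : `|ps' x| <= e1 + B.
    rewrite (_ : ps' x = (ps' x - ps x) + ps x); last by rewrite subrK.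
    by rewrite (le_trans (ler_normD _ _))// lerD.
  have Ips' : intg mu ps' by exact: (@intg_bounded _ XX R _ ps' _ mps' ps'B).
  have I1 : intg mu (fun x => ps x * s x) by exact: (intgMb Ips ms s1).
  have I2 : intg mu (fun x => ps' x * s x) by exact: (intgMb Ips' ms s1).
  have Hh' : pred_Lq (fun x => h x + t * s x).
    have hsM x : `|h x + t * s x| <= M + t.
      by rewrite (le_trans (ler_normD _ _))// lerD// normrM (gtr0_norm t0) ler_piMr// ltW.
    have mhs : measurable_fun setT (fun x => h x + t * s x).
      by apply: measurable_funD => //; exact: measurable_funM.
    split; first by split => // x; rewrite ht st.
    apply: (@intg_bounded _ _ _ _ _ ((M + t) `^ q)); first exact: measurable_powR_comp.
    by move=> x; rewrite ger0_norm ?powR_ge0// powR_mono// ltW.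
  have Igt : intg mu (fun x => `|g x - t * s x| `^ q).
    apply: (@intg_bounded _ _ _ _ _ ((2 * M + t) `^ q)).
      apply: measurable_powR_comp; apply: measurable_funB => //; exact: measurable_funM.
    move=> x; rewrite ger0_norm ?powR_ge0// powR_mono ?(ltW q0)//.
    by rewrite (le_trans (ler_normB _ _))// lerD// normrM (gtr0_norm t0) ler_piMr// ltW.
  have h2 : Jinf b + q * t * Ex mu (fun x => ps' x * s x) <= j.
    apply: (@le_trans _ _ (Ex mu (fun x => `|g x - t * s x| `^ q + q * t * (ps' x * s x)))).
      rewrite ExD//; last exact: intgZ.
      rewrite ExZ// lerD2r; apply: (le_trans (Jinf_le b Hh')).
      by apply: eq_ler; apply: Ex_eq => x; rewrite /g opprD addrA.
    apply: Ex_le => //; first by apply: intgD => //; exact: intgZ.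
    move=> x; have := powR_tangent p1 qE (g x) (g x - t * s x).
    by rewrite opprB addrCA subrr addr0 /ps' => /(le_trans _); apply; rewrite lerD2l; apply: eq_ler; ring.
  have h3 : Ex mu (fun x => ps' x * s x) <= e1.
    have qt0 : 0 < q * t by rewrite mulr_gt0.
    rewrite -(ler_pM2l qt0) mulrC; have := le_trans h2 jJ.
    rewrite lerD2l mulrC => /le_trans; apply.
    by rewrite mulrC [leRHS]mulrC /eta ge_min mulrC lexx.
  have h4 : Ex mu (fun x => ps x * s x) - Ex mu (fun x => ps' x * s x) <= e1.
    rewrite -ExB// -[leRHS](Ex_cst mu e1); apply: Ex_le; [exact: intgB|exact: intg_cst|].
    move=> x; rewrite -mulrBl (le_trans (ler_norm _))// normrM.
    by rewrite (le_trans (ler_wpM2l _ (s1 x)))// mulr1 distrC.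
  rewrite -[leLHS](subrK (Ex mu (fun x => ps' x * s x))) mulr_natl mulr2n; exact: lerD h4 h3.
have Em : Ex mu (fun x => `|m x|) <= 3 * e1.
  rewrite msn.
  have I1 : intg mu (fun x => ps x * s x) by exact: (intgMb Ips ms s1).
  have I2 : intg mu (fun x => phi x * s x) by exact: (intgMb Iphi ms s1).
  have h4 : Ex mu (fun x => phi x * s x) - Ex mu (fun x => ps x * s x) <= e1.
    rewrite -ExB// (le_trans _ phips)//; apply: Ex_le; [exact: intgB|exact/intg_norm/intgB|].
    move=> x; rewrite -mulrBl (le_trans (ler_norm _))// normrM.
    by rewrite (le_trans (ler_wpM2l _ (s1 x)))// mulr1.
  by clear -h4 opt; lra.
pose Ph x := phi x - m x.
have IPh : intg mu (Ph : XX -> R) by exact: intgB.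
have PhB x : `|Ph x| <= 2 * B by rewrite (le_trans (ler_normB _ _))// mulr_natl mulr2n lerD.
have mPh : measurable_fun setT (Ph : XX -> R) by exact: measurable_funB.
have ID : intg mu (fun x => `|Ph x - ps x|) by apply/intg_norm/intgB.
have Phps : Ex mu (fun x => `|Ph x - ps x|) <= 4 * e1.
  apply: (@le_trans _ _ (Ex mu (fun x => `|phi x - ps x| + `|m x|))).
    apply: Ex_le => //.
      by apply: intgD; apply: intg_norm => //; exact: intgB.
    by move=> x; rewrite /Ph addrAC; exact: ler_normB.
  rewrite ExD; [|by apply/intg_norm/intgB|exact: intg_norm].
  by clear -phips Em; lra.
have c41 : 4 * e1 * c = e / 2 by rewrite /e1; field; rewrite gt_eqF.
exists phi, m, K, B; split; split => //.
- by move=> x y; rewrite (le_trans (lphi _ _))// ler_wpM2l// trunc_lip.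
- by move=> x; rewrite /phi trunc_idem.
- apply: (@le_trans _ _ (j + e / 2)); last first.
    rewrite [leRHS](_ : _ = Jinf b + e / 2 + e / 2); last by rewrite -addrA -splitr.
    by rewrite lerD2r (le_trans jJ)// lerD2l /eta ge_min lexx orbT.
  apply: (@le_trans _ _ (Ex mu (fun x => `|g x| `^ q + p * (2 * B) `^ (p - 1) * `|Ph x - ps x|))).
    apply: Ex_le.
    + apply: (@intg_bounded _ _ _ _ _ ((2 * B) `^ p)); first exact: measurable_powR_comp.
      by move=> x; rewrite ger0_norm ?powR_ge0// powR_mono ?(ltW p0)//; exact: PhB.
    + by apply: intgD => //; exact: intgZ.
    move=> x; rewrite -/(Ph x) -(norm_psi_powR p1 qE) -/(ps x).
    (* The tangent inequality with [p] and [q] exchanged, at the point [Ph x]; recall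
       [|ps|^p = |g|^q]. *)
    have := powR_tangent q1 pE (ps x) (Ph x).
    have h2 : `|p * (psi p (Ph x) * (ps x - Ph x))| <= p * (2 * B) `^ (p - 1) * `|Ph x - ps x|.
      rewrite normrM (gtr0_norm p0) -mulrA ler_wpM2l ?(ltW p0)// normrM [`|ps x - _|]distrC ler_wpM2r//.
      by rewrite (norm_psi q1 pE) powR_mono// subr_ge0 ltW.
    have := lerNnormlW h2.
    by clear; move: (p * (psi p _ * _)) => z; lra.
  rewrite ExD//; last exact: intgZ.
  rewrite -/j lerD2l ExZ// -c41 mulrC.
  apply: ler_pM => //; first by apply: Ex_ge0.
    by rewrite mulr_ge0 ?powR_ge0// ltW.
  by rewrite /c -addrA lerDl addr_ge0// mulr_ge0.
- have Ibf : intg mu (fun x => h x * Ph x).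
    by apply: (intgMb (@intg_bounded _ XX R mu h M mh hM) mPh PhB).
  have IgPh : intg mu (fun x => g x * Ph x) by apply: (intgMb (@intg_bounded _ XX R mu g _ mg gM) mPh PhB).
  have Igps : intg mu (fun x => g x * ps x) by apply: (intgMb (@intg_bounded _ XX R mu g _ mg gM) mps psB).
  have E0 : Ex mu (fun x => h x * Ph x) = 0.
    rewrite (@Ex_eq _ _ _ mu _ (fun x => Ph x * h x)); last by move=> x; rewrite mulrC.
    by apply: (centered_orth IPh cm rh); exact: (intgMb IPh mh hM).
  have -> : Ex mu (fun x => b x * Ph x) = Ex mu (fun x => g x * Ph x).
    rewrite -[RHS]addr0 -E0 -ExD//; apply: Ex_eq => x; rewrite /g; ring.
  have Ej : Ex mu (fun x => g x * ps x) = j.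
    by apply: Ex_eq => x; rewrite /ps mulrC (mul_psi p1 qE).
  have h2 : j - Ex mu (fun x => g x * Ph x) <= e / 2.
    rewrite -Ej -ExB//.
    apply: (@le_trans _ _ (Ex mu (fun x => 2 * M * `|Ph x - ps x|))).
      apply: Ex_le; [exact: intgB|exact: intgZ|].
      by move=> x; rewrite -mulrBr (le_trans (ler_norm _))// normrM [`|ps x - _|]distrC ler_wpM2r.
    rewrite ExZ// -c41 mulrC; apply: ler_pM => //; first by apply: Ex_ge0.
      by rewrite mulr_ge0.
    by rewrite /c addrAC lerDr addr_ge0// mulr_ge0 ?powR_ge0// ltW.
  by clear -h2 Jj e0; rewrite /Ph in h2; lra.
Qed.

(** Convexity splits [c - h] into [b - h] and [c - b]. The coefficient of [Jinf b] can be brought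
    close to 1, which yields continuity of [Jinf] under L^q approximation. *)
Lemma Jinf_perturb (b c : XX -> R) (s : R) : rF n.+1 b -> rF n.+1 c ->
  intg mu (fun x => `|b x| `^ q) -> intg mu (fun x => `|c x| `^ q) -> 0 < s -> s < 1 ->
  Jinf c <= (1 - s) `^ (1 - q) * Jinf b + s `^ (1 - q) * Ex mu (fun x => `|c x - b x| `^ q).
Proof.
move=> [mb _] [mc _] Ib Ic s0 s1.
set la := (1 - s) `^ (1 - q); have la0 : 0 < la by rewrite powR_gt0// subr_gt0.
rewrite -lerBlDr [la * _]mulrC -ler_pdivrMr// {2}/Jinf; apply: lb_le_inf; first exact: (has_inf_dists b).1.
move=> _ [h Hh <-]; rewrite ler_pdivrMr// [_ * la]mulrC lerBlDr.
apply: (le_trans (Jinf_le c Hh)).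
have Ibh := intg_Lq_sub mb Ib Hh.
have Icb : intg mu (fun x => `|c x - b x| `^ q).
  apply: (intg_powRD (ltW q0) mc (measurable_funN mb) Ic).
  by under eq_fun do rewrite normrN.
rewrite -!ExZ// -ExD; [|exact: intgZ..].
apply: Ex_le; [exact: intg_Lq_sub|by apply: intgD; exact: intgZ|].
move=> x; have := powR_add_convex (b x - h x) (c x - b x) (ltW q1) s0 s1.
by rewrite addrC addrA subrK.
Qed.

Lemma dual_arith (J J' e e1 ka : R) : 0 < e -> 0 <= J -> 0 <= J' ->
  e1 * (J + 1 + e) = e / 8 -> 0 <= e1 -> J' <= (1 + e1) * J + ka -> J <= (1 + e1) * J' + ka ->
  ka <= e / 8 -> J' <= J + e / 4 /\ J - e / 4 <= J'.
Proof.
move=> e0 J0 J'0 e1E e10 h1 h2 kae.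
have h3 : J' <= J + e / 4 by nra.
split => //.
have : e1 * J' <= e1 * (J + 1 + e) by apply: ler_wpM2l => //; lra.
by nra.
Qed.

Lemma dual_arith_norm (J J' e : R) : 0 < e -> J' <= J + e / 4 -> J' + e / 4 <= J + e.
Proof. by move=> e0 h; lra. Qed.

Lemma dual_arith_pairing (J J' e u v ka : R) : 0 < e -> J - e / 4 <= J' -> ka <= e / 8 ->
  v <= ka + e / 8 -> J' - e / 4 <= u -> J - e <= u - v.
Proof. by move=> e0 *; lra. Qed.

(** Clipping [b] reduces to the bounded case. The pairing of the part cut off with [phi - m] is
    estimated by Young's inequality with a small weight on E|phi - m|^p, a quantity that the duality
    already bounds by [J + e]. *)
Lemma dual_scalar (b : XX -> R) (e : R) : rF n.+1 b -> intg mu (fun x => `|b x| `^ q) ->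
  0 < e -> dual_pair b (Jinf b) e.
Proof.
move=> rb Ib e0; have [mb _] := rb.
have J0 := Jinf_ge0 b.
have Je : 0 < Jinf b + 1 + e by rewrite ltr_wpDl// addr_ge0.
pose e1 : R := e / 8 / (Jinf b + 1 + e).
have e8 : 0 < e / 8 by rewrite divr_gt0.
have e10 : 0 < e1 by rewrite divr_gt0.
have e1E : e1 * (Jinf b + 1 + e) = e / 8 by rewrite /e1 divfK// gt_eqF.
have qB : 0 < q - 1 by rewrite subr_gt0.
(* With [s = 1 - w], the factor [(1 - s)^(1-q)] in [Jinf_perturb] is exactly [1 + e1]. *)
pose w : R := (1 + e1) `^ (1 - q)^-1.
have w0 : 0 < w by rewrite powR_gt0// addr_gt0.
have wE : w `^ (1 - q) = 1 + e1.
  by rewrite /w powRVK ?addr_ge0 ?(ltW e10)// -(opprB q) oppr_eq0 gt_eqF.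
have w1 : w < 1.
  rewrite ltNge; apply/negP => w1.
  have : w `^ (1 - q) <= 1 `^ (1 - q).
    rewrite powR1 -[leRHS](powRr0 w); apply: ler_powR => //.
    by rewrite -oppr_ge0 opprB ltW.
  by rewrite wE powR1 leNgt ltrDl e10.
pose s := 1 - w; have s0 : 0 < s by rewrite subr_gt0.
have s1 : s < 1 by rewrite ltrBlDl ltrDr.
have sw : 1 - s = w by rewrite /s subKr.
pose S := s `^ (1 - q); have S0 : 0 < S by exact: powR_gt0.
have [A A0 HA] := young_eps p1 qE e10.
(* A single clipping level serves both for the change of [Jinf] (coefficient [S]) and for the error
   in the pairing (coefficient [A]). *)
pose c : R := S + A + 1; have c0 : 0 < c by rewrite ltr_wpDl// addr_ge0// ltW.
have : (fun k : nat => Ex mu (fun x => `|b x - clip k%:R (b x)| `^ q)) @ \oo --> Ex mu (fun=> 0).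
  apply: (Ex_dct _ _ _ (intgZ (2 `^ q) Ib)) => //.
  - move=> k; apply: measurable_powR_comp; apply: measurable_funB => //.
    by apply: measurableT_comp => //; exact: measurable_clip.
  - move=> x; apply: cvg_near_cst; near=> k; rewrite clip_id ?subrr ?normr0 ?powR0 ?gt_eqF//.
    near: k; exact: nbhs_infty_ger.
  - move=> k x; rewrite ger0_norm ?powR_ge0// -powRM//; apply: powR_mono; [exact: ltW|by []|].
    by rewrite (le_trans (ler_normB _ _))// mulr_natl mulr2n lerD// clip_norm.
rewrite Ex_cst => /cvgr0_norm_le /(_ _ (divr_gt0 e8 c0))[k _ /(_ k (leqnn k)) /= Hk].
have {}Hk := le_trans (ler_norm _) Hk.
pose b' x := clip k%:R (b x).
have rb' : rF n.+1 b' by apply: (rmeas_comp (measurable_clip k%:R) rb).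
have [mb' _] := rb'.
have b'M x : `|b' x| <= k%:R by exact: clip_le.
have Ib' : intg mu (fun x => `|b' x| `^ q).
  apply: (intg_le _ Ib); first exact: measurable_powR_comp.
  by move=> x; rewrite ger0_norm ?powR_ge0// powR_mono ?(ltW q0)// clip_norm.
pose dl := Ex mu (fun x => `|b x - b' x| `^ q).
have dl0 : 0 <= dl by apply: Ex_ge0 => x; exact: powR_ge0.
have dlc : c * dl <= e / 8 by rewrite mulrC -ler_pdivlMr.
have e4 : 0 < e / 4 by rewrite divr_gt0.
have [phi [m [K [B [[K0 lphi phiF [phiB mB]] [rm cm hP hE]]]]]] := dual_bounded rb' b'M e4.
have dl' : Ex mu (fun x => `|b' x - b x| `^ q) = dl by apply: Ex_eq => x; rewrite distrC.
have j1 := Jinf_perturb rb rb' Ib Ib' s0 s1; rewrite sw wE dl' -/S in j1.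
have j2 := Jinf_perturb rb' rb Ib' Ib s0 s1; rewrite sw wE -/S -/dl in j2.
have Sdl : S * dl <= e / 8.
  by apply: le_trans dlc; apply: (ler_wpM2r dl0); rewrite /c -addrA lerDl; apply: addr_ge0.
have Adl : A * dl <= e / 8.
  by apply: le_trans dlc; apply: (ler_wpM2r dl0); rewrite /c addrAC lerDr; apply: addr_ge0; [exact: ltW|exact: ler01].
have [k1 k2] := dual_arith e0 J0 (Jinf_ge0 b') e1E (ltW e10) j1 j2 Sdl.
exists phi, m, K, B; split; first by split; [exact: K0|exact: lphi|exact: phiF|split].
have hP' : Ex mu (fun x => `|phi x - m x| `^ p) <= Jinf b + e.
  exact: (le_trans hP (dual_arith_norm e0 k1)).
split; [exact: rm|exact: cm|exact: hP'|].
have [mm _] := rm.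
pose Ph (x : XX) : R := phi x - m x.
have mphi : measurable_fun setT (phi : XX -> R) by apply: lip_measurable; exists K.
have mPh : measurable_fun setT Ph by exact: measurable_funB.
have PhB x : `|Ph x| <= 2 * B by rewrite (le_trans (ler_normB _ _))// mulr_natl mulr2n lerD.
have Ibb : intg mu b by exact: (intg_powR_le (ltW q1) mb Ib).
have Ibb' : intg mu b' by exact: (intg_powR_le (ltW q1) mb' Ib').
have I1 : intg mu (fun x => b' x * Ph x) by exact: (intgMb Ibb' mPh PhB).
have I2 : intg mu (fun x => (b' x - b x) * Ph x) by exact: (intgMb (intgB Ibb' Ibb) mPh PhB).
have I3 : intg mu (fun x => `|Ph x| `^ p).
  apply: (@intg_bounded _ XX R mu _ ((2 * B) `^ p)); first exact: measurable_powR_comp.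
  by move=> x; rewrite ger0_norm ?powR_ge0// powR_mono ?(ltW p0).
have I4 : intg mu (fun x => `|b x - b' x| `^ q).
  apply: (intg_powRD (ltW q0) mb (measurable_funN mb') Ib).
  by under eq_fun do rewrite normrN.
have h1 : Ex mu (fun x => (b' x - b x) * Ph x) <= A * dl + e1 * (Jinf b + 1 + e).
  apply: (@le_trans _ _ (Ex mu (fun x => A * `|b x - b' x| `^ q + e1 * `|Ph x| `^ p))).
    apply: Ex_le => //; first by apply: intgD; exact: intgZ.
    by move=> x; rewrite (le_trans (ler_norm _))// normrM [`|b' x - _|]distrC HA.
  rewrite ExD; [|exact: intgZ..]; rewrite !ExZ// lerD2l ler_wpM2l ?(ltW e10)//.
  rewrite (le_trans hP')// addrAC lerDl; exact: ler01.
rewrite e1E in h1.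
have -> : Ex mu (fun x => b x * Ph x) = Ex mu (fun x => b' x * Ph x) - Ex mu (fun x => (b' x - b x) * Ph x).
  by rewrite -ExB//; apply: Ex_eq => x; ring.
have h2 : Jinf b' - e / 4 <= Ex mu (fun x => b' x * Ph x) by exact: hE.
exact: (dual_arith_pairing e0 k2 Adl h1 h2).
Unshelve. all: by end_near. Qed.

End Duality.

Lemma le_sum2 (R : numDomainType) (N d : nat) (F : 'I_N -> 'I_d -> R) k0 i0 :
  (forall k i, 0 <= F k i) -> F k0 i0 <= \sum_k \sum_i F k i.
Proof.
move=> F0; rewrite (bigD1 k0)//= (bigD1 i0)//= -addrA lerDl.
by apply: addr_ge0; [exact: sumr_ge0|apply: sumr_ge0 => k _; exact: sumr_ge0].
Qed.

Lemma sum2_cst (R : numDomainType) (N d : nat) (c : R) :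
  \sum_(k < N) \sum_(i < d) c = (N * d)%:R * c.
Proof.
rewrite (eq_bigr (fun=> c *+ d)) => [|k _]; last by rewrite sumr_const card_ord.
by rewrite sumr_const card_ord -mulrnA mulnC mulr_natl.
Qed.

Lemma Ex_sum2 d0 (T : measurableType d0) (R : realType) (P : probability T R) (N d : nat)
    (F : 'I_N -> 'I_d -> T -> R) : (forall k i, intg P (F k i)) ->
  Ex P (fun x => \sum_k \sum_i F k i x) = \sum_k \sum_i Ex P (F k i).
Proof.
move=> IF; rewrite Ex_sum => [|k _]; last by apply: intg_sum => i _; exact: IF.
by apply: eq_bigr => k _; rewrite Ex_sum.
Qed.

Section TotalDuality.
Variables (R : realType) (N d : nat) (p q C : R) (f : 'M[R]_(N, d) -> R).
Local Notation XX := (pathspace R N d).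
Local Notation MM := 'M[R]_(N, d).
Variable mu : probability XX R.
Hypotheses (p1 : 1 < p) (qE : q = p / (p - 1)) (f1 : C1 f).
Hypothesis fC : forall x : MM, `|DD f x| <= C * (1 + `|x| `^ (p - 1)).
Hypothesis mp : intg mu (fun x : XX => `|x : MM| `^ p).

Local Notation G := (Gf f mu).
Local Notation Gspec := (Gf_spec p1 qE f1 fC mp).
Local Notation GLq := (intg_Gfq p1 qE f1 fC mp).

Definition Jtot : R := \sum_(k < N) \sum_(i < d) Jinf q mu k (G k i).

Lemma Jtot_ge0 : 0 <= Jtot.
Proof. by apply: sumr_ge0 => k _; apply: sumr_ge0 => i _; exact: Jinf_ge0. Qed.

Definition predictable (h : 'I_N -> 'I_d -> XX -> R) := forall (k : 'I_N) (i : 'I_d), pred_Lq q mu k (h k i).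

Lemma intg_dist h k i : predictable h -> intg mu (fun x => `|G k i x - h k i x| `^ q).
Proof.
move=> Hh; have [[mG _] _ _] := Gspec k i.
exact: (intg_Lq_sub p1 qE mG (GLq k i) (Hh k i)).
Qed.

Lemma Jtot_le h : predictable h ->
  Jtot <= Ex mu (fun x => \sum_(k < N) \sum_(i < d) `|G k i x - h k i x| `^ q).
Proof.
move=> Hh; rewrite Ex_sum2 => [|k i]; last exact: intg_dist.
by apply: ler_sum => k _; apply: ler_sum => i _; exact: Jinf_le.
Qed.

Lemma sum2_eps (e : R) : 0 < e -> exists2 c : R, 0 < c & \sum_(k < N) \sum_(i < d) c <= e.
Proof.
move=> e0; have s0 : 0 < (N * d)%:R + 1 :> R by rewrite ltr_wpDl.
exists (e / ((N * d)%:R + 1)); first exact: divr_gt0.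
rewrite sum2_cst mulrCA ler_piMr ?(ltW e0)//.
by rewrite ler_pdivrMr// mul1r lerDl.
Qed.

Lemma Jtot_adherent e : 0 < e -> exists2 h, predictable h &
  Ex mu (fun x => \sum_(k < N) \sum_(i < d) `|G k i x - h k i x| `^ q) <= Jtot + e.
Proof.
move=> e0; have [c c0 ce] := sum2_eps e0.
have /choice[h Hh] (ki : 'I_N * 'I_d) : exists h, pred_Lq q mu ki.1 h /\
    Ex mu (fun x => `|G ki.1 ki.2 x - h x| `^ q) < Jinf q mu ki.1 (G ki.1 ki.2) + c.
  by have [h ? ?] := Jinf_adherent q mu ki.1 (G ki.1 ki.2) c0; exists h.
have ph : predictable (fun k i => h (k, i)) by move=> k i; exact: (Hh (k, i)).1.
exists (fun k i => h (k, i)) => //.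
rewrite Ex_sum2 => [|k i]; last exact: (intg_dist k i ph).
apply: le_trans (lerD (lexx Jtot) ce); rewrite /Jtot -big_split/=.
apply: ler_sum => k _; rewrite -big_split/=; apply: ler_sum => i _.
exact: (ltW (Hh (k, i)).2).
Qed.

(** [J0] bounds the pairing from below and [J1] the [p]-th power of the norm from above. They are
    kept apart because multiplying the pair by [c] scales them by [c] and by [c^p]. *)
Definition dual_total (J0 J1 : R) := exists (phi m : 'I_N -> 'I_d -> MM -> R) (K B : R),
  [/\ 0 <= K, forall k i x y, `|phi k i x - phi k i y| <= K * `|x - y|,
      forall (k : 'I_N) i x, phi k i (trunc k.+1 x) = phi k i x &
      (forall k i x, `|phi k i x| <= B) /\ (forall k i x, `|m k i x| <= B)] /\
  [/\ forall (k : 'I_N) i, rF k (m k i), forall (k : 'I_N) i, cF mu k (fun x => phi k i x - m k i x),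
      Ex mu (fun x => \sum_(k < N) \sum_(i < d) `|dshift phi m k i x| `^ p) <= J1 &
      J0 <= Ex mu (fun x => \sum_(k < N) \sum_(i < d) Df f k i x * dshift phi m k i x)].

Lemma dual_sum e : 0 < e -> dual_total (Jtot - e) (Jtot + e).
Proof.
move=> e0; have [c c0 ce] := sum2_eps e0.
have D (ki : 'I_N * 'I_d) : dual_pair p mu ki.1 (G ki.1 ki.2) (Jinf q mu ki.1 (G ki.1 ki.2)) c.
  by have [r _ _] := Gspec ki.1 ki.2; apply: (dual_scalar p1 qE r _ c0); exact: GLq.
have [phi {}D] := choice D.
have [m {}D] := choice D.
have [K {}D] := choice D.
have [B D'] := choice D.
have K0 k i : 0 <= K (k, i) by have [[]] := D' (k, i).
have lphi k i x y : `|phi (k, i) x - phi (k, i) y| <= K (k, i) * `|x - y|.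
  by have [[_ + _ _] _] := D' (k, i); apply.
have phiF (k : 'I_N) i x : phi (k, i) (trunc k.+1 x) = phi (k, i) x.
  by have [[_ _ + _] _] := D' (k, i); apply.
have phiB k i x : `|phi (k, i) x| <= B (k, i) by have [[_ _ _ [+ _]] _] := D' (k, i); apply.
have mB k i x : `|m (k, i) x| <= B (k, i) by have [[_ _ _ [_ +]] _] := D' (k, i); apply.
have rm (k : 'I_N) i : rF k (m (k, i)) by have [_ []] := D' (k, i).
have cP (k : 'I_N) i : cF mu k (fun x => phi (k, i) x - m (k, i) x) by have [_ []] := D' (k, i).
have hP (k : 'I_N) i : Ex mu (fun x => `|phi (k, i) x - m (k, i) x| `^ p) <= Jinf q mu k (G k i) + c.
  by have [_ []] := D' (k, i).
have hG (k : 'I_N) i : Jinf q mu k (G k i) - c <= Ex mu (fun x => G k i x * (phi (k, i) x - m (k, i) x)).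
  by have [_ []] := D' (k, i).
have B0 k i : 0 <= B (k, i) by exact: le_trans (phiB k i point).
have BB k i : B (k, i) <= \sum_k \sum_i B (k, i).
  exact: (@le_sum2 _ _ _ (fun k i => B (k, i))).
have KK k i : K (k, i) <= \sum_k \sum_i K (k, i).
  exact: (@le_sum2 _ _ _ (fun k i => K (k, i))).
pose Ph k i (x : XX) : R := phi (k, i) x - m (k, i) x.
have mphi k i : measurable_fun setT (phi (k, i) : XX -> R) by apply: lip_measurable; exists (K (k, i)).
have mPh k i : measurable_fun setT (Ph k i) by apply: measurable_funB => //; exact: (rm k i).1.
have PhB k i x : `|Ph k i x| <= B (k, i) + B (k, i).
  by rewrite (le_trans (ler_normB _ _))// lerD.
have rPh (k : 'I_N) i : rF k.+1 (Ph k i).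
  by split => // x; rewrite /Ph phiF; have [_ ->] := rF_le (leqnSn k) (rm k i).
exists (fun k i => phi (k, i)), (fun k i => m (k, i)), (\sum_k \sum_i K (k, i)), (\sum_k \sum_i B (k, i)).
split; split.
- by apply: sumr_ge0 => k _; exact: sumr_ge0.
- by move=> k i x y; rewrite (le_trans (lphi k i x y))// ler_wpM2r.
- exact: phiF.
- by split => k i x; rewrite (le_trans _ (BB k i)).
- exact: rm.
- exact: cP.
- rewrite (@Ex_sum2 _ XX R mu N d (fun k i x => `|Ph k i x| `^ p)).
    apply: le_trans (lerD (lexx Jtot) ce); rewrite /Jtot -big_split/=.
    by apply: ler_sum => k _; rewrite -big_split/=; apply: ler_sum => i _; exact: hP.
  move=> k i; apply: (@intg_bounded _ XX R mu _ ((B (k, i) + B (k, i)) `^ p)).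
    exact: measurable_powR_comp.
  by move=> x; rewrite ger0_norm ?powR_ge0// powR_mono// ltW// (lt_trans _ p1).
- rewrite (@Ex_sum2 _ XX R mu N d (fun k i x => Df f k i x * Ph k i x)).
    apply: le_trans (lerB (lexx Jtot) ce) _; rewrite /Jtot -sumrB.
    apply: ler_sum => k _; rewrite -sumrB; apply: ler_sum => i _.
    (* [D] may take the place of its conditional expectation [G]: [D - G] is centered given time
       [k + 1], and [Ph k i] is measurable at that time. *)
    apply: (le_trans (hG k i)); rewrite -subr_ge0.
    have [rG IG cG] := Gspec k i.
    have ID := intg_Df p1 qE f1 fC mp k i.
    rewrite -ExB; [|exact: (intgMb ID (mPh k i) (PhB k i))|exact: (intgMb IG (mPh k i) (PhB k i))].
    rewrite (@Ex_eq _ _ _ mu _ (fun x => (Df f k i x - G k i x) * Ph k i x)); last by move=> x; rewrite -mulrBl.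
    rewrite (centered_orth (intgB ID IG) cG (rPh k i))//.
    exact: (intgMb (intgB ID IG) (mPh k i) (PhB k i)).
  by move=> k i; exact: (intgMb (intg_Df p1 qE f1 fC mp k i) (mPh k i) (PhB k i)).
Qed.

Lemma dual_scale (c J0 J1 : R) : 0 <= c -> dual_total J0 J1 -> dual_total (c * J0) (c `^ p * J1).
Proof.
move=> c0 [phi [m [K [B [[K0 lphi phiF [phiB mB]] [rm cP hP hG]]]]]].
have mphi k i : measurable_fun setT (phi k i : XX -> R) by apply: lip_measurable; exists K.
have mPh k i : measurable_fun setT (dshift phi m k i : XX -> R).
  by apply: measurable_funB => //; exact: (rm k i).1.
have PhB k i x : `|dshift phi m k i x| <= B + B.
  by rewrite (le_trans (ler_normB _ _))// lerD.
have S k i x : dshift (fun k i x => c * phi k i x) (fun k i x => c * m k i x) k i x = c * dshift phi m k i x.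
  by rewrite /dshift mulrBr.
exists (fun k i x => c * phi k i x), (fun k i x => c * m k i x), (c * K), (c * B); split; split.
- exact: mulr_ge0.
- by move=> k i x y; rewrite -mulrBr normrM ger0_norm// -mulrA ler_wpM2l.
- by move=> k i x; rewrite phiF.
- by split => k i x; rewrite normrM ger0_norm// ler_wpM2l.
- move=> k i; have [mm rr] := rm k i; split; first exact: measurable_funM.
  by move=> x; rewrite rr.
- move=> k i A mA; rewrite -(mulr0 c) -(cP k i A mA) -ExZ; last first.
    have := intgMi (measurable_preim (@measurable_trunc R N d k) mA) (@intg_bounded _ XX R mu _ (B + B) (mPh k i) (PhB k i)).
    by under eq_fun do rewrite indic_preim.
  by apply: Ex_eq => x; rewrite -mulrBr mulrA.
- rewrite (@Ex_eq _ _ _ mu _ (fun x => c `^ p * (\sum_(k < N) \sum_(i < d) `|dshift phi m k i x| `^ p))).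
    rewrite ExZ; first by rewrite ler_wpM2l// powR_ge0.
    apply: intg_sum => k _; apply: intg_sum => i _.
    apply: (@intg_bounded _ XX R mu _ ((B + B) `^ p)); first exact: measurable_powR_comp.
    by move=> x; rewrite ger0_norm ?powR_ge0// powR_mono ?(ltW (lt_trans _ p1))//; exact: PhB.
  move=> x; rewrite mulr_sumr; apply: eq_bigr => k _; rewrite mulr_sumr; apply: eq_bigr => i _.
  by rewrite S normrM ger0_norm// powRM.
- rewrite (@Ex_eq _ _ _ mu _ (fun x => c * (\sum_(k < N) \sum_(i < d) Df f k i x * dshift phi m k i x))).
    rewrite ExZ; first by rewrite ler_wpM2l.
    apply: intg_sum => k _; apply: intg_sum => i _.
    exact: (intgMb (intg_Df p1 qE f1 fC mp k i) (mPh k i) (PhB k i)).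
  move=> x; rewrite mulr_sumr; apply: eq_bigr => k _; rewrite mulr_sumr; apply: eq_bigr => i _.
  by rewrite S mulrCA.
Qed.

Lemma dual_zero : dual_total 0 0.
Proof.
have S k i x : dshift (fun (_ : 'I_N) (_ : 'I_d) (_ : MM) => 0 : R) (fun _ _ _ => 0) k i x = 0.
  by rewrite /dshift subr0.
exists (fun _ _ _ => 0), (fun _ _ _ => 0), 0, 0; split; split => //.
- by move=> k i x y; rewrite subr0 normr0 mul0r.
- by split => k i x; rewrite normr0.
- move=> k i A mA; rewrite -[RHS](Ex_cst mu 0); apply: Ex_eq => x.
  by rewrite subr0 mul0r.
- rewrite -[leRHS](Ex_cst mu 0); apply: eq_ler; apply: Ex_eq => x.
  rewrite big1// => k _; rewrite big1// => i _.
  by rewrite S normr0 powR0// gt_eqF// (lt_trans _ p1).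
- rewrite -[leLHS](Ex_cst mu 0); apply: eq_ler; apply: Ex_eq => x.
  by rewrite big1// => k _; rewrite big1// => i _; rewrite S mulr0.
Qed.

Lemma dual_total_le J0 J0' J1 J1' : J0 <= J0' -> J1' <= J1 -> dual_total J0' J1' -> dual_total J0 J1.
Proof.
move=> h0 h1 [phi [m [K [B [H [rm cP hP hG]]]]]].
exists phi, m, K, B; split; [exact: H|split; [exact: rm|exact: cP| |]].
  exact: le_trans hP h1.
exact: le_trans h0 hG.
Qed.

(** Multiplication by [(Jtot + eta)^(-1/p)] normalizes the norm to 1 and turns [Jtot - eta] into
    [(Jtot + eta)^(1/q) - 2 eta (Jtot + eta)^(-1/p)]. With [eta = e / 2 * Jtot^(1/p)] the loss is at
    most [e]. If [Jtot = 0], the zero perturbation is enough. *)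
Lemma dual_normalized e : 0 < e -> dual_total (Jtot `^ q^-1 - e) 1.
Proof.
move=> e0; have p0 : 0 < p by rewrite (lt_trans _ p1).
have q0 := q_gt0 p1 qE.
have := Jtot_ge0; rewrite le_eqVlt => /predU1P[<-|J0].
  apply: dual_total_le dual_zero => //.
  by rewrite powR0 ?invr_eq0 ?gt_eqF// sub0r oppr_le0 ltW.
pose eta := e / 2 * Jtot `^ p^-1.
have Jp0 : 0 < Jtot `^ p^-1 by exact: powR_gt0.
have eta0 : 0 < eta by rewrite mulr_gt0// divr_gt0.
have Je0 : 0 < Jtot + eta by rewrite addr_gt0.
have Jep : 0 < (Jtot + eta) `^ p^-1 by exact: powR_gt0.
have JJ : Jtot `^ p^-1 <= (Jtot + eta) `^ p^-1.
  by rewrite powR_mono ?invr_ge0 ?(ltW p0) ?(ltW J0)// lerDl ltW.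
have qp : q^-1 = 1 - p^-1.
  by rewrite -(conj_pq p1 qE) addrAC subrr add0r.
have c0 : 0 < (Jtot + eta) `^ (- p^-1) by exact: powR_gt0.
apply: (dual_total_le _ _ (dual_scale (ltW c0) (dual_sum eta0))); last first.
  by rewrite -powRrM mulNr mulVf ?gt_eqF// powR_inv1 ?(ltW Je0)// mulVf// gt_eqF.
have cE : (Jtot + eta) `^ (- p^-1) * (Jtot + eta) = (Jtot + eta) `^ q^-1.
  rewrite -[X in _ * X](powRr1 (ltW Je0)) -powRD ?(gt_eqF Je0) ?implybT//.
  by rewrite qp [- _ + 1]addrC.
have cp : (Jtot + eta) `^ (- p^-1) * Jtot `^ p^-1 <= 1.
  by rewrite powRN -ler_pdivlMl ?invr_gt0// invrK mulr1.
have h1 : Jtot `^ q^-1 <= (Jtot + eta) `^ q^-1.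
  by rewrite powR_mono ?invr_ge0 ?(ltW q0) ?(ltW J0)// lerDl ltW.
rewrite (_ : _ * _ = (Jtot + eta) `^ q^-1 - e * ((Jtot + eta) `^ (- p^-1) * Jtot `^ p^-1)).
  by rewrite lerB// ler_piMr// ltW.
rewrite -cE /eta; by field.
Qed.

End TotalDuality.

Section Upsilon.
Variables (R : realType) (N d : nat) (p q C : R) (f : 'M[R]_(N, d) -> R).
Local Notation XX := (pathspace R N d).
Local Notation MM := 'M[R]_(N, d).
Variable mu : probability XX R.
Hypotheses (p1 : 1 < p) (qE : q = p / (p - 1)) (f1 : C1 f).
Hypothesis fC : forall x : MM, `|DD f x| <= C * (1 + `|x| `^ (p - 1)).
Hypothesis mp : intg mu (fun x : XX => `|x : MM| `^ p).

Local Notation G := (Gf f mu).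
Local Notation Gspec := (Gf_spec p1 qE f1 fC mp).
Let q0 : 0 < q. Proof. exact: q_gt0 p1 qE. Qed.

Lemma condE_rVE k x i : condE_rV mu (Ft (this_time k)) (DD_ f k) x 0 i = G k i x.
Proof.
rewrite mxE /Gf; congr (condE mu _ _ x); apply/funext => y.
by rewrite /Df mxE.
Qed.

Lemma lnorm_powR (v : 'rV[R]_d) : lnorm q v `^ q = \sum_i `|v 0 i| `^ q.
Proof.
by rewrite /lnorm powRVK ?gt_eqF// sumr_ge0// => i _; exact: powR_ge0.
Qed.

Lemma HH_predictable (h : 'I_N -> XX -> 'rV[R]_d) :
  HH q mu h <-> predictable q mu (fun k i x => h k x 0 i).
Proof.
have mq k i : measurable_fun setT (fun x => h k x 0 i) ->
    measurable_fun setT (fun x => `|h k x 0 i| `^ q) by exact: measurable_powR_comp.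
split => [[mh Ih] k i|H].
  have rh i' : rF k (fun x => h k x 0 i').
    apply/(rmeas_wrt (prev_time k)) => B mB.
    apply: (mh k ((fun v : borel 'rV[R]_d => (v : 'rV[R]_d) 0 i') @^-1` B)).
    by rewrite -[X in measurable X]setTI; apply: measurable_coord.
  split; first exact: rh.
  have mi i' := (rh i').1.
  have ms : measurable_fun setT (fun x => lnorm q (h k x) `^ q).
    under eq_fun do rewrite lnorm_powR.
    by apply: measurable_sum => i'; apply: mq; exact: mi.
  apply: (intg_le _ (intg_ge0 ms _ _)).
  - by apply: mq; exact: mi.
  - by move=> x; exact: powR_ge0.
  - apply: le_lt_trans Ih; rewrite (bigD1 k)//= leeDl//.
    by apply: sume_ge0 => j _; apply: integral_ge0 => x _; rewrite lee_fin powR_ge0.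
  - move=> x; rewrite ger0_norm ?powR_ge0// lnorm_powR (bigD1 i)//= lerDl.
    by apply: sumr_ge0 => j _; exact: powR_ge0.
split=> [k|].
  apply: measurable_wrtE.
    by apply: measurable_mx => z i; rewrite (_ : z = 0) ?ord1//; exact: (H k i).1.1.
  by move=> x; apply/rowP => i; exact: (H k i).1.2.
have Ik k : intg mu (fun x => lnorm q (h k x) `^ q).
  under eq_fun do rewrite lnorm_powR.
  by apply: intg_sum => i _; exact: (H k i).2.
rewrite (eq_bigr (fun k => (Ex mu (fun x => lnorm q (h k x) `^ q))%:E)).
  by rewrite sumEFin ltry.
by move=> k _; rewrite ExE.
Qed.

Lemma dist_powR (h : 'I_N -> XX -> 'rV[R]_d) : HH q mu h ->
  ((\int[mu]_x (\sum_(k < N) lnorm q (condE_rV mu (Ft (this_time k)) (DD_ f k) x - h k x) `^ q)%:E) `^ q^-1)%E =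
  (Ex mu (fun x => \sum_(k < N) \sum_(i < d) `|G k i x - h k x 0 i| `^ q) `^ q^-1)%:E.
Proof.
move=> /HH_predictable Hh; rewrite -poweR_EFin; congr (_ `^ _)%E.
rewrite -ExE; last first.
  apply: intg_sum => k _; apply: intg_sum => i _; exact: (intg_dist p1 qE f1 fC mp k i Hh).
apply: eq_integral => x _; congr EFin; apply: eq_bigr => k _.
rewrite lnorm_powR; apply: eq_bigr => i _.
by rewrite !mxE -condE_rVE mxE.
Qed.

Lemma dist_inf : ereal_inf
    [set ((\int[mu]_x (\sum_(k < N)
            lnorm q (condE_rV mu (Ft (this_time k)) (DD_ f k) x - h k x)
              `^ q)%R%:E) `^ q^-1)%E
    | h in HH q mu] = (Jtot q f mu `^ q^-1)%:E.
Proof.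
have qV : 0 < q^-1 by rewrite invr_gt0.
apply/eqP; rewrite eq_le; apply/andP; split; last first.
  apply/ereal_infP => _ [h Hh <-]; rewrite dist_powR// lee_fin.
  apply: powR_mono; [exact: ltW|exact: Jtot_ge0|].
  exact: (Jtot_le p1 qE f1 fC mp ((HH_predictable h).1 Hh)).
apply/lee_addgt0Pr => e e0; set v := Jtot q f mu `^ q^-1.
have v0 : 0 <= v by exact: powR_ge0.
have vE : v `^ q = Jtot q f mu by rewrite /v powRVK ?gt_eqF// Jtot_ge0.
(* The margin for [q]-th powers that becomes [e] after the [q]-th root is taken. *)
have h0 : 0 < (v + e) `^ q - v `^ q.
  by rewrite subr_gt0 gt0_ltr_powR ?nnegrE ?addr_ge0 ?(ltW e0)// ltrDl.
have [h Hh] := Jtot_adherent p1 qE f1 fC mp h0.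
rewrite -vE addrC subrK => He.
pose hv k x : 'rV[R]_d := \row_i h k i x.
have hvE : (fun k i x => hv k x 0 i) = h.
  by apply/funext => k; apply/funext => i; apply/funext => x; rewrite /hv mxE.
have Hv : HH q mu hv by apply/HH_predictable; rewrite hvE.
apply: ge_ereal_inf; eexists; first by exists hv.
rewrite dist_powR//.
rewrite -EFinD lee_fin -[leRHS](@powRK _ q) ?gt_eqF ?addr_ge0 ?(ltW e0)//.
apply: powR_mono; [exact: ltW|by apply: Ex_ge0 => x; apply: sumr_ge0 => k _; apply: sumr_ge0 => i _; exact: powR_ge0|].
apply: le_trans He; apply: eq_ler; apply: Ex_eq => x.
by apply: eq_bigr => k _; apply: eq_bigr => i _; rewrite /hv mxE.
Qed.

End Upsilon.

(** * The asymptotic expansion *)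

Section Penalty.
Variables (R : realType) (p v0 : R) (L : R -> \bar R).
Hypotheses (p1 : 1 < p) (v00 : 0 <= v0).
Hypothesis L0 : forall u, 0 <= u -> (0 <= L u)%E.
Hypothesis L00 : L 0 = 0%E.
Hypothesis Lp : limf_einf (fun u => L u / (u `^ p)%:E)%E (pinfty_nbhs R) = +oo%E.

Lemma penalty_growth (M : R) : exists2 U : R, 1 <= U & forall u, U < u -> ((M * u `^ p)%:E <= L u)%E.
Proof.
have : (M%:E < limf_einf (fun u => L u / (u `^ p)%:E)%E (pinfty_nbhs R))%E by rewrite Lp ltry.
rewrite limf_einfE => /ereal_sup_gt[_ [B [A [rA AB]] <-]] MB.
exists (Num.max A 1); first by rewrite le_max lexx orbT.
move=> u; rewrite gt_max => /andP[Au u1].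
have u0 : 0 < u by exact: lt_trans u1.
have up : 0 < u `^ p by exact: powR_gt0.
have : (M%:E <= L u / (u `^ p)%:E)%E.
  by apply: (ltW (lt_le_trans MB _)); apply: ereal_inf_lbound; exists u => //; exact: AB.
have := L0 (ltW u0); case: (L u) => [l _|_|]; last by rewrite leNgt ltNyr.
  by rewrite inver gt_eqF// -EFinM !lee_fin ler_pdivlMr.
by rewrite leey.
Qed.

(** The value at [u = 0] gives the sign. Beyond some [U >= 1] one has [L u >= v0 * u^p >= v0 * u],
    so only [u <= U] can contribute a positive amount. *)
Lemma conjugate_fin : exists2 y : R, conjugate L v0%:E = y%:E & 0 <= y.
Proof.
have c0 : (0 <= conjugate L v0%:E)%E.
  apply: ereal_sup_ubound; exists 0 => //=; by rewrite L00 mul0e sube0.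
have [U U1 HU] := penalty_growth v0.
have cU : (conjugate L v0%:E <= (U * v0)%:E)%E.
  apply: ge_ereal_sup => _ [u /= u0 <-].
  have [uU|Uu] := leP u U.
    apply: (@le_trans _ _ (u%:E * v0%:E)%E).
      have := L0 u0; case: (L u) => [l l0|_|//]; last by rewrite leNye.
      by rewrite -EFinM -EFinB lee_fin lerBlDr lerDl.
    by rewrite -EFinM lee_fin ler_wpM2r.
  have u1 : 1 <= u by rewrite (le_trans U1)// ltW.
  apply: (@le_trans _ _ 0%E); last by rewrite lee_fin mulr_ge0// (le_trans _ U1).
  have : ((u * v0)%:E <= L u)%E.
    apply: le_trans (HU u Uu); rewrite lee_fin mulrC ler_wpM2l//.
    by rewrite -{1}(powRr1 u0) ler_powR// ltW.
  rewrite -EFinM; have := L0 u0; case: (L u) => [l _|_ _|//]; last by rewrite leNye.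
  by rewrite -EFinB !lee_fin subr_le0.
have := c0; have := cU; case: (conjugate L _) => [y _ y0| |]//.
by exists y.
Qed.

Lemma conjugate_le (y u l : R) : conjugate L v0%:E = y%:E -> 0 <= u -> L u = l%:E -> u * v0 - l <= y.
Proof.
move=> yE u0 lE; rewrite -lee_fin -yE; apply: ereal_sup_ubound; exists u => //.
by rewrite lE EFinB.
Qed.

Lemma conjugate_adherent (y e : R) : conjugate L v0%:E = y%:E -> 0 < e ->
  exists (u l : R), [/\ 0 <= u, 0 <= l, L u = l%:E & y - e <= u * v0 - l].
Proof.
move=> yE e0; have : ((y - e)%:E < conjugate L v0%:E)%E by rewrite yE lte_fin ltrBlDr ltrDl.
move=> /ereal_sup_gt[_ [u /= u0 <-]]; have := L0 u0.
case lE : (L u) => [l| |]// l0.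
by rewrite -EFinM -EFinB lte_fin => /ltW h; exists u, l.
Qed.

End Penalty.

Lemma expectationEx d0 (T : measurableType d0) (R : realType) (P : probability T R) (g : T -> R) :
  intg P g -> ('E_P[g] = (Ex P g)%:E)%E.
Proof. by move=> Ig; rewrite unlock ExE. Qed.

Lemma upper_arith (R : realType) (y l u v e1 eta e dl U E : R) : 0 < e -> 0 < dl -> 0 <= u -> u <= U -> 0 <= v ->
  0 < U -> 0 < eta -> eta <= 1 ->
  e1 * (U + 1) = e / 4 -> 0 < e1 -> v * eta <= e / 4 -> u * v - l <= y ->
  E <= (v + e1) * ((u + eta) * dl) + e / 4 * dl -> E <= dl * (y + e) + dl * l.
Proof.
move=> e0 dl0 u0 uU v0 U0 eta0 eta1 e1E e10 veta h1 h2; apply: (le_trans h2).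
have h3 : e1 * (u + eta) <= e / 4 by rewrite -e1E ler_wpM2l ?(ltW e10)// lerD.
rewrite -mulrDr [leRHS]mulrC mulrA -mulrDl ler_wpM2r ?(ltW dl0)//.
rewrite mulrDl mulrDr [v * u]mulrC.
by clear -h1 h3 veta e0; lra.
Qed.

Lemma sub_arith (R : realType) (a b c e : R) : a - b <= c + e -> a - e <= b + c.
Proof. by move=> H; lra. Qed.

Lemma lower_arith_value (R : realType) (y e u v l J dl E : R) : 0 < e -> 0 <= u -> 0 < dl ->
  y - e / 3 <= u * v - l -> v - e / 3 / (u + 1) <= J ->
  dl * (u * J - e / 3) <= E -> dl * (y - e) + dl * l <= E.
Proof.
move=> e0 u0 dl0 h1 h2 h3; apply: le_trans h3; rewrite -mulrDr ler_wpM2l ?(ltW dl0)//.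
have u1 : 0 < u + 1 by rewrite ltr_wpDl.
have h4 : u * (e / 3 / (u + 1)) <= e / 3.
  by rewrite mulrCA ler_piMr ?divr_ge0 ?(ltW e0)// ler_pdivrMr// mul1r lerDl.
have h5 : u * (v - e / 3 / (u + 1)) <= u * J by exact: ler_wpM2l.
rewrite mulrBr in h5.
by clear -h1 h4 h5 e0; lra.
Qed.

Lemma lower_arith_penalty (R : realType) (a b x dl l l' : R) : 0 <= dl -> l' <= l ->
  x + dl * l <= a - b -> b + x <= a - dl * l'.
Proof. by move=> dl0 h1 h2; have := ler_wpM2l dl0 h1; lra. Qed.

Section Value.
Variables (R : realType) (N d : nat) (p q C : R) (f : 'M[R]_(N, d) -> R).
Local Notation XX := (pathspace R N d).
Local Notation XX2 := (XX * XX)%type.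
Local Notation MM := 'M[R]_(N, d).
Variable mu : probability XX R.
Hypotheses (p1 : 1 < p) (qE : q = p / (p - 1)) (f1 : C1 f).
Hypothesis fC : forall x : MM, `|DD f x| <= C * (1 + `|x| `^ (p - 1)).
Hypothesis mm : martingale_measure mu.
Hypothesis mp : intg mu (fun x : XX => `|x : MM| `^ p).
Variable L : R -> \bar R.
Hypothesis L0 : forall u, 0 <= u -> (0 <= L u)%E.
Hypothesis Lmono : forall u v, 0 <= u -> u <= v -> (L u <= L v)%E.
Hypothesis L00 : L 0 = 0%E.
Hypothesis Lp : limf_einf (fun u => L u / (u `^ p)%:E)%E (pinfty_nbhs R) = +oo%E.

Local Notation W := (fun z : XX2 => (z.2 : MM) - (z.1 : MM)).
Let p0 : 0 < p. Proof. exact: lt_trans p1. Qed.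
Let q0 : 0 < q. Proof. exact: q_gt0 p1 qE. Qed.

Lemma cost_incp (x y : XX) : cost p x y = incp p ((y : MM) - (x : MM)).
Proof.
rewrite costE; last by rewrite gt_eqF.
apply: eq_bigr => k _; apply: eq_bigr => i _.
by rewrite !incB distrC.
Qed.

Lemma measurable_incpw : measurable_fun setT (fun z : XX2 => incp p (W z)).
Proof.
apply: measurable_sum => k; apply: measurable_sum => i.
exact: measurable_powR_comp (measurable_incw k i).
Qed.

Lemma poweR_fin (D : \bar R) (r : R) : (0 <= D)%E -> (D `^ p^-1 = r%:E)%E ->
  0 <= r /\ D = (r `^ p)%:E.
Proof.
have pV : p^-1 != 0 by rewrite invr_eq0 gt_eqF.
case: D => [D|_|]; last by [].
  by rewrite lee_fin poweR_EFin => D0 [<-]; split; [exact: powR_ge0|rewrite powRVK ?gt_eqF].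
by rewrite poweRyr.
Qed.

Lemma d_bc_ge0 (nu : probability XX R) : (0 <= d_bc p mu nu)%E.
Proof.
apply/ereal_infP => _ [pi _ <-]; apply: integral_ge0 => z _.
by rewrite lee_fin cost_incp incp_ge0.
Qed.

Lemma Ex_cost (pi : probability XX2 R) : intg pi (fun z : XX2 => incp p (W z)) ->
  (\int[pi]_z (cost p z.1 z.2)%:E)%E = (Ex pi (fun z : XX2 => incp p (W z)))%:E.
Proof. by move=> I; rewrite -ExE//; apply: eq_integral => z _; rewrite cost_incp. Qed.

Lemma near_optimal (nu : probability XX R) (r rho : R) : (d_bc p mu nu = (r `^ p)%:E)%E -> 0 <= r -> r < rho ->
  exists pi : probability XX2 R, [/\ bicausal mu nu pi,
    intg pi (fun z : XX2 => incp p (W z)) & Ex pi (fun z : XX2 => incp p (W z)) <= rho `^ p].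
Proof.
move=> dE r0 rr; have : (d_bc p mu nu < (rho `^ p)%:E)%E.
  by rewrite dE lte_fin gt0_ltr_powR ?nnegrE// (le_trans r0)// ltW.
move=> /ereal_inf_lt[_ [pi bpi <-]] H.
have I : intg pi (fun z : XX2 => incp p (W z)).
  apply: intg_ge0; [exact: measurable_incpw|by move=> z; exact: incp_ge0|].
  apply: le_lt_trans (_ : (_ < +oo)%E); last exact: (lt_trans H (ltry _)).
  by apply: eq_ler; apply: eq_integral => z _; rewrite cost_incp.
exists pi; split => //; move: H; rewrite Ex_cost// lte_fin; exact: ltW.
Qed.

Local Notation v0 := (Jtot q f mu `^ q^-1).

Lemma V_le (y e : R) : conjugate L v0%:E = y%:E -> 0 <= y -> 0 < e ->
  exists2 d0 : R, 0 < d0 & forall dl, 0 < dl < d0 ->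
    (V p L f mu dl <= (Ex mu (f : XX -> R) + dl * (y + e))%:E)%E.
Proof.
move=> yE y0 e0; have vv : 0 <= v0 by exact: powR_ge0.
have [A A0 HA] := increase_le_large p1 qE f1 fC mp.
(* For [u > U >= 1], [A (u + 1)^p <= A 2^p u^p <= L u], so beyond [U] the penalty outweighs the
   whole increase of the expectation. *)
have [U U1 HU] := penalty_growth L0 Lp (A * 2 `^ p).
have U0 : 0 < U by exact: lt_le_trans U1.
have U10 : 0 < U + 1 by rewrite addr_gt0.
have e4 : 0 < e / 4 by rewrite divr_gt0.
pose e1 := e / 4 / (U + 1); have e10 : 0 < e1 by rewrite divr_gt0.
have e1E : e1 * (U + 1) = e / 4 by rewrite divfK// gt_eqF.
have v1 : 0 < v0 + 1 by rewrite ltr_wpDl.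
(* The infimum in [d_bc] need not be attained; a coupling of cost at most [((u + eta) * dl)^p] is
   used instead, and the slack costs at most [v0 * eta <= e / 4]. Likewise [e1] is the slack in the
   infimum over predictable processes. *)
pose eta := Num.min 1 (e / 4 / (v0 + 1)).
have eta0 : 0 < eta by rewrite lt_min ltr01 divr_gt0.
have eta1 : eta <= 1 by rewrite ge_min lexx.
have veta : v0 * eta <= e / 4.
  apply: (@le_trans _ _ ((v0 + 1) * (e / 4 / (v0 + 1)))); last by rewrite mulrC divfK// gt_eqF.
  by apply: ler_pM => //; [exact: ltW|rewrite lerDl|rewrite ge_min lexx orbT].
have ve1 : 0 < v0 + e1 by rewrite ltr_wpDl.
have h0 : 0 < (v0 + e1) `^ q - v0 `^ q.
  by rewrite subr_gt0 gt0_ltr_powR ?nnegrE ?(ltW ve1)// ltrDl.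
have [h Hh] := Jtot_adherent p1 qE f1 fC mp h0.
rewrite {1}(_ : Jtot q f mu = v0 `^ q); last by rewrite powRVK ?gt_eqF// Jtot_ge0.
rewrite addrC subrK => He.
have [d1 d10 Hd] := increase_le_small p1 qE f1 fC mm mp (fun k i => (Hh k i).1) (fun k i => (Hh k i).2) ve1 U10 e4 He.
exists (Num.min d1 1); first by rewrite lt_min d10 ltr01.
move=> dl; rewrite lt_min => /andP[dl0 /andP[dld1 dl1]].
apply: ge_ereal_sup => _ [nu mnu <-].
set pen := penalty _ _ _ => /=; case: (eqVneq pen +oo%E) => [_|]; first by rewrite leNye.
(* A finite penalty forces [d_bc] to be finite. A coupling of finite cost then exists, and it makes
   [f] integrable under [nu]. *)
rewrite /pen /penalty; case rE : (d_bc p mu nu `^ p^-1)%E => [r| |]//.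
have [r0 dE] := poweR_fin (d_bc_ge0 nu) rE.
have u0 : 0 <= r / dl by rewrite divr_ge0// ltW.
have := L0 u0; case lE : (L (r / dl)) => [l| |]//; last by rewrite gt0_muley ?lte_fin.
rewrite lee_fin => l0 _.
set u := r / dl in u0 lE.
have ru : r = u * dl by rewrite /u divfK// gt_eqF.
have dlz : dl != 0 by rewrite gt_eqF.
suff [If H] : intg nu (f : XX -> R) /\
    Ex nu (f : XX -> R) - Ex mu (f : XX -> R) <= dl * (y + e) + dl * l.
  rewrite expectationEx// -EFinM -EFinB lee_fin; exact: (sub_arith H).
have [uU|Uu] := leP u U.
  have rr : r < (u + eta) * dl by rewrite ru ltr_pM2r// ltrDl.
  have [pi [bpi Ipi Epi]] := near_optimal dE r0 rr.
  have [[c1 c2] _ _] := bpi.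
  split; first exact: (intg_f_nu p1 qE f1 fC mp c1 c2 Ipi).
  have u1 : 0 < u + eta by rewrite ltr_wpDl.
  apply: (upper_arith e0 dl0 u0 uU vv U0 eta0 eta1 e1E e10 veta (conjugate_le yE u0 lE)).
  apply: (Hd nu pi dl ((u + eta) * dl)) => //; first by rewrite dl0 dld1.
  by rewrite mulr_gt0//= ler_pM2r// lerD.
have u1 : 1 <= u by rewrite (le_trans U1)// ltW.
have rr : r < (u + 1) * dl by rewrite ru ltr_pM2r// ltrDl.
have [pi [bpi Ipi Epi]] := near_optimal dE r0 rr.
have [cpi _ _] := bpi.
have [] := HA nu pi dl ((u + 1) * dl) cpi Ipi Epi.
  by rewrite dl0 ltW.
  by rewrite ler_peMl ?(ltW dl0)// lerDr.
move=> If H; split => //; apply: (le_trans H); rewrite mulfK//.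
have h1 : A * (u + 1) `^ p <= l.
  have := HU u Uu; rewrite lE lee_fin; apply: le_trans; rewrite -mulrA ler_wpM2l// -powRM//.
  by apply: powR_mono; [exact: ltW|rewrite addr_ge0|rewrite mulr_natl mulr2n lerD2l].
rewrite mulrC (le_trans (ler_wpM2l (ltW dl0) h1))// lerDr mulr_ge0// ?(ltW dl0)//.
by rewrite addr_ge0// ltW.
Qed.

Lemma V_ge (y e : R) : conjugate L v0%:E = y%:E -> 0 < e ->
  exists2 d0 : R, 0 < d0 & forall dl, 0 < dl < d0 ->
    ((Ex mu (f : XX -> R) + dl * (y - e))%:E <= V p L f mu dl)%E.
Proof.
move=> yE e0; have e3 : 0 < e / 3 by rewrite divr_gt0.
(* A near-maximizer [u] in the conjugate determines the size [u * dl] of the perturbation. *)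
have [u [l [u0 l0 lE hy]]] := conjugate_adherent L0 yE e3.
have u1 : 0 < u + 1 by rewrite ltr_wpDl.
(* The error in the duality is multiplied by [u] later, hence the division by [u + 1], which is
   positive even for [u = 0]. *)
have e31 : 0 < e / 3 / (u + 1) by rewrite divr_gt0.
have [phi [m [K [B [[K0 lphi phiF [phiB mB]] [rm cP hP hG]]]]]] := dual_normalized p1 qE f1 fC mp e31.
have [d0 d00 Hd] := increase_ge p1 qE f1 fC mm mp K0 lphi phiF phiB rm mB cP u0 e3 hP.
exists d0 => // dl /[dup] dlI /andP[dl0 _].
have [nu [pi [mnu bpi Ipi Epi [If H]]]] := Hd dl dlI.
have {}H := lower_arith_value e0 u0 dl0 hy hG H.
have dle : (d_bc p mu nu <= ((u * dl) `^ p)%:E)%E.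
  by apply: ge_ereal_inf; exists (\int[pi]_z (cost p z.1 z.2)%:E)%E; [exists pi|rewrite Ex_cost// lee_fin].
have [D D0 dE] : exists2 D : R, 0 <= D & d_bc p mu nu = D%:E.
  by have := d_bc_ge0 nu; case: (d_bc p mu nu) dle => [D _ D0| |]//; exists D.
rewrite dE lee_fin in dle.
have rle : D `^ p^-1 <= u * dl.
  rewrite -[leRHS](@powRK _ p) ?gt_eqF ?mulr_ge0 ?(ltW dl0)//.
  by apply: powR_mono => //; rewrite invr_ge0 ltW.
(* The perturbation bounds the distance by [u * dl] only from above; monotonicity of [L] turns this
   into a bound on the penalty. *)
have Lle : (L (D `^ p^-1 / dl) <= l%:E)%E.
  by rewrite -lE; apply: Lmono; rewrite ?divr_ge0 ?powR_ge0 ?(ltW dl0)// ler_pdivrMr.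
have Lge : (0 <= L (D `^ p^-1 / dl))%E by apply: L0; rewrite divr_ge0 ?powR_ge0 ?(ltW dl0).
have [l' l'E] : exists l', L (D `^ p^-1 / dl) = l'%:E.
  by move: Lle Lge; case: (L _) => [l' _ _| |]//; exists l'.
rewrite l'E lee_fin in Lle.
apply: (@le_trans _ _ ('E_nu[f] - penalty L dl (d_bc p mu nu `^ p^-1))%E); last first.
  apply: ereal_sup_ubound; exists nu => //=.
  by rewrite dE poweR_EFin /penalty l'E -EFinM.
rewrite expectationEx// dE poweR_EFin /penalty l'E -EFinM -EFinB lee_fin.
exact: (lower_arith_penalty (ltW dl0) Lle H).
Qed.

End Value.

Section Quadratic.
Variables (R : realType) (N d : nat) (p q C : R) (f : 'M[R]_(N, d) -> R).
Local Notation XX := (pathspace R N d).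
Local Notation MM := 'M[R]_(N, d).
Variable mu : probability XX R.
Hypotheses (p1 : 1 < p) (qE : q = p / (p - 1)) (f1 : C1 f).
Hypothesis fC : forall x : MM, `|DD f x| <= C * (1 + `|x| `^ (p - 1)).
Hypothesis mp : intg mu (fun x : XX => `|x : MM| `^ p).
Hypotheses (p2 : p = 2) (q2 : q = 2).

Local Notation G := (Gf f mu).
Local Notation Gspec := (Gf_spec p1 qE f1 fC mp).
Let q0 : 0 < q. Proof. exact: q_gt0 p1 qE. Qed.

Let H k i := condE mu (Ft (prev_time k)) (Df f k i).

Let Hspec k i := condE_spec (prev_time k) (intg_Df p1 qE f1 fC mp k i).

Let predH : predictable q mu H.
Proof.
move=> k i; have [rH IH cH] := Hspec k i; split; first exact: rH.
by have [] := condexp_pow p1 qE (intg_Df p1 qE f1 fC mp k i) rH IH cH (intg_Dfq p1 qE f1 fC mp k i).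
Qed.

(* Pythagoras: [H k i] is the [L^2] projection of [G k i]. *)
Lemma Jinf_projection (k : 'I_N) (i : 'I_d) :
  Jinf q mu k (G k i) = Ex mu (fun x => `|G k i x - H k i x| `^ q).
Proof.
apply/eqP; rewrite eq_le (Jinf_le (G k i) (predH k i))/=.
have [rH IH cH] := Hspec k i; have [rG IG cG] := Gspec k i.
have ID := intg_Df p1 qE f1 fC mp k i.
(* Tower property: [D - G] is centered given time [k + 1], hence given time [k], and so is
   [D - H]. *)
have c : cF mu k (fun x => G k i x - H k i x).
  move=> A mA; have h1 := cF_le (leqnSn k) cG mA; have h2 := cH A mA.
  transitivity (Ex mu (fun x => (Df f k i x - H k i x) * \1_A (trunc k x)) -
      Ex mu (fun x => (Df f k i x - G k i x) * \1_A (trunc k x))); last first.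
    by rewrite h1 [X in X - _]h2 subrr.
  rewrite -ExB.
  - by apply: Ex_eq => x; ring.
  - under eq_fun do rewrite -indic_preim.
    by apply: (intgMi (measurable_preim (@measurable_trunc R N d k) mA)); exact: intgB.
  - under eq_fun do rewrite -indic_preim.
    by apply: (intgMi (measurable_preim (@measurable_trunc R N d k) mA)); exact: intgB.
apply: lb_le_inf; first exact: (has_inf_dists q mu k (G k i)).1.
move=> _ [h [rh Ih] <-].
have I1 : intg mu (fun x => `|G k i x - H k i x| `^ q).
  exact: (intg_Lq_sub p1 qE rG.1 (intg_Gfq p1 qE f1 fC mp k i) (predH k i)).
have I2 : intg mu (fun x => `|G k i x - h x| `^ q).
  exact: (intg_Lq_sub p1 qE rG.1 (intg_Gfq p1 qE f1 fC mp k i) (conj rh Ih)).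
have I3 : intg mu (fun x => `|H k i x - h x| `^ q).
  exact: (intg_Lq_sub p1 qE rH.1 (predH k i).2 (conj rh Ih)).
have mGH : measurable_fun setT (fun x => G k i x - H k i x).
  by apply: measurable_funB; [exact: rG.1|exact: rH.1].
have mHh : measurable_fun setT (fun x => H k i x - h x).
  by apply: measurable_funB; [exact: rH.1|exact: rh.1].
have I4 : intg mu (fun x => (G k i x - H k i x) * (H k i x - h x)).
  by apply: (intg_young p1 qE mGH mHh I1); rewrite p2 -q2.
have rHh : rF k (fun x => H k i x - h x).
  split=> // x; rewrite rh.2; congr (_ - _); exact: (rH.2 x).
have E0 : Ex mu (fun x => (G k i x - H k i x) * (H k i x - h x)) = 0.
  by apply: (centered_orth _ c rHh I4); exact: intgB.
rewrite -[leLHS]addr0 -(mulr0 2) -E0 -ExZ// -ExD//; last exact: intgZ.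
apply: Ex_le => //; first by apply: intgD => //; exact: intgZ.
move=> x; rewrite q2 !powR_mulrn ?normr_ge0// !real_normK ?num_real//.
by rewrite -subr_ge0 (_ : _ - _ = (H k i x - h x) ^+ 2) ?sqr_ge0//; ring.
Qed.

Lemma Upsilon_quadratic (L : R -> \bar R) : Upsilon q L f mu = Upsilon2 q L f mu.
Proof.
rewrite /Upsilon (dist_inf p1 qE f1 fC mp) /Upsilon2; congr (conjugate L _).
pose h (k : 'I_N) x := condE_rV mu (Ft (prev_time k)) (DD_ f k) x.
have hE : (fun k i x => h k x 0 i) = H.
  apply/funext => k; apply/funext => i; apply/funext => x; rewrite mxE /H.
  by congr (condE mu _ _ x); apply/funext => y; rewrite /Df mxE.
have Hh : HH q mu h by apply/(HH_predictable mu p1 qE); rewrite hE; exact: predH.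
rewrite -[in RHS]q2 [RHS](dist_powR p1 qE f1 fC mp Hh); congr (_ `^ _)%:E.
rewrite (@Ex_sum2 _ XX R mu N d (fun k i x => `|G k i x - h k x 0 i| `^ q)).
  apply: eq_bigr => k _; apply: eq_bigr => i _; rewrite Jinf_projection.
  by apply: Ex_eq => x; congr (`|_ - _| `^ _); rewrite -hE.
by move=> k i; exact: (intg_dist p1 qE f1 fC mp k i ((HH_predictable mu p1 qE h).1 Hh)).
Qed.

End Quadratic.

Theorem theorem4p6 (R : realType) (N d : nat) (p q : R)
    (mu : probability (pathspace R N d) R)
    (L : R -> \bar R) (f : 'M[R]_(N, d) -> R) (C : R) :
  (0 < N)%N -> (0 < d)%N -> 1 < p -> q = p / (p - 1) ->
  martingale_measure mu ->
  (\int[mu]_x (`|x : 'M[R]_(N, d)| `^ p)%:E < +oo)%E ->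
  (forall u, 0 <= u -> (0 <= L u)%E) ->
  {within [set u : R | 0 <= u], continuous L} ->
  (forall u v, 0 <= u -> u <= v -> (L u <= L v)%E) ->
  L 0 = 0%E ->
  limf_einf (fun u => L u / (u `^ p)%:E)%E (pinfty_nbhs R) = +oo%E ->
  C1 f ->
  (forall x, `|DD f x| <= C * (1 + `|x| `^ (p - 1))) ->
  ('E_mu[f])%E \is a fin_num /\
  Upsilon q L f mu \is a fin_num /\
  (exists2 r : R -> R, r =o_ (0^'+) (fun delta : R => delta) &
    \forall delta \near 0^'+,
      V p L f mu delta =
        ('E_mu[f] + Upsilon q L f mu * delta%:E + (r delta)%:E)%E) /\
  (p = 2 -> Upsilon q L f mu = Upsilon2 q L f mu).
Proof.
move=> _ _ p1 qE mm mp' L0 _ Lmono L00 Lp f1 fC.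
have mp : intg mu (fun x : pathspace R N d => `|x : 'M[R]_(N, d)| `^ p).
  by apply: intg_ge0 => //; apply: (measurableT_comp (measurable_powR p)); exact: measurable_norm_path.
have EE := expectationEx (intg_f_mu p1 qE f1 fC mp).
have vv : 0 <= Jtot q f mu `^ q^-1 by exact: powR_ge0.
have UE : Upsilon q L f mu = conjugate L (Jtot q f mu `^ q^-1)%:E.
  by rewrite /Upsilon (dist_inf p1 qE f1 fC mp).
have [y yE y0] := conjugate_fin p1 vv L0 L00 Lp.
split; first by rewrite EE.
split; first by rewrite UE yE.
split; last first.
  move=> p2; have q2 : q = 2 by rewrite qE p2; field.
  exact: (Upsilon_quadratic p1 qE f1 fC mp p2 q2).
set E := Ex mu f in EE.
have close e : 0 < e -> \forall dl \near 0^'+,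
    ((E + dl * (y - e))%:E <= V p L f mu dl <= (E + dl * (y + e))%:E)%E.
  move=> e0.
  have [d1 d10 H1] := V_le p1 qE f1 fC mm mp L0 Lp yE y0 e0.
  have [d2 d20 H2] := V_ge p1 qE f1 fC mm mp L0 Lmono yE e0.
  near=> dl; have dl0 : 0 < dl by near: dl; exact: nbhs_right_gt.
  rewrite H1 ?H2 ?dl0//=; near: dl; exact: nbhs_right_lt.
(* The remainder below is defined through [fine], so the expansion can be an equality only where the
   value is finite; the two-sided bound with [e = 1] gives this near 0. *)
have fin : \forall dl \near 0^'+, V p L f mu dl \is a fin_num.
  near=> dl; have /andP[] : ((E + dl * (y - 1))%:E <= V p L f mu dl <= (E + dl * (y + 1))%:E)%E.
    by near: dl; exact: close.
  by case: (V p L f mu dl).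
exists (fun dl => fine (V p L f mu dl) - E - y * dl).
  apply/eqoP => e e0; near=> dl.
  have dl0 : 0 < dl by near: dl; exact: nbhs_right_gt.
  have Vf : V p L f mu dl \is a fin_num by near: dl.
  have : ((E + dl * (y - e))%:E <= V p L f mu dl <= (E + dl * (y + e))%:E)%E.
    by near: dl; exact: close.
  rewrite -(fineK Vf) !lee_fin => /andP[h1 h2].
  rewrite (gtr0_norm dl0) ler_norml; apply/andP; split.
    by move: h1; rewrite mulrBr [dl * y]mulrC [dl * e]mulrC; clear; lra.
  by move: h2; rewrite mulrDr [dl * y]mulrC [dl * e]mulrC; clear; lra.
near=> dl.
have Vf : V p L f mu dl \is a fin_num by near: dl.
rewrite UE yE EE -(fineK Vf) -EFinM -!EFinD /=; congr EFin; ring.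
Unshelve. all: by end_near. Qed.
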